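(* Let $\mu$ be a bounded perturbation of the uniform distribution on $[a,b]$. For an integer $n\ge1$ let $(X_P,w_P)$, with nodes $x_1,\dots,x_n$ and weights $w_1,\dots,w_n$, be the Poincaré quadrature with $n$ nodes and order $M=2n-1$, and let $\mathrm{wce}(n)=\mathrm{wce}(X_P,w_P,H^1(\mu))$ be its worst-case error in $H^1(\mu)$. Then $$\mathrm{wce}(n)^2=\sum_{m\ge M+1}\alpha_m\left(\sum_{i=1}^n w_i\varphi_m(x_i)\right)^2,$$ and $$\mathrm{wce}(n)^2=w_P^\top\bigl(K(X_P,X_P)-K_M(X_P,X_P)\bigr)w_P$$ $$=\mathbb{1}^\top K_M(X_P,X_P)^{-1}\bigl(K(X_P,X_P)-K_M(X_P,X_P)\bigr)K_M(X_P,X_P)^{-1}\mathbb{1}.$$ Furthermore, for all $n$, $$\mathrm{wce}(n)\le\sqrt{\|K-K_{2n-1}\|_\infty},$$ which goes to zero when $n$ tends to infinity.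
   Context: Let $-\infty<a<b<\infty$. A probability distribution $\mu$ on $[a,b]$ is a bounded perturbation of the uniform distribution if it has a density $\rho$ that is positive, continuous and piecewise $C^1$ on $[a,b]$. Write $\|f\|^2=\int_a^b f^2\,d\mu$, $\langle f,g\rangle=\int_a^b fg\,d\mu$, $H^1(\mu)=\{f\in L^2(\mu): f'\in L^2(\mu)\}$ (weak derivatives; elements identified with their continuous representatives), with norm $\|f\|_{H^1(\mu)}^2=\|f\|^2+\|f'\|^2$. With this norm $H^1(\mu)$ is a reproducing kernel Hilbert space. Poincaré basis: the problem of finding $f\in H^1(\mu)$ and $\lambda$ with $\langle f',g'\rangle=\lambda\langle f,g\rangle$ for all $g\in H^1(\mu)$ has simple eigenvalues $0=\lambda_0<\lambda_1<\cdots\to\infty$; the $L^2(\mu)$-normalized eigenfunctions $(\varphi_m)_{m\ge0}$ (unique up to sign, $\varphi_0=1$) form an orthonormal basis of $L^2(\mu)$ and are continuous. Set $\alpha_m=(1+\lambda_m)^{-1}$. $K$ denotes the reproducing kernel of $H^1(\mu)$, which is continuous on $[a,b]^2$ with Mercer representation $K(x,y)=\sum_{m\ge0}\alpha_m\varphi_m(x)\varphi_m(y)$, and $K_M(x,y)=\sum_{m=0}^M\alpha_m\varphi_m(x)\varphi_m(y)$. For $X=(x_1,\dots,x_n)\in[a,b]^n$ and $w\in\mathbb{R}^n$, $\mathrm{wce}(X,w,\mathcal{H})=\sup_{h\in\mathcal{H},\|h\|_{\mathcal{H}}\le1}\left|\int h\,d\mu-\sum_{i=1}^n w_ih(x_i)\right|$.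 For a kernel $\kappa$, $\kappa(X,X)=(\kappa(x_i,x_j))_{1\le i,j\le n}$. $\mathbb{1}$ is the vector of ones of length $n$, and $\|\cdot\|_\infty$ is the supremum norm on $[a,b]^2$. The Poincaré quadrature $(X_P,w_P)$ with $n$ nodes (order $2n-1$) is the unique quadrature with $n$ nodes in $[a,b]$ and positive weights that is exact for $\varphi_0,\dots,\varphi_{2n-1}$, i.e. $\int\varphi_m\,d\mu=\sum_i w_i\varphi_m(x_i)$ for $0\le m\le2n-1$ (existence and uniqueness are known because the Poincaré basis is, up to signs, a Tchebytchev system). For distinct nodes with $n\le M+1$ the matrix $K_M(X,X)$ is known to be invertible. *)

(* Defs.v *)
(* MathComp-Analysis. Functions on [a, b] are represented by functions R -> R;
   every notion below depends only on their restriction to [a, b]. *)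
From HB Require Import structures.
From mathcomp Require Import all_boot all_order all_algebra.
From mathcomp Require Import all_classical all_reals all_analysis.

Set Implicit Arguments.
Unset Strict Implicit.
Unset Printing Implicit Defensive.
Import Order.TTheory GRing.Theory Num.Theory.
Import numFieldNormedType.Exports.

Local Open Scope classical_set_scope.
Local Open Scope ring_scope.

Section BoundedPerturbation.
Context {R : realType}.
Variables (a b : R).

(* On each piece [c, d] the derivative extends continuously to the closed
   interval; together with the continuity of rho this says that the restriction
   of rho to [c, d] is C^1, with one-sided derivatives at c and d. *)
Definition piecewise_C1 (rho : R -> R) : Prop :=
  exists2 s : seq R, itv_partition a b s &
    forall i, (i < size s)%N ->
      let c := nth b (a :: s) i in
      let d := nth b (a :: s) i.+1 in
      exists2 drho : R -> R, {within `[c, d], continuous drho} &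
        forall x, x \in `]c, d[ -> is_derive x 1 rho (drho x).

(* mu is a probability on the Borel sets of R; the density formula forces it to
   be carried by [a, b] and rho to have integral 1 there. *)
Definition bounded_perturbation (mu : probability (measurableTypeR R) R) : Prop :=
  exists rho : R -> R,
    [/\ forall x, x \in `[a, b] -> 0 < rho x,
        {within `[a, b], continuous rho},
        piecewise_C1 rho &
        forall A : set (measurableTypeR R), measurable A ->
          mu A = (\int[lebesgue_measure]_(x in A `&` `[a, b]) (rho x)%:E)%E].

End BoundedPerturbation.

Section Sobolev.
Context {R : realType}.
Variables (a b : R) (mu : probability (measurableTypeR R) R).

Definition L2 (f : R -> R) : Prop := (f \_ `[a, b]) \in Lfun mu 2%:E.

Definition L2ip (f g : R -> R) : R := \int[mu]_(x in `[a, b]) (f x * g x).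

Definition L2norm (f : R -> R) : R := Num.sqrt (L2ip f f).

(* C^1 functions with compact support in ]a, b[, the test functions used for
   Sobolev spaces on an interval in Brezis, Functional Analysis, Sobolev Spaces
   and Partial Differential Equations, Section 8.2. *)
Definition test_function (psi : R -> R) : Prop :=
  [/\ forall x, derivable psi x 1,
      continuous (derive1 psi) &
      exists c d, [/\ a < c, d < b & forall x, x \notin `[c, d] -> psi x = 0]].

(* Weak derivative with respect to the Lebesgue measure. *)
Definition is_weak_derivative (f g : R -> R) : Prop :=
  [/\ locally_integrable `]a, b[ f, locally_integrable `]a, b[ g &
      forall psi, test_function psi ->
        \int[lebesgue_measure]_(x in `]a, b[) (f x * derive1 psi x) =
        - \int[lebesgue_measure]_(x in `]a, b[) (g x * psi x)].

(* A version of f' (two versions agree almost everywhere); it is the zero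
   function when f has no weak derivative. *)
Definition weak_derivative (f : R -> R) : R -> R :=
  xget (cst 0) [set g | is_weak_derivative f g].

(* The elements of H^1(mu) are identified with their continuous
   representatives. *)
Definition H1 : set (R -> R) :=
  [set f | [/\ {within `[a, b], continuous f}, L2 f &
               exists2 g, is_weak_derivative f g & L2 g]].

Definition H1ip (f g : R -> R) : R :=
  L2ip f g + L2ip (weak_derivative f) (weak_derivative g).

Definition H1norm (f : R -> R) : R := Num.sqrt (H1ip f f).

Definition poincare_eigenpair (l : R) (f : R -> R) : Prop :=
  H1 f /\ forall g, H1 g ->
    L2ip (weak_derivative f) (weak_derivative g) = l * L2ip f g.

(* Eigenvalues, in increasing order, and normalized eigenfunctions; the last
   two fields say that every eigenvalue occurs in the list and is simple, and
   that the eigenfunctions are complete in L^2(mu). *)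
Record poincare_basis (lambda : nat -> R) (phi : nat -> R -> R) : Prop := {
  poincare_lambda0 : lambda 0%N = 0;
  poincare_lambda_lt : forall m, lambda m < lambda m.+1;
  poincare_lambda_cvg : lambda m @[m --> \oo] --> +oo%R;
  poincare_phi0 : forall x, x \in `[a, b] -> phi 0%N x = 1;
  poincare_eigen : forall m, poincare_eigenpair (lambda m) (phi m);
  poincare_orthonormal : forall i j, L2ip (phi i) (phi j) = (i == j)%:R;
  poincare_simple : forall l f, poincare_eigenpair l f ->
    (exists2 x, x \in `[a, b] & f x != 0) ->
    exists m c, l = lambda m /\ forall x, x \in `[a, b] -> f x = c * phi m x;
  poincare_complete : forall f, L2 f ->
    L2norm (fun x => f x - \sum_(m < N) L2ip f (phi m) * phi m x)
      @[N --> \oo] --> (0 : R) }.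

End Sobolev.

Section Quadrature.
Context {R : realType}.
Variables (a b : R) (mu : probability (measurableTypeR R) R).

Definition reproducing_kernel (D : set R) (H : set (R -> R))
    (ip : (R -> R) -> (R -> R) -> R) (K : R -> R -> R) : Prop :=
  forall y, D y -> H (K^~ y) /\ forall h, H h -> ip h (K^~ y) = h y.

Definition alpha (lambda : nat -> R) (m : nat) : R := (1 + lambda m)^-1.

Definition truncated_kernel (lambda : nat -> R) (phi : nat -> R -> R)
    (M : nat) (x y : R) : R :=
  \sum_(m < M.+1) alpha lambda m * phi m x * phi m y.

Definition quad n (X w : 'cV[R]_n) (h : R -> R) : R :=
  \sum_(i < n) w i 0 * h (X i 0).

(* Extended-real valued, so that an unbounded supremum is +oo. *)
Definition wce n (X w : 'cV[R]_n) (H : set (R -> R)) (nrm : (R -> R) -> R)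
    : \bar R :=
  ereal_sup [set (`| \int[mu]_(x in `[a, b]) h x - quad X w h |)%:E
            | h in [set h | H h /\ nrm h <= 1]].

Definition kernel_mx (k : R -> R -> R) n (X : 'cV[R]_n) : 'M[R]_n :=
  \matrix_(i < n, j < n) k (X i 0) (X j 0).

Definition kernel_sup_norm (k : R -> R -> R) : \bar R :=
  ereal_sup [set (`| k p.1 p.2 |)%:E | p in `[a, b] `*` `[a, b]].

Definition poincare_quadrature (phi : nat -> R -> R) n (X w : 'cV[R]_n) : Prop :=
  [/\ forall i, X i 0 \in `[a, b],
      injective (fun i => X i 0),
      forall i, 0 < w i 0 &
      forall m, (m <= (2 * n).-1)%N ->
        \int[mu]_(x in `[a, b]) phi m x = quad X w (phi m)].

End Quadrature.

(* Main.v *)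
Require Import Defs.
From HB Require Import structures.
From mathcomp Require Import all_boot all_order all_algebra.
From mathcomp Require Import all_classical all_reals all_analysis.
From mathcomp Require Import measurable_realfun ring lra.

Set Implicit Arguments.
Unset Strict Implicit.
Unset Printing Implicit Defensive.
Import Order.TTheory GRing.Theory Num.Theory.
Import numFieldNormedType.Exports.

Local Open Scope classical_set_scope.
Local Open Scope ring_scope.

(* The functional [h |-> \int h - \sum_i w_i h(x_i)] is represented in H^1 by
   [1 - \sum_i w_i K(., x_i)], so wce^2 is the squared norm of this function.
   Exactness kills its components on phi_0, ..., phi_M and amounts to
   [K_M(X, X) w = 1], which gives all the formulas for wce^2.

   Uniform convergence of K_M: on the orthogonal complement of the first N
   eigenfunctions the H^1 norm is at least [sqrt (1 + lambda_N)] times the L^2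
   norm, so bounded H^1 functions there are small in L^2, hence uniformly small
   because they are equi-Holder.

   Invertibility of K_M(X, X) is a Sturm-Hurwitz argument.  If a nonzero [v] had
   [\sum_i v_i phi_m(x_i) = 0] for m < n, the first nonzero component of
   [k = \sum_i v_i K(., x_i)] would be at some m0 >= n.  Applying the p-th power
   of the resolvent to a long partial sum of the expansion of k and rescaling
   gives, as p grows, phi_m0, which alternates at m0 + 1 points by Sturm
   comparison.  By the maximum principle the resolvent does not create
   alternations, so k already alternates at n + 1 points; cutting it at its zeros
   gives n + 1 functions g with [\sum_i v_i g(x_i) = |g|^2 > 0] and disjoint
   supports, each containing a node, but there are only n nodes. *)

(** * Measures with a density *)

(** The density may have corners, so the equation (rho f')' = - lambda rho f is never read as a
    second-order equation: eigenfunctions are handled as pairs (f, F) with F = rho f', a first-order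
    system without any derivative of rho, with boundary conditions F(a) = F(b) = 0.

    Sign changes are counted by alternation with a margin e > 0 instead of zeros, because the
    argument passes between k, its partial sums and phi_m0 by uniform approximation, which respects
    a margin but not a number of zeros. The maximum principle needs a differentiable flux, whereas k
    has kinks at the nodes; this is why the resolvent acts on finite eigenfunction sums. Going back
    there from power p to power 0 costs nothing of the margin, so p is fixed first, then the margin,
    and last the length of the partial sum that approximates k.

    Invertibility of K_M(X, X) is established along the way because the last formula for wce^2
    contains [invmx], which returns its argument when the matrix is singular. *)

Lemma within_continuous_measurable (R : realType) (a b : R) (f : R -> R) :
  {within `[a, b], continuous f} -> measurable_fun `[a, b]%classic f.
Proof. by move=> cf; apply: subspace_continuous_measurable_fun. Qed.

Lemma within_continuous_integrable (R : realType) (a b : R) (f : R -> R) :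
  {within `[a, b], continuous f} ->
  (@lebesgue_measure R).-integrable `[a, b] (EFin \o f).
Proof. by move=> cf; apply: continuous_compact_integrable => //; exact: segment_compact. Qed.

Lemma within_continuous_bounded (R : realType) (a b : R) (f : R -> R) :
  {within `[a, b], continuous f} ->
  exists2 C : R, 0 < C & forall x, x \in `[a, b] -> `|f x| <= C.
Proof.
move=> cf; have [ab|ba] := leP a b; last first.
  exists 1 => // x; rewrite in_itv/= => /andP[h1 h2].
  by have := le_lt_trans (le_trans h1 h2) ba; rewrite ltxx.
have cn : {within `[a, b], continuous (fun x => `|f x|)}.
  apply/subspace_continuousP => x abx; apply: cvg_norm.
  by move/subspace_continuousP : cf; exact.
have [c _ hc] := EVT_max ab cn.
by exists (`|f c| + 1) => [|x /hc/=h]; rewrite ?ltr_wpDl// ler_wpDr.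
Qed.

Section density.
Context {R : realType} (a b : R) (mu : probability (measurableTypeR R) R).
Context (rho : R -> R).
Hypothesis rho_gt0 : forall x, x \in `[a, b] -> 0 < rho x.
Hypothesis rho_cont : {within `[a, b], continuous rho}.
Hypothesis rho_density : forall A : set (measurableTypeR R), measurable A ->
  mu A = (\int[lebesgue_measure]_(x in A `&` `[a, b]) (rho x)%:E)%E.

Local Notation lam := (@lebesgue_measure R).

Lemma density_ac : mu `<< lam.
Proof.
apply/null_content_dominatesP => A mA A0; rewrite rho_density//.
apply: null_set_integral.
- exact: measurableI.
- apply: (@measurable_funS _ _ _ _ `[a, b]%classic) => //.
  by apply/measurable_EFinP; exact: within_continuous_measurable.
- apply/eqP; rewrite -measure_le0 -A0 le_measure ?inE//; exact: measurableI.
Qed.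

Local Notation dmu := (Radon_Nikodym_SigmaFinite.f mu lam).

(** Change of variables is formulated with the Radon-Nikodym derivative; this identifies that
    derivative with the continuous density [rho]. *)
Lemma density_ae : ae_eq lam `[a, b]%classic (EFin \o rho) dmu.
Proof.
apply: integral_ae_eq => //.
- exact: within_continuous_integrable.
- apply: measurable_funTS; apply: measurable_int.
  exact: Radon_Nikodym_SigmaFinite.f_integrable density_ac.
- move=> E ED mE; rewrite -Radon_Nikodym_SigmaFinite.f_integral//; last exact: density_ac.
  by have := rho_density mE; rewrite (setIidl ED) => <-.
Qed.

Lemma density_integral (f : R -> R) :
  measurable_fun `[a, b]%classic f ->
  (forall x, 0 <= f x) ->
  (\int[mu]_(x in `[a, b]) (f x)%:E =
   \int[lam]_(x in `[a, b]) (f x * rho x)%:E)%E.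
Proof.
move=> mf f0.
have mf' : measurable_fun `[a, b]%classic (EFin \o f).
  exact/measurable_EFinP.
rewrite -(Radon_Nikodym_SigmaFinite.change_of_variables density_ac
  (f := EFin \o f) (E := `[a, b]%classic))//.
apply: ae_eq_integral => //.
- apply: emeasurable_funM => //.
  apply: measurable_funTS; apply: measurable_int.
  exact: Radon_Nikodym_SigmaFinite.f_integrable density_ac.
- apply/measurable_EFinP; apply: measurable_funM => //.
  exact: within_continuous_measurable.
- apply: filterS density_ae => x /= h /h /= <-.
  by rewrite -?EFinM.
Qed.

(** The upper bound of [rho] on the compact interval gives this direction, and the positive lower
    bound of [density_ge] gives the converse in [density_ge_integrable]. Together they make L^2(mu)
    and L^2(dx) the same set of functions. *)
Lemma density_le_integrable (f : R -> R) :
  lam.-integrable `[a, b] (EFin \o f) -> mu.-integrable `[a, b] (EFin \o f).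
Proof.
move=> fint; have /measurable_EFinP mf := measurable_int _ fint.
have [C C0 hC] := within_continuous_bounded rho_cont.
apply/integrableP; split; first exact/measurable_EFinP.
rewrite (_ : (\int[mu]_(x in _) _)%E = (\int[mu]_(x in `[a, b]) (`|f x|)%:E)%E)//.
rewrite density_integral//; last exact: measurableT_comp.
have : lam.-integrable `[a, b] (fun x => (`|f x| * rho x)%:E).
  apply: (@le_integrable _ _ _ lam `[a, b] _ _ (fun x => C%:E * (f x)%:E)%E) => //.
  - apply/measurable_EFinP; apply: measurable_funM; first exact: measurableT_comp.
    exact: within_continuous_measurable.
  - move=> x xab; rewrite -EFinM !abse_EFin lee_fin !normrM normr_id mulrC.
    by rewrite ler_wpM2r// (ger0_norm (ltW C0)) hC.
  - exact: integrableZl.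
move=> /integrableP[_]; apply: le_lt_trans.
apply: ge0_le_integral => //=.
- by move=> x xab; rewrite lee_fin mulr_ge0// ltW// rho_gt0.
- apply/measurable_EFinP; apply: measurable_funM; first exact: measurableT_comp.
  exact: within_continuous_measurable.
- apply/measurable_EFinP; apply: measurableT_comp => //.
  apply: measurable_funM; first exact: measurableT_comp.
  exact: within_continuous_measurable.
- by move=> x xab; rewrite lee_fin ler_norm.
Qed.

Lemma density_ge : exists2 c : R, 0 < c & forall x, x \in `[a, b] -> c <= rho x.
Proof.
have [ab|ba] := leP a b; last first.
  exists 1 => // x; rewrite in_itv/= => /andP[h1 h2].
  by have := le_lt_trans (le_trans h1 h2) ba; rewrite ltxx.
by have [c cab hc] := EVT_min ab rho_cont; exists (rho c) => //; exact: rho_gt0.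
Qed.

Lemma density_ge_integrable (f : R -> R) :
  measurable_fun `[a, b]%classic f ->
  mu.-integrable `[a, b] (EFin \o f) -> lam.-integrable `[a, b] (EFin \o f).
Proof.
move=> mf /integrableP[_ fint]; have [c c0 hc] := density_ge.
apply/integrableP; split; first exact/measurable_EFinP.
rewrite (_ : (\int[lam]_(x in _) _)%E = (\int[lam]_(x in `[a, b]) (`|f x|)%:E)%E)//.
have {}fint : (\int[mu]_(x in `[a, b]) (`|f x|)%:E < +oo)%E by [].
rewrite density_integral// in fint; last exact: measurableT_comp.
have : (c%:E * \int[lam]_(x in `[a, b]) (`|f x|)%:E < +oo)%E.
  rewrite -ge0_integralZl//=; last 2 first.
  - by apply/measurable_EFinP; exact: measurableT_comp.
  - by rewrite lee_fin ltW.
  apply: le_lt_trans fint; apply: ge0_le_integral => //=.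
  - by move=> x _; rewrite mule_ge0// lee_fin// ltW.
  - apply/measurable_EFinP; apply: measurable_funM => //.
    exact: measurableT_comp.
  - apply/measurable_EFinP; apply: measurable_funM; first exact: measurableT_comp.
    exact: within_continuous_measurable.
  - by move=> x xab; rewrite -EFinM lee_fin mulrC ler_wpM2l// hc.
by rewrite !ltey; apply: contra => /eqP ->; rewrite gt0_muley// lte_fin.
Qed.

Lemma density_Rintegral (f : R -> R) :
  lam.-integrable `[a, b] (EFin \o f) ->
  \int[mu]_(x in `[a, b]) f x = \int[lam]_(x in `[a, b]) (f x * rho x).
Proof.
move=> fint; have mf := measurable_int _ fint; congr fine.
rewrite -(@Radon_Nikodym_change_of_variables _ _ _ mu lam density_ac (EFin \o f))//;
  last exact: density_le_integrable.
apply: ae_eq_integral => //.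
- apply: emeasurable_funM => //.
  apply: measurable_funTS; apply: (measurable_int lam).
  by apply: Radon_Nikodym_integrable; exact: density_ac.
- apply/measurable_EFinP; apply: measurable_funM; first exact/measurable_EFinP.
  exact: within_continuous_measurable.
- have := @ae_eq_Radon_Nikodym_SigmaFinite _ _ _ mu lam density_ac
   `[a, b]%classic ltac:(done).
  have := density_ae; apply: filterS2 => x /= h1 h2 xab.
  by rewrite -h2// -h1.
Qed.

End density.

(** * Square-integrable functions on an interval *)

Section square_integrable.
Context {R : realType} (a b : R).
Local Notation lam := (@lebesgue_measure R).

(** L^2 for the Lebesgue measure, in a form that restricts easily to subintervals; [L2_sqint]
    identifies it with [L2]. *)
Definition sqint (f : R -> R) : Prop :=
  measurable_fun `[a, b]%classic f /\
  lam.-integrable `[a, b] (EFin \o (fun x => f x ^+ 2)).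

Lemma sqint_mul (f g : R -> R) : sqint f -> sqint g ->
  lam.-integrable `[a, b] (EFin \o (fun x => f x * g x)).
Proof.
move=> [mf f2] [mg g2].
apply: (@le_integrable _ _ _ lam `[a, b] _ _
  (EFin \o (fun x => f x ^+ 2 + g x ^+ 2))) => //.
- by apply/measurable_EFinP; exact: measurable_funM.
- move=> x _ /=; rewrite lee_fin normrM (ger0_norm (addr_ge0 (sqr_ge0 _) (sqr_ge0 _))).
  rewrite -(real_normK (num_real (f x))) -(real_normK (num_real (g x))).
  have := normr_ge0 (f x); have := normr_ge0 (g x); nra.
- exact: (integrableD _ f2 g2).
Qed.

Lemma sqint_lin (f g : R -> R) (c : R) : sqint f -> sqint g ->
  sqint (fun x => f x + c * g x).
Proof.
move=> sf sg; have [mf f2] := sf; have [mg g2] := sg; split.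
  by apply: measurable_funD => //; exact: measurable_funM.
have fg := sqint_mul sf sg.
rewrite (_ : _ \o _ = (fun x => ((f x ^+ 2)%:E + ((2 * c)%:E * (f x * g x)%:E +
  (c ^+ 2)%:E * (g x ^+ 2)%:E))%E)); last first.
  apply/funext => x /=; rewrite -!EFinM -!EFinD; congr EFin; ring.
by apply: integrableD => //; apply: integrableD => //; exact: integrableZl.
Qed.

Lemma sqint_continuous (f : R -> R) : {within `[a, b], continuous f} -> sqint f.
Proof.
move=> cf; split; first exact: within_continuous_measurable.
apply: within_continuous_integrable; apply/subspace_continuousP => x abx.
by apply: cvgM; move/subspace_continuousP : cf; exact.
Qed.

Lemma sqint_cst (c : R) : sqint (cst c).
Proof. by apply: sqint_continuous; apply: continuous_subspaceT => x; exact: cvg_cst. Qed.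

Lemma sqint_integrable (f : R -> R) : sqint f -> lam.-integrable `[a, b] (EFin \o f).
Proof.
move=> sf; have := sqint_mul sf (sqint_cst 1).
by congr integrable; apply/funext => x /=; rewrite mulr1.
Qed.

Lemma sqint_ae (f g : R -> R) : measurable_fun `[a, b]%classic g ->
  ae_eq lam `[a, b]%classic f g -> sqint f -> sqint g.
Proof.
move=> mg fg [mf f2]; split => //.
apply/integrableP; split.
  by apply/measurable_EFinP; exact: measurable_funX.
move/integrableP : f2 => [_]; apply: le_lt_trans.
rewrite le_eqVlt; apply/orP; left; apply/eqP; apply: ae_eq_integral => //.
- by apply: measurableT_comp => //; apply/measurable_EFinP; exact: measurable_funX.
- by apply: measurableT_comp => //; apply/measurable_EFinP; exact: measurable_funX.
- by apply: filterS fg => x /= h /h ->.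
Qed.

End square_integrable.

(** * The inner product of L^2(mu) *)

Section L2.
Context {R : realType} (a b : R) (mu : probability (measurableTypeR R) R).
Context (rho : R -> R).
Hypothesis rho_gt0 : forall x, x \in `[a, b] -> 0 < rho x.
Hypothesis rho_cont : {within `[a, b], continuous rho}.
Hypothesis rho_density : forall A : set (measurableTypeR R), measurable A ->
  mu A = (\int[lebesgue_measure]_(x in A `&` `[a, b]) (rho x)%:E)%E.

Local Notation lam := (@lebesgue_measure R).
Local Notation L2 := (L2 a b mu).
Local Notation L2ip := (L2ip a b mu).

Lemma L2_sqint (f : R -> R) : L2 f <-> sqint a b f.
Proof.
split=> [Lf|[mf f2]].
- have mf : measurable_fun `[a, b]%classic f.
    have m0 : measurable_fun [set: measurableTypeR R] (f \_ `[a, b]).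
      by move: Lf; rewrite /Defs.L2 inE => /andP[/[!inE]].
    by move/(measurable_restrictT f (measurable_itv `[a, b])) : m0.
  split => //.
  have := Lfun2_integrable_sqr Lf.
  move=> /(integrableS measurableT) H.
  apply: (density_ge_integrable rho_gt0 rho_cont rho_density).
    exact: measurable_funX.
  have := H `[a, b]%classic ltac:(done) ltac:(done).
  apply: eq_integrable => // x xab /=.
  by rewrite patchE xab.
- rewrite /Defs.L2 inE; apply/andP; split; rewrite inE/=.
    by move/(measurable_restrictT f (measurable_itv `[a, b])) : mf.
  rewrite /finite_norm unlock.
  apply: poweR_lty.
  have /integrableP[_] := density_le_integrable rho_gt0 rho_cont rho_density f2.
  rewrite [X in (X < _)%E -> _]integral_mkcond; apply: le_lt_trans.
  rewrite le_eqVlt; apply/orP; left; apply/eqP.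
  apply: eq_integral => x _ /=; rewrite !patchE; case: ifPn => xab.
    by rewrite powR_mulrn// real_normK// ?num_real// ger0_norm ?sqr_ge0.
  by rewrite normr0 powR0.
Qed.

Lemma L2ipE (f g : R -> R) : sqint a b f -> sqint a b g ->
  L2ip f g = \int[lam]_(x in `[a, b]) (f x * g x * rho x).
Proof.
move=> sf sg.
exact: (density_Rintegral rho_gt0 rho_cont rho_density (sqint_mul sf sg)).
Qed.

Lemma L2ip_integrable (f g : R -> R) : sqint a b f -> sqint a b g ->
  mu.-integrable `[a, b] (EFin \o (fun x => f x * g x)).
Proof.
by move=> sf sg; apply: (density_le_integrable rho_gt0 rho_cont rho_density); exact: sqint_mul.
Qed.

Lemma L2ipC (f g : R -> R) : L2ip f g = L2ip g f.
Proof. by apply: eq_Rintegral => x _; rewrite mulrC. Qed.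

Lemma L2ip_lin (f g h : R -> R) (c : R) : sqint a b f -> sqint a b g -> sqint a b h ->
  L2ip (fun x => f x + c * g x) h = L2ip f h + c * L2ip g h.
Proof.
move=> sf sg sh; rewrite /Defs.L2ip -RintegralZl//; last exact: L2ip_integrable.
rewrite -RintegralD//; last 2 first.
- exact: L2ip_integrable.
- have := integrableZl (mu:=mu) (D := `[a, b]%classic) ltac:(done) c (L2ip_integrable sg sh).
  by apply: eq_integrable.
by apply: eq_Rintegral => x _; ring.
Qed.

Lemma L2ip_ge0 (f : R -> R) : 0 <= L2ip f f.
Proof. by apply: Rintegral_ge0 => x _; rewrite -expr2 sqr_ge0. Qed.

Lemma L2ip_ae (f g h : R -> R) : sqint a b f -> sqint a b g -> sqint a b h ->
  ae_eq lam `[a, b]%classic f g -> L2ip f h = L2ip g h.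
Proof.
move=> sf sg sh fg; congr fine; apply: ae_eq_integral => //.
- by apply/measurable_EFinP; apply: measurable_funM; [case: sf|case: sh].
- by apply/measurable_EFinP; apply: measurable_funM; [case: sg|case: sh].
- apply: (@null_dominates_ae_eq _ _ _ _ mu lam) => //.
    exact: density_ac rho_cont rho_density.
  by apply: filterS fg => x /= h1 /h1 ->.
Qed.

End L2.

(** * Calculus on the line and a C^1 step function *)

Section calculus.
Context {R : realType}.
Local Notation lam := (@lebesgue_measure R).
Implicit Types (f g h F : R -> R) (a b c d x : R).

Lemma is_derive_continuous f (l : R) x : is_derive x 1 f l -> {for x, continuous f}.
Proof.
by move=> df; apply: differentiable_continuous; apply/derivable1_diffP; exact: ex_derive.
Qed.

Lemma Rintegral_FTC2 f F a b : a < b ->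
  (forall x, is_derive x 1 F (f x)) -> continuous f ->
  \int[lam]_(x in `[a, b]) f x = F b - F a.
Proof.
move=> ab dF cf; rewrite /Rintegral (@continuous_FTC2 _ f F)//.
- exact: continuous_subspaceT.
- have cF x : {for x, continuous F} by exact: is_derive_continuous (dF x).
  split.
  + by move=> x _; exact: ex_derive.
  + by apply: cvg_at_right_filter; exact: cF.
  + by apply: cvg_at_left_filter; exact: cF.
- by move=> x _; rewrite derive1E derive_val.
Qed.

Lemma Rintegral_dominated (E : set R) (f_ : nat -> R -> R) f G :
  measurable E -> (forall n, measurable_fun E (f_ n)) -> measurable_fun E f ->
  (forall x, E x -> f_ n x @[n --> \oo] --> f x) ->
  lam.-integrable E (EFin \o G) -> (forall n x, E x -> `|f_ n x| <= G x) ->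
  \int[lam]_(x in E) f_ n x @[n --> \oo] --> \int[lam]_(x in E) f x.
Proof.
move=> mE mf_ mf ff iG fG.
have h1 n : measurable_fun E (fun x => (f_ n x)%:E) by exact/measurable_EFinP.
have h2 : measurable_fun E (EFin \o f) by exact/measurable_EFinP.
have h3 : {ae lam, forall x, E x -> (f_ n x)%:E @[n --> \oo] --> (f x)%:E}.
  by apply: aeW => x Ex; apply: cvg_EFin; [exact: nearW|exact: ff].
have h4 : {ae lam, forall x n, E x -> (`|(f_ n x)%:E| <= (G x)%:E)%E}.
  by apply: aeW => x n Ex; rewrite lee_fin fG.
have [fi _ fl] := @dominated_convergence _ (measurableTypeR R) R lam E mE _ _ _ h1 h2 h3 iG h4.
have fin : (\int[lam]_(x in E) (f x)%:E)%E \is a fin_num by exact: integrable_fin_num fi.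
rewrite /Rintegral; apply: fine_cvg; rewrite fineK//.
Qed.

Lemma is_derive_sqr_abs x : is_derive x 1 (fun t => t * `|t|) (2 * `|x|).
Proof.
have [x0|x0|->] := ltgtP x 0.
- have h : is_derive x 1 (fun t : R => - (t * t)) (2 * `|x|).
    apply: is_derive_eq; rewrite ltr0_norm// /GRing.scale/=; ring.
  apply: near_eq_is_derive h.
  near=> t; rewrite ltr0_norm ?mulrN//; near: t.
  exact: lt_nbhsl.
- have h : is_derive x 1 (fun t : R => t * t) (2 * `|x|).
    apply: is_derive_eq; rewrite gtr0_norm// /GRing.scale/=; ring.
  apply: near_eq_is_derive h.
  near=> t; rewrite gtr0_norm//; near: t.
  exact: lt_nbhsr.
- apply/is_derive1_caratheodory; exists (fun z => `|z|); split.
  + by move=> z; rewrite mul0r !subr0 mulrC.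
  + exact: norm_continuous.
  + by rewrite normr0 mulr0.
Unshelve. all: by end_near. Qed.

(** A C^1 step from 0 to 1 across [0, 1]. Since [x * |x|] is a C^1 antiderivative of [2 * |x|], this
    quadratic spline with knots 0, 1/2, 1 is the primitive of the hat function [dramp], which has
    height 2 and integral 1. *)
Definition ramp x := x * `|x| - 2 * ((x - 2^-1) * `|x - 2^-1|)
  + (x - 1) * `|x - 1| + 2^-1.

Definition dramp x := 2 * `|x| - 4 * `|x - 2^-1| + 2 * `|x - 1|.

Lemma is_derive_shift f (l : R) x c (k : R) : is_derive (k * (x - c)) 1 f l ->
  is_derive x 1 (fun t => f (k * (t - c))) (k * l).
Proof.
move=> df.
have d1 : is_derive x 1 (fun t => k * (t - c)) k.
  by apply: is_derive_eq; rewrite /GRing.scale/= subr0 mulr1.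
by rewrite mulrC; exact: (@is_derive1_comp R f (fun t => k * (t - c)) x _ _ df d1).
Qed.

Lemma is_derive_ramp x : is_derive x 1 ramp (dramp x).
Proof.
have d0 := is_derive_sqr_abs x.
have d1 c : is_derive x 1 (fun t => (t - c) * `|t - c|) (2 * `|x - c|).
  have dc : is_derive x 1 (fun t => t - c) 1 by apply: is_derive_eq; rewrite subr0.
  have := @is_derive1_comp R (fun t => t * `|t|) (fun t => t - c) x _ _
    (is_derive_sqr_abs _) dc.
  by rewrite mulr1.
have d2 := d1 2^-1; have d3 := d1 1.
rewrite /ramp; apply: is_derive_eq; rewrite /dramp /GRing.scale/=. ring.
Qed.

Lemma continuous_dramp : continuous dramp.
Proof.
have c0 c : continuous (fun x : R => `|x - c|).
  move=> x; apply: cvg_norm; apply: cvgB; [exact: cvg_id|exact: cvg_cst].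
move=> x; rewrite /dramp; apply: cvgD; [apply: cvgB|]; apply: cvgM;
  try exact: cvg_cst; try exact: c0.
exact: norm_continuous.
Qed.

Lemma ramp_le0 x : x <= 0 -> ramp x = 0.
Proof.
move=> x0; rewrite /ramp (ler0_norm x0) !ler0_norm; [|lra|lra].
by field.
Qed.

Lemma ramp_ge1 x : 1 <= x -> ramp x = 1.
Proof.
by move=> x0; rewrite /ramp !ger0_norm; [field|lra|lra|lra].
Qed.

Lemma dramp_out x : x <= 0 \/ 1 <= x -> dramp x = 0.
Proof.
case=> x0; rewrite /dramp.
  by rewrite (ler0_norm x0) !ler0_norm; [field|lra|lra].
by rewrite !ger0_norm; [field|lra|lra|lra].
Qed.

Lemma dramp_ge0 x : 0 <= dramp x.
Proof.
rewrite /dramp.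
have : `|x - 2^-1 + (x - 2^-1)| <= `|x| + `|x - 1|.
  rewrite (_ : x - 2^-1 + (x - 2^-1) = x + (x - 1)); last by field.
  exact: ler_normD.
rewrite -mulr2n normrMn mulr2n; lra.
Qed.

Lemma ramp_ndecr x y : x <= y -> ramp x <= ramp y.
Proof.
move=> xy; apply: (@ger0_derive1_le_cc _ ramp x y _ _ _) => //.
- by move=> z _; case: (is_derive_ramp z).
- by move=> z _; rewrite derive1E; have := is_derive_ramp z => ?; rewrite derive_val dramp_ge0.
- by apply: continuous_subspaceT => z; exact: is_derive_continuous (is_derive_ramp z).
- by rewrite in_itv/= lexx.
- by rewrite in_itv/= xy lexx.
Qed.

Lemma ramp_ge0 x : 0 <= ramp x.
Proof.
have [x0|x0] := leP x 0; first by rewrite ramp_le0.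
by rewrite -(ramp_le0 (lexx 0)) ramp_ndecr// ltW.
Qed.

Lemma ramp_le1 x : ramp x <= 1.
Proof.
have [x0|x0] := leP 1 x; first by rewrite ramp_ge1.
by rewrite -(ramp_ge1 (lexx 1)) ramp_ndecr// ltW.
Qed.

(* an approximate identity concentrated to the right of p *)
Lemma dramp_approx h (p e : R) (k : nat -> R) : p < e ->
  {within `[p, e], continuous h} -> k n @[n --> \oo] --> +oo ->
  \int[lam]_(x in `[p, e]) (h x * (k n * dramp (k n * (x - p)))) @[n --> \oo] --> h p.
Proof.
move=> pe ch koo; apply/cvgrPdist_le => eps eps0.
have hp : h x @[x --> within `[p, e]%classic (nbhs p)] --> h p.
  by move/subspace_continuousP : ch; apply; rewrite /= in_itv/= lexx ltW.
move/cvgrPdist_le : hp => /(_ _ eps0) [del/= del0 hdel].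
(* Once [k n] exceeds [m^-1], the support of the scaled hat has length less than [m]: it lies inside
   [p, e], so its mass is 1, and inside the zone where [h] is within [eps] of [h p]. *)
pose m := Num.min del (e - p).
have m0 : 0 < m by rewrite lt_min del0 subr_gt0.
have : \forall n \near \oo, m^-1 < k n by exact: (cvgryPgt _).1.
apply: filterS => n kn.
have k0 : 0 < k n by rewrite (lt_trans _ kn)// invr_gt0.
have kem : 1 <= k n * (e - p).
  rewrite (@le_trans _ _ (m^-1 * m))//; first by rewrite mulVf// gt_eqF.
  by rewrite ler_pM// ?invr_ge0 ?(ltW m0)// ?(ltW kn)// ge_min lexx orbT.
pose w x := k n * dramp (k n * (x - p)).
have w0 x : 0 <= w x by rewrite mulr_ge0 ?dramp_ge0// ltW.
have cw : continuous w.
  move=> x; apply: cvgM; first exact: cvg_cst.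
  apply: (@continuous_comp _ _ _ (fun x => k n * (x - p)) dramp); last exact: continuous_dramp.
  by apply: cvgM; [exact: cvg_cst|apply: cvgB; [exact: cvg_id|exact: cvg_cst]].
have w1 : \int[lam]_(x in `[p, e]) w x = 1.
  have dW x : is_derive x 1 (fun x => ramp (k n * (x - p))) (w x).
    by apply: is_derive_shift; exact: is_derive_ramp.
  have -> := Rintegral_FTC2 pe dW cw.
  by rewrite subrr mulr0 (ramp_le0 (lexx 0)) subr0 ramp_ge1.
have cwI : {within `[p, e], continuous w} by exact: continuous_subspaceT.
have iw := within_continuous_integrable cwI.
have ihw : lam.-integrable `[p, e] (EFin \o (fun x => h x * w x)).
  by apply: sqint_mul; exact: sqint_continuous.
have -> : h p = \int[lam]_(x in `[p, e]) (h p * w x) by rewrite RintegralZl// w1 mulr1.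
have ihpw : lam.-integrable `[p, e] (EFin \o (fun x => h p * w x)).
  by apply: sqint_mul; [exact: sqint_cst|exact: sqint_continuous].
rewrite -RintegralB//.
rewrite (le_trans (le_normr_Rintegral _ _))//.
  by have := integrableB (mu := lam) (D := `[p, e]%classic) ltac:(done) ihpw ihw.
apply: (@le_trans _ _ (\int[lam]_(x in `[p, e]) (eps * w x))); last first.
  by rewrite RintegralZl// w1 mulr1.
apply: le_Rintegral => //.
- apply: (@integrable_norm _ _ _ lam _ (fun x => h p * w x - h x * w x)).
  by have := integrableB (mu := lam) (D := `[p, e]%classic) ltac:(done) ihpw ihw.
- by apply: sqint_mul; [exact: sqint_cst|exact: sqint_continuous].
- move=> x/= xpe; rewrite -mulrBl normrM (ger0_norm (w0 x)).
  have [kx|kx] := leP 1 (k n * (x - p)).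
    by rewrite /w (dramp_out (or_intror kx)) mulr0 !mulr0.
  rewrite ler_wpM2r//; apply: hdel => //=.
  move: (xpe); rewrite in_itv/= => /andP[px xe].
  rewrite distrC ger0_norm ?subr_ge0//.
  apply: (@lt_le_trans _ _ m); last by rewrite ge_min lexx.
  rewrite -[ltLHS]mul1r -(@mulfV _ m) ?gt_eqF// -mulrA gtr_pMr//.
  apply: le_lt_trans kx; rewrite ler_wpM2r ?subr_ge0//; exact: ltW.
Qed.

End calculus.

(** * Weak derivatives *)

Section weak_derivative.
Context {R : realType} (a b : R).
Local Notation lam := (@lebesgue_measure R).
Implicit Types f g h psi : R -> R.

Lemma Rintegral_zero_outside (D E : set R) h : E `<=` D ->
  (forall x, D x -> ~ E x -> h x = 0) ->
  \int[lam]_(x in D) h x = \int[lam]_(x in E) h x.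
Proof.
move=> ED h0; rewrite Rintegral_mkcond [RHS]Rintegral_mkcond.
congr (Rintegral _ _ _); apply/funext => x; rewrite !patchE.
case: ifPn => [/set_mem Dx|nDx]; case: ifPn => //.
  by move=> nEx; apply: h0 => // Ex; rewrite mem_set in nEx.
by move=> /set_mem /ED Dx; rewrite mem_set in nDx.
Qed.

Lemma weak_derivative_integrable f g c d : is_weak_derivative a b f g ->
  a < c -> d < b -> lam.-integrable `[c, d] (EFin \o g).
Proof.
move=> [_ [mg _ locg] _] ac db.
have sub : `[c, d] `<=` `]a, b[%classic.
  move=> x /=; rewrite !in_itv/= => /andP[h1 h2].
  by rewrite (lt_le_trans ac h1) (le_lt_trans h2 db).
apply/integrableP; split.
  by apply/measurable_EFinP; exact: measurable_funS mg.
by have := locg _ sub (@segment_compact _ c d).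
Qed.

(* Testing the weak derivative against [psi] times a C^1 approximation of the
   indicator of [c, d] and letting the width of the transition layers vanish. *)
Lemma weak_derivative_by_parts_oo f g psi dpsi c d :
  {within `[a, b], continuous f} -> is_weak_derivative a b f g ->
  (forall x : R, is_derive x 1 psi (dpsi x : R)) -> continuous dpsi ->
  a < c -> c < d -> d < b ->
  \int[lam]_(x in `[c, d]) (f x * dpsi x + g x * psi x) =
  f d * psi d - f c * psi c.
Proof.
move=> cf wfg dpsi_ cdpsi ac cd db.
have cpsi : continuous psi by move=> x; exact: is_derive_continuous (dpsi_ x).
(* Both transition layers lie to the right of their endpoint, one starting at [c] and one at [d], so
   the test functions live on [c, e] with [e < b]. *)
pose e := (d + b) / 2.
have de : d < e by rewrite /e; lra.
have eb : e < b by rewrite /e; lra.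
have ce : c < e := lt_trans cd de.
have subI : `[c, e] `<=` `]a, b[%classic.
  move=> x /=; rewrite !in_itv/= => /andP[h1 h2].
  by rewrite (lt_le_trans ac h1) (le_lt_trans h2 eb).
have subI' : `[c, e] `<=` `[a, b]%classic.
  by move=> x /subI /=; apply: subset_itv_oo_cc.
have cfI : {within `[c, e], continuous f} by exact: continuous_subspaceW cf.
have ig := weak_derivative_integrable wfg ac eb.
(* The offset keeps the layer that starts at [d] inside [d, e] for every [n], including 0. *)
pose k n : R := n%:R + (e - d)^-1.
have k0 n : 0 < k n by rewrite ltr_wpDl// invr_gt0 subr_gt0.
have ked n : 1 <= k n * (e - d).
  by rewrite mulrDl mulVf ?subr_eq0 ?gt_eqF// lerDr mulr_ge0// subr_ge0 ltW.
have koo : k n @[n --> \oo] --> +oo.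
  apply: (@ger_cvgy _ _ _ _ (fun n : nat => n%:R)); last exact: cvgr_idn.
  by apply: nearW => n; rewrite /k lerDl invr_ge0 subr_ge0 ltW.
pose B n x := ramp (k n * (x - c)) - ramp (k n * (x - d)).
pose dB n x := k n * dramp (k n * (x - c)) - k n * dramp (k n * (x - d)).
have dB_ n (x : R) : is_derive x 1 (B n) (dB n x).
  have h1 := is_derive_shift (is_derive_ramp (k n * (x - c))).
  have h2 := is_derive_shift (is_derive_ramp (k n * (x - d))).
  exact: is_deriveB.
have cdB n : continuous (dB n).
  have ck p : continuous (fun x => k n * dramp (k n * (x - p))).
    move=> x; apply: cvgM; first exact: cvg_cst.
    apply: (@continuous_comp _ _ _ (fun x => k n * (x - p)) dramp); last exact: continuous_dramp.
    by apply: cvgM; [exact: cvg_cst|apply: cvgB; [exact: cvg_id|exact: cvg_cst]].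
  by move=> x; apply: cvgB; exact: ck.
have cB n : continuous (B n) by move=> x; exact: is_derive_continuous (dB_ n x).
have Bout n x : x \notin `[c, e] -> B n x = 0 /\ dB n x = 0.
  rewrite in_itv/= negb_and -!ltNge => /orP[xc|ex].
    have h1 : k n * (x - c) <= 0 by rewrite pmulr_rle0// subr_le0 ltW.
    have h2 : k n * (x - d) <= 0 by rewrite pmulr_rle0// subr_le0 ltW// (lt_trans xc).
    rewrite /B /dB (ramp_le0 h1) (ramp_le0 h2) (dramp_out (or_introl h1)).
    by rewrite (dramp_out (or_introl h2)) !mulr0 !subrr.
  have h2 : 1 <= k n * (x - d).
    by rewrite (le_trans (ked n))// ler_wpM2l ?(ltW (k0 n))// lerD2r ltW.
  have h1 : 1 <= k n * (x - c).
    by rewrite (le_trans h2)// ler_wpM2l ?(ltW (k0 n))// lerD2l lerN2 ltW.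
  rewrite /B /dB (ramp_ge1 h1) (ramp_ge1 h2) (dramp_out (or_intror h1)).
  by rewrite (dramp_out (or_intror h2)) !mulr0 !subrr.
pose T n x := psi x * B n x.
have dT n (x : R) : is_derive x 1 (T n) (psi x * dB n x + B n x * dpsi x).
  have h1 := dpsi_ x; have h2 := dB_ n x.
  by apply: is_derive_eq; rewrite /GRing.scale/=.
have tT n : test_function a b (T n).
  split.
  - by move=> x; case: (dT n x).
  - rewrite (_ : derive1 _ = fun x => psi x * dB n x + B n x * dpsi x).
      by move=> x; apply: cvgD; apply: cvgM; [exact: cpsi|exact: cdB|exact: cB|exact: cdpsi].
    by apply/funext => x; rewrite derive1E; have h := dT n x; rewrite derive_val.
  - exists c, e; split => // x xce.
    by rewrite /T (Bout n x xce).1 mulr0.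
pose q x := f x * dpsi x + g x * psi x.
have iq : lam.-integrable `[c, e] (EFin \o q).
  have h1 : lam.-integrable `[c, e] (EFin \o (fun x => f x * dpsi x)).
    by apply: sqint_mul; apply: sqint_continuous => //; exact: continuous_subspaceT.
  have [C C0 hC] := within_continuous_bounded (@continuous_subspaceT _ _ `[c, e] psi cpsi).
  have h2 : lam.-integrable `[c, e] (EFin \o (fun x => g x * psi x)).
    apply: (@le_integrable _ _ _ lam `[c, e] _ _ (fun x => C%:E * (g x)%:E)%E) => //.
    - apply/measurable_EFinP; apply: measurable_funM.
        by have /measurable_EFinP := measurable_int _ ig.
      by apply: within_continuous_measurable; exact: continuous_subspaceT.
    - move=> x xab; rewrite -EFinM !abse_EFin lee_fin !normrM mulrC.
      by rewrite ler_wpM2r// (ger0_norm (ltW C0)) hC.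
    - exact: integrableZl.
  exact: (integrableD _ h1 h2).
have mB n : measurable_fun `[c, e]%classic (B n).
  by apply: within_continuous_measurable; exact: continuous_subspaceT.
have mq : measurable_fun `[c, e]%classic q by have /measurable_EFinP := measurable_int _ iq.
have B01 n x : 0 <= B n x <= 1.
  rewrite /B subr_ge0 ramp_ndecr/=; last first.
    by rewrite ler_wpM2l ?(ltW (k0 n))// lerD2l lerN2 ltW.
  have := ramp_ge0 (k n * (x - d)); have := ramp_le1 (k n * (x - c)); lra.
have B0 n x : 0 <= B n x by case/andP: (B01 n x).
have B1 n x : B n x <= 1 by case/andP: (B01 n x).
have eqn n : \int[lam]_(x in `[c, e]) (q x * B n x) =
    - \int[lam]_(x in `[c, e]) (f x * psi x * dB n x).
  have [_ _ /(_ _ (tT n))] := wfg.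
  rewrite (Rintegral_zero_outside subI); last first.
    move=> x _ /negP xce; rewrite derive1E; have h := dT n x; rewrite derive_val.
    by have [-> ->] := Bout n x xce; rewrite mulr0 mul0r addr0 mulr0.
  rewrite (Rintegral_zero_outside (h := fun x => g x * T n x) subI); last first.
    by move=> x _ /negP xce; rewrite /T (Bout n x xce).1 !mulr0.
  move=> H.
  have i1 : lam.-integrable `[c, e] (EFin \o (fun x => f x * psi x * dB n x)).
    apply: sqint_mul; apply: sqint_continuous; last exact: continuous_subspaceT.
    apply/subspace_continuousP => x abx; apply: cvgM.
      by move/subspace_continuousP : cfI; exact.
    by apply: cvg_within_filter; exact: cpsi.
  have i2 : lam.-integrable `[c, e] (EFin \o (fun x => q x * B n x)).
    apply: (@le_integrable _ _ _ lam `[c, e] _ _ (EFin \o q)) => //.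
    - by apply/measurable_EFinP; exact: (@measurable_funM _ _ _ _ _ _ mq (mB n)).
    - by move=> x _; rewrite /= lee_fin normrM (ger0_norm (B0 n x)) ler_piMr.
  have i3 : lam.-integrable `[c, e] (EFin \o (fun x => g x * T n x)).
    apply: (@eq_integrable _ _ _ lam _ _ 
      (EFin \o (fun x => q x * B n x - f x * dpsi x * B n x))) => //.
      by move=> x _ /=; congr EFin; rewrite /q /T; ring.
    have i4 : lam.-integrable `[c, e] (EFin \o (fun x => f x * dpsi x * B n x)).
      apply: sqint_mul; apply: sqint_continuous; last exact: continuous_subspaceT.
      apply/subspace_continuousP => x abx; apply: cvgM.
        by move/subspace_continuousP : cfI; exact.
      by apply: cvg_within_filter; exact: cdpsi.
    exact: (integrableB _ i2 i4).
  have i5 : lam.-integrable `[c, e] (EFin \o (fun x => f x * (psi x * dB n x + B n x * dpsi x))).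
    apply: (@eq_integrable _ _ _ lam _ _ (EFin \o (fun x => f x * psi x * dB n x +
      (q x * B n x - g x * T n x)))) => //.
      by move=> x _ /=; congr EFin; rewrite /q /T; ring.
    exact: (integrableD _ i1 (integrableB _ i2 i3)).
  have {}H : \int[lam]_(x in `[c, e]) (f x * (psi x * dB n x + B n x * dpsi x)) =
      - \int[lam]_(x in `[c, e]) (g x * T n x).
    rewrite -H; apply: eq_Rintegral => x _; rewrite derive1E.
    by have h := dT n x; rewrite derive_val.
  apply/eqP; rewrite -addr_eq0 -RintegralD//.
  apply/eqP; transitivity (\int[lam]_(x in `[c, e])
      (f x * (psi x * dB n x + B n x * dpsi x) + g x * T n x)).
    by apply: eq_Rintegral => x _; rewrite /q /T; ring.
  by rewrite RintegralD// H addNr.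
(* [B n] tends pointwise to the indicator of ]c, d] and stays in [0, 1], so dominated convergence
   applies with bound [|q|]. *)
have lim1 : \int[lam]_(x in `[c, e]) (q x * B n x) @[n --> \oo] -->
    \int[lam]_(x in `[c, d]) q x.
  have -> : \int[lam]_(x in `[c, d]) q x =
      \int[lam]_(x in `[c, e]) (q x * (\1_(`]c, d]%classic) x)).
    have iq' : lam.-integrable `]c, d] (EFin \o q).
      apply: integrableS iq => // x /=; rewrite !in_itv/= => /andP[/ltW-> h].
      by rewrite (le_trans h)// ltW.
    rewrite -(Rintegral_itv_obnd_cbnd iq').
    rewrite [RHS](@Rintegral_zero_outside _ `]c, d]).
    - by apply: eq_Rintegral => x xcd; rewrite indicE xcd mulr1.
    - by move=> x /=; rewrite !in_itv/= => /andP[/ltW-> h]; rewrite (le_trans h)// ltW.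
    - by move=> x _ xcd; rewrite indicE memNset// mulr0.
  apply: (@Rintegral_dominated _ _ _ _ (fun x => `|q x|)) => //.
  - by move=> n; exact: (@measurable_funM _ _ _ _ _ _ mq (mB n)).
  - apply: measurable_funM; first exact: mq.
    exact: measurable_indic.
  - move=> x xce; apply: cvgM; first exact: cvg_cst.
    rewrite indicE; have [xc|cx] := leP x c.
      rewrite memNset; last by rewrite /= in_itv/= ltNge xc.
      apply: cvg_near_cst; apply: nearW => n.
      have h1 : k n * (x - c) <= 0 by rewrite pmulr_rle0// subr_le0.
      have h2 : k n * (x - d) <= 0 by rewrite pmulr_rle0// subr_le0 ltW// (le_lt_trans xc).
      by rewrite /B (ramp_le0 h1) (ramp_le0 h2) subrr.
    have big p : p < x -> \forall n \near \oo, 1 <= k n * (x - p).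
      move=> px; have : \forall n \near \oo, (x - p)^-1 < k n by exact: (cvgryPgt _).1.
      apply: filterS => n /ltW; rewrite -[_^-1]mul1r ler_pdivrMr ?subr_gt0//.
    have [xd|dx] := leP x d.
      rewrite mem_set; last by rewrite /= in_itv/= cx xd.
      apply: cvg_near_cst; apply: filterS (big c cx) => n h1.
      have h2 : k n * (x - d) <= 0 by rewrite pmulr_rle0// subr_le0.
      by rewrite /B (ramp_ge1 h1) (ramp_le0 h2) subr0.
    rewrite memNset; last by rewrite /= in_itv/= cx/= leNgt dx.
    apply: cvg_near_cst; have := big d dx; apply: filterS2 (big c cx) => n h1 h2.
    by rewrite /B (ramp_ge1 h1) (ramp_ge1 h2) subrr.
  - exact: integrable_norm.
  - by move=> n x _; rewrite normrM (ger0_norm (B0 n x)) ler_piMr.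
have cfpsi p : c <= p -> {within `[p, e], continuous (fun x => f x * psi x)}.
  move=> cp; apply/subspace_continuousP => x xpe; apply: cvgM.
    have cfp : {within `[p, e], continuous f}.
      by apply: continuous_subspaceW cfI; apply: subset_itvr; rewrite bnd_simp.
    by move/subspace_continuousP : cfp; exact.
  by apply: cvg_within_filter; exact: cpsi.
(* [dB n] is a difference of two approximate identities, at [c] and at [d]. *)
have lim2 : \int[lam]_(x in `[c, e]) (f x * psi x * dB n x) @[n --> \oo] -->
    f c * psi c - f d * psi d.
  have E n : \int[lam]_(x in `[c, e]) (f x * psi x * dB n x) =
      \int[lam]_(x in `[c, e]) (f x * psi x * (k n * dramp (k n * (x - c)))) -
      \int[lam]_(x in `[d, e]) (f x * psi x * (k n * dramp (k n * (x - d)))).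
    have ck p : continuous (fun x => k n * dramp (k n * (x - p))).
      move=> x; apply: cvgM; first exact: cvg_cst.
      apply: (@continuous_comp _ _ _ (fun x => k n * (x - p)) dramp); last exact: continuous_dramp.
      by apply: cvgM; [exact: cvg_cst|apply: cvgB; [exact: cvg_id|exact: cvg_cst]].
    have sp p : sqint c e (fun x => k n * dramp (k n * (x - p))).
      by apply: sqint_continuous; exact: continuous_subspaceT.
    have sf : sqint c e (fun x => f x * psi x) by apply: sqint_continuous; exact: cfpsi.
    rewrite -(@Rintegral_zero_outside `[c, e] `[d, e]); last 2 first.
    - by apply: subset_itvr; rewrite bnd_simp ltW.
    - move=> x /=; rewrite !in_itv/= => /andP[cx xe] /negP; rewrite xe andbT -ltNge => xd.
      rewrite dramp_out ?mulr0//; left; rewrite pmulr_rle0// subr_le0 ltW//.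
    rewrite -RintegralB//; last 2 first.
    - exact: sqint_mul.
    - exact: sqint_mul.
    by apply: eq_Rintegral => x _; rewrite /dB mulrBr.
  under eq_cvg => n do rewrite E.
  exact: cvgB (dramp_approx ce (cfpsi c (lexx _)) koo) (dramp_approx de (cfpsi d (ltW cd)) koo).
have lim3 : \int[lam]_(x in `[c, e]) (q x * B n x) @[n --> \oo] -->
    - (f c * psi c - f d * psi d).
  by under eq_cvg => n do rewrite eqn; exact: cvgN.
by rewrite -[RHS]opprB; exact: (cvg_unique _ lim1 lim3).
Qed.

End weak_derivative.

(** * Projection onto an interval *)

Section clamp.
Context {R : realType}.
Implicit Types (f : R -> R) (c d x : R).

(** Composition with this projection extends a function continuous on [c, d] to a continuous
    function on the whole line, as antiderivatives and two-sided derivatives require. *)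
Definition clamp c d x : R := Num.max c (Num.min x d).

Lemma clamp_itv c d x : c <= d -> clamp c d x \in `[c, d].
Proof.
move=> cd; rewrite in_itv/= /clamp le_max lexx/= ge_max cd/= ge_min lexx orbT//.
Qed.

Lemma clamp_id c d x : x \in `[c, d] -> clamp c d x = x.
Proof.
by rewrite in_itv/= /clamp => /andP[cx xd]; rewrite min_l// max_r.
Qed.

Lemma clamp_lipschitz c d x y : `|clamp c d x - clamp c d y| <= `|x - y|.
Proof.
rewrite /clamp /Order.max /Order.min.
case: (ltP x d) => xd; case: (ltP y d) => yd;
  do ?[case: (ltP c x) => cx]; do ?[case: (ltP c y) => cy];
  do ?[case: (ltP c d) => cd]; rewrite ?subrr ?normr0 ?normr_ge0//;
  rewrite ler_norml; have := ler_norm (x - y); have := ler_norm (y - x);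
  rewrite distrC; lra.
Qed.

Lemma clamp_continuous c d : continuous (clamp c d).
Proof.
move=> x; apply/cvgrPdist_lt => e e0; near=> y.
apply: le_lt_trans (clamp_lipschitz _ _ _ _) _.
by near: y; move/cvgrPdist_lt : (@cvg_id _ (nbhs x)) => /(_ e e0).
Unshelve. all: by end_near. Qed.

Lemma continuous_clamp f c d : c <= d -> {within `[c, d], continuous f} ->
  continuous (f \o clamp c d).
Proof.
move=> cd /subspace_continuousP cf x.
have := cf _ (clamp_itv x cd); apply: cvg_comp.
move=> A; rewrite /within/= => hA.
have /(_ _ hA) := @clamp_continuous c d x.
by apply: (@filterS _ (nbhs x)) => y /= /(_ (clamp_itv y cd)).
Qed.

End clamp.

(** * Weak derivatives up to the boundary and their uniqueness *)

Section weak_derivative.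
Context {R : realType} (a b : R).
Hypothesis ab : a < b.
Local Notation lam := (@lebesgue_measure R).
Implicit Types f g h psi : R -> R.

Lemma Rintegral_oo_cc h : lam.-integrable `[a, b] (EFin \o h) ->
  \int[lam]_(x in `]a, b[) h x = \int[lam]_(x in `[a, b]) h x.
Proof.
move=> ih.
rewrite Rintegral_itv_bndo_bndc; last first.
  by apply: integrableS ih => //; exact: subset_itv_oo_cc.
by rewrite Rintegral_itv_obnd_cbnd//; apply: integrableS ih => //; exact: subset_itv_oc_cc.
Qed.

Lemma constant_on_closure (F : R -> R) : {within `[a, b], continuous F} ->
  (forall c d, a < c -> c < d -> d < b -> F c = F d) ->
  forall x, x \in `[a, b] -> F x = F ((a + b) / 2).
Proof.
move=> /(continuous_within_itvP _ ab)[_ Fa Fb] Foo.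
set m := (a + b) / 2.
have [am mb] := midf_lt ab.
have Fm x : a < x -> x < b -> F x = F m.
  by move=> ax xb; have [xm|mx|->//] := ltgtP x m; [|symmetry]; apply: Foo.
move=> x; rewrite in_itv/= !le_eqVlt => /andP[/predU1P[<-|ax] /predU1P[xb|xb]].
- by have := ab; rewrite xb ltxx.
- have : F x @[x --> a^'+] --> F m.
    apply: cvg_near_cst; near=> t; apply: Fm; near: t; first exact: nbhs_right_gt.
    exact: nbhs_right_lt.
  exact: cvg_unique Fa.
- have : F x @[x --> b^'-] --> F m.
    apply: cvg_near_cst; near=> t; apply: Fm; near: t; last exact: nbhs_left_lt.
    exact: nbhs_left_gt.
  rewrite xb; exact: cvg_unique Fb.
- exact: Fm.
Unshelve. all: by end_near. Qed.

Lemma continuousM_within f psi : {within `[a, b], continuous f} -> continuous psi ->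
  {within `[a, b], continuous (fun x => f x * psi x)}.
Proof.
move=> /subspace_continuousP cf cp; apply/subspace_continuousP => x xab.
by apply: cvgM; [exact: cf|apply: cvg_within_filter; exact: cp].
Qed.

Lemma by_parts_integrable f g psi dpsi :
  {within `[a, b], continuous f} -> sqint a b g -> continuous psi -> continuous dpsi ->
  lam.-integrable `[a, b] (EFin \o (fun x => f x * dpsi x + g x * psi x)).
Proof.
move=> cf sg cp cdp.
have h1 : lam.-integrable `[a, b] (EFin \o (fun x => f x * dpsi x)).
  by apply: sqint_mul; apply: sqint_continuous => //; exact: continuous_subspaceT.
have h2 : lam.-integrable `[a, b] (EFin \o (fun x => g x * psi x)).
  by apply: sqint_mul => //; apply: sqint_continuous => //; exact: continuous_subspaceT.
exact: (integrableD _ h1 h2).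
Qed.

(** The interior formula says that [F], the product [f * psi] minus the primitive of the integrand,
    is constant on ]a, b[. Square integrability of [g] up to the boundary makes [F] continuous on
    [a, b], so the endpoints are included. *)
Lemma weak_derivative_by_parts f g psi dpsi c d :
  {within `[a, b], continuous f} -> is_weak_derivative a b f g -> sqint a b g ->
  (forall x : R, is_derive x 1 psi (dpsi x : R)) -> continuous dpsi ->
  a <= c -> c <= d -> d <= b ->
  \int[lam]_(x in `[c, d]) (f x * dpsi x + g x * psi x) =
  f d * psi d - f c * psi c.
Proof.
move=> cf wfg sg dpsi_ cdpsi ac cd db.
have cpsi : continuous psi by move=> x; exact: is_derive_continuous (dpsi_ x).
pose q x := f x * dpsi x + g x * psi x.
have iq : lam.-integrable `[a, b] (EFin \o q) by exact: by_parts_integrable.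
pose F x := f x * psi x - \int[lam]_(t in `[a, x]) q t.
have cF : {within `[a, b], continuous F}.
  apply/subspace_continuousP => x xab; apply: cvgB.
    by have /subspace_continuousP := continuousM_within cf cpsi; exact.
  by have /subspace_continuousP := parameterized_integral_continuous (ltW ab) iq; exact.
have intB (u v : R) : a <= u -> u <= v -> v <= b ->
    \int[lam]_(x in `[u, v]) q x =
    \int[lam]_(t in `[a, v]) q t - \int[lam]_(t in `[a, u]) q t.
  move=> au uv vb.
  have iv : lam.-integrable `[a, v] (EFin \o q).
    by apply: integrableS iq => //; exact: subset_itvl.
  rewrite (Rintegral_itvB iv)//; last rewrite ?bnd_simp//.
  rewrite Rintegral_itv_obnd_cbnd//.
  apply: integrableS iv => //; apply: subset_itvr; by rewrite bnd_simp.
have Foo u v : a < u -> u < v -> v < b -> F u = F v.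
  move=> au uv vb.
  have := weak_derivative_by_parts_oo cf wfg dpsi_ cdpsi au uv vb.
  rewrite -/(q _) intB ?(ltW _)// /F; lra.
have Fc := constant_on_closure cF Foo.
have : F c = F d.
  by rewrite !Fc// in_itv/= ?ac ?db ?(le_trans cd)// ?(le_trans ac).
rewrite intB// /F; lra.
Qed.

Lemma weak_derivative_ftc f g c d :
  {within `[a, b], continuous f} -> is_weak_derivative a b f g -> sqint a b g ->
  a <= c -> c <= d -> d <= b -> \int[lam]_(x in `[c, d]) g x = f d - f c.
Proof.
move=> cf wfg sg ac cd db.
have h1 (x : R) : is_derive x 1 (fun _ : R => 1 : R) (0 : R) by exact: is_derive_cst.
have := weak_derivative_by_parts cf wfg sg h1 (@cst_continuous _ _ 0) ac cd db.
rewrite !mulr1 => <-; apply: eq_Rintegral => x _; by rewrite mulr0 add0r mulr1.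
Qed.

(** The versions are only locally integrable, so the argument stays on interior intervals [c, d].
    There both have the same integral over every subinterval starting at [c], the primitive of their
    difference vanishes, and Lebesgue differentiation gives almost everywhere equality. *)
Lemma weak_derivative_unique f g1 g2 : {within `[a, b], continuous f} ->
  is_weak_derivative a b f g1 -> is_weak_derivative a b f g2 ->
  ae_eq lam `[a, b]%classic g1 g2.
Proof.
move=> cf w1 w2.
have ftc g c d : is_weak_derivative a b f g -> a < c -> c < d -> d < b ->
    \int[lam]_(x in `[c, d]) g x = f d - f c.
  move=> wg ac cd db.
  have h1 (x : R) : is_derive x 1 (fun _ : R => 1 : R) (0 : R) by exact: is_derive_cst.
  have := weak_derivative_by_parts_oo cf wg h1 (@cst_continuous _ _ 0) ac cd db.
  rewrite !mulr1 => <-; apply: eq_Rintegral => x _; by rewrite mulr0 add0r mulr1.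
have key c d : a < c -> c < d -> d < b -> ae_eq lam `[c, d]%classic g1 g2.
  move=> ac cd db.
  have i1 := weak_derivative_integrable w1 ac db.
  have i2 := weak_derivative_integrable w2 ac db.
  have iq : lam.-integrable `[c, d] (EFin \o (fun x => g1 x - g2 x)).
    exact: (integrableB _ i1 i2).
  pose q := (fun x => g1 x - g2 x) \_ `[c, d].
  have iqT : lam.-integrable setT (EFin \o q).
    by rewrite -restrict_EFin; apply/(integrable_mkcond _ _).1.
  have zero x : \int[lam]_(t in `]-oo, x]) q t = 0.
    rewrite -Rintegral_mkcondr.
    have [xc|cx] := leP x c.
      have [xc'|xc'] := ltP x c.
        rewrite (_ : _ `&` _ = set0) ?Rintegral_set0//; apply/seteqP; split => // t [/=].
        rewrite !in_itv/= => tx /andP[ct _].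
        by have := le_lt_trans (le_trans ct tx) xc'; rewrite ltxx.
      have {xc xc'} -> : x = c by apply/eqP; rewrite eq_le xc xc'.
      rewrite (_ : _ `&` _ = [set c]) ?Rintegral_set1//; apply/seteqP; split => t /=.
        rewrite !in_itv/= => -[tc /andP[ct _]]; apply/eqP; by rewrite eq_le tc ct.
      by move=> ->; rewrite !in_itv/= !lexx ltW.
    pose m := Num.min x d.
    have cm : c < m by rewrite lt_min cx cd.
    have md : m <= d by rewrite ge_min lexx orbT.
    rewrite (_ : _ `&` _ = `[c, m]%classic).
      have sub : `[c, m] `<=` `[c, d]%classic by apply: subset_itvl.
      rewrite RintegralB//; [|exact: integrableS i1|exact: integrableS i2].
      by rewrite !(ftc _ c m)// ?subrr// (le_lt_trans md).
    apply/seteqP; split => t /=; rewrite !in_itv/= le_min.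
      by move=> [-> /andP[-> ->]].
    by move=> /and3P[-> -> ->].
  have loc : locally_integrable [set: R] q by exact: open_integrable_locally openT iqT.
  have iqy (y : R) : lam.-integrable `]-oo, y] (EFin \o q) by exact: integrableS iqT.
  have := FTC1Ny iqy loc.
  apply: filterS; first exact: (ae_filter_ringOfSetsType lam).
  move=> x /=; rewrite (_ : (fun _ => _) = cst 0); last by apply/funext => y; exact: zero.
  move=> [_]; rewrite derive1_cst /q patchE => + xcd; rewrite mem_set//.
  by move=> /esym/eqP; rewrite subr_eq0 => /eqP.
(* Countably many intervals exhausting ]a, b[; the factor 1/3 ensures [c n < d n] already for
   [n = 0]. *)
pose c n : R := a + (b - a) / 3 / n.+1%:R.
pose d n : R := b - (b - a) / 3 / n.+1%:R.
have ab' := ab.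
have step n : 0 < (b - a) / 3 / n.+1%:R <= (b - a) / 3.
  have s0 : 0 < (b - a) / 3 by lra.
  by rewrite divr_gt0//= ler_pdivrMr// ler_peMr ?ler1n// ltW.
have keyn n : ae_eq lam `[c n, d n]%classic g1 g2.
  by have := step n; rewrite /c /d; move: (_ / n.+1%:R) => t ht; apply: key; lra.
have na : {ae lam, forall x, x != a}.
  exists [set a]; split => //; first exact: lebesgue_measure_set1.
  by move=> x /= /negP; rewrite negbK => /eqP.
have nb : {ae lam, forall x, x != b}.
  exists [set b]; split => //; first exact: lebesgue_measure_set1.
  by move=> x /= /negP; rewrite negbK => /eqP.
have all_n : {ae lam, forall x n, `[c n, d n]%classic x -> g1 x = g2 x}.
  by apply/ae_foralln => n; exact: keyn.
have Fae := ae_filter_ringOfSetsType lam.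
apply: filterS3 all_n na nb => x h xa xb; rewrite /= in_itv/= !le_eqVlt => /andP[].
rewrite eq_sym (negbTE xa) (negbTE xb) /= => ax xb'.
have [n hn] : exists n : nat, (b - a) / 3 / n.+1%:R <= Num.min (x - a) (b - x).
  have m0 : 0 < Num.min (x - a) (b - x) by rewrite lt_min !subr_gt0 ax.
  exists (Num.truncn ((b - a) / 3 / Num.min (x - a) (b - x))).
  rewrite ler_pdivrMr// [leRHS]mulrC -ler_pdivrMr//; apply/ltW; exact: truncnS_gt.
apply: (h n); rewrite /= in_itv/= /c /d.
by move: hn; rewrite le_min; move: (_ / n.+1%:R) => t; lra.
Qed.

End weak_derivative.

(** * Weakly differentiable functions with a square-integrable derivative *)

Section weakly_differentiable.
Context {R : realType} (a b : R).
Hypothesis ab : a < b.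
Local Notation lam := (@lebesgue_measure R).
Implicit Types f g h psi : R -> R.

(** Membership in H^1 with an explicit version of the derivative, in terms of the Lebesgue measure;
    [wdiff_H1] and [H1_wdiff] translate from and to [H1]. *)
Definition wdiff f g : Prop :=
  [/\ {within `[a, b], continuous f}, is_weak_derivative a b f g & sqint a b g].

Lemma sqint_locally_integrable f : sqint a b f -> locally_integrable `]a, b[ f.
Proof.
move=> sf; apply: open_integrable_locally; first exact: itv_open.
by apply: integrableS (sqint_integrable sf) => //; exact: subset_itv_oo_cc.
Qed.

Lemma test_function_spec psi : test_function a b psi ->
  [/\ forall x : R, is_derive x 1 psi (derive1 psi x), continuous psi,
      continuous (derive1 psi), psi a = 0 & psi b = 0].
Proof.
move=> [dpsi cpsi' [c [d [ac db out]]]].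
have dp (x : R) : is_derive x 1 psi (derive1 psi x).
  by rewrite derive1E; exact/derivableP.
split => //.
- by move=> x; exact: is_derive_continuous (dp x).
- by apply: out; rewrite in_itv/= leNgt ac.
- by apply: out; rewrite in_itv/= negb_and -!ltNge db orbT.
Qed.

Lemma wdiffI f g : {within `[a, b], continuous f} -> sqint a b g ->
  (forall psi, test_function a b psi ->
    \int[lam]_(x in `[a, b]) (f x * derive1 psi x + g x * psi x) = 0) ->
  wdiff f g.
Proof.
move=> cf sg H; split => //.
have sf := sqint_continuous cf.
split; [exact: sqint_locally_integrable|exact: sqint_locally_integrable|].
move=> psi tpsi; have [dp cp cdp _ _] := test_function_spec tpsi.
have sp : sqint a b psi by apply: sqint_continuous; exact: continuous_subspaceT.
have sdp : sqint a b (derive1 psi).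
  by apply: sqint_continuous; exact: continuous_subspaceT.
have i1 := sqint_mul sf sdp; have i2 := sqint_mul sg sp.
rewrite !Rintegral_oo_cc//; apply/eqP; rewrite -addr_eq0 -RintegralD//.
by rewrite H.
Qed.

Lemma wdiff_by_parts f g psi dpsi c d : wdiff f g ->
  (forall x : R, is_derive x 1 psi (dpsi x : R)) -> continuous dpsi ->
  a <= c -> c <= d -> d <= b ->
  \int[lam]_(x in `[c, d]) (f x * dpsi x + g x * psi x) =
  f d * psi d - f c * psi c.
Proof. by move=> [cf wf sg]; exact: weak_derivative_by_parts. Qed.

Lemma wdiff_ftc f g c d : wdiff f g -> a <= c -> c <= d -> d <= b ->
  \int[lam]_(x in `[c, d]) g x = f d - f c.
Proof. by move=> [cf wf sg]; exact: weak_derivative_ftc. Qed.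

Lemma wdiff_sqint f g : wdiff f g -> sqint a b f.
Proof. by move=> [cf _ _]; exact: sqint_continuous. Qed.

Lemma wdiff_test f g psi : wdiff f g -> test_function a b psi ->
  \int[lam]_(x in `[a, b]) (f x * derive1 psi x + g x * psi x) = 0.
Proof.
move=> wf /test_function_spec[dp cp cdp pa pb].
by rewrite (wdiff_by_parts wf dp cdp)// ?(ltW ab)// pa pb !mulr0 subrr.
Qed.

Lemma within_continuous_lin f g (k : R) : {within `[a, b], continuous f} ->
  {within `[a, b], continuous g} -> {within `[a, b], continuous (fun x => f x + k * g x)}.
Proof.
move=> /subspace_continuousP cf /subspace_continuousP cg; apply/subspace_continuousP => x xab.
by apply: cvgD; [exact: cf|apply: cvgM; [exact: cvg_cst|exact: cg]].
Qed.

Lemma wdiff_lin f f' g g' (k : R) : wdiff f f' -> wdiff g g' ->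
  wdiff (fun x => f x + k * g x) (fun x => f' x + k * g' x).
Proof.
move=> wf wg; have [cf _ sf'] := wf; have [cg _ sg'] := wg.
apply: wdiffI; [exact: within_continuous_lin|exact: sqint_lin|].
move=> psi tpsi; have [dp cp cdp _ _] := test_function_spec tpsi.
have i1 := by_parts_integrable cf sf' cp cdp.
have i2 := by_parts_integrable cg sg' cp cdp.
have i3 : lam.-integrable `[a, b] (EFin \o (fun x => k *
    (g x * derive1 psi x + g' x * psi x))) by exact: (integrableZl _ k i2).
transitivity (\int[lam]_(x in `[a, b]) ((f x * derive1 psi x + f' x * psi x) +
    k * (g x * derive1 psi x + g' x * psi x))).
  by apply: eq_Rintegral => x _; ring.
by rewrite RintegralD// RintegralZl// !wdiff_test// mulr0 addr0.
Qed.

Lemma wdiff_C1 (f f' : R -> R) : (forall x : R, is_derive x 1 f (f' x : R)) -> continuous f' ->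
  wdiff f f'.
Proof.
move=> df cf'.
have cf : continuous f by move=> x; exact: is_derive_continuous (df x).
apply: wdiffI; [exact: continuous_subspaceT| |].
  by apply: sqint_continuous; exact: continuous_subspaceT.
move=> psi /test_function_spec[dp cp cdp pa pb].
have dfp (x : R) : is_derive x 1 (fun x => f x * psi x) (f x * derive1 psi x + f' x * psi x).
  have h1 := df x; have h2 := dp x.
  by apply: is_derive_eq; rewrite /GRing.scale/= [psi x * _]mulrC.
rewrite (Rintegral_FTC2 ab dfp) ?pa ?pb ?mulr0 ?subrr//.
by move=> x; apply: cvgD; apply: cvgM; [exact: cf|exact: cdp|exact: cf'|exact: cp].
Qed.

Lemma sqint_patch g c d : a <= c -> d <= b -> sqint a b g ->
  sqint a b (g \_ `[c, d]).
Proof.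
move=> ac db [mg g2].
have mp : measurable_fun `[a, b]%classic (g \_ `[c, d]).
  by apply/measurable_restrict => //; apply: measurable_funS mg.
split => //.
apply: (@le_integrable _ _ _ lam `[a, b] _ _ (EFin \o (fun x => g x ^+ 2))) => //.
+ by apply/measurable_EFinP/measurable_funX; exact: mp.
+ move=> x _; rewrite /= lee_fin !ger0_norm ?sqr_ge0// patchE.
  by case: ifP => // _; rewrite expr0n/= sqr_ge0.
Qed.

(** Cutting creates no boundary term: at an end of [c, d] either [f] vanishes, or the end is [a] or
    [b], where test functions vanish. *)
Lemma wdiff_cut f g c d : a <= c -> c < d -> d <= b ->
  c = a \/ f c = 0 -> d = b \/ f d = 0 -> wdiff f g ->
  wdiff (f \_ `[c, d]) (g \_ `[c, d]).
Proof.
move=> ac cd db fc fd wf; have [cf _ [mg g2]] := wf.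
have sub : `[c, d] `<=` `[a, b]%classic by apply: subset_itv; rewrite bnd_simp.
apply: wdiffI.
- have cfc : {within `[c, d], continuous f} by exact: continuous_subspaceW cf.
  have := continuous_subspaceT (A := `[a, b]%classic) (continuous_clamp (ltW cd) cfc).
  apply: subspace_eq_continuous => x; rewrite inE/= in_itv/= => /andP[ax xb].
  change (f (clamp c d x) = (f \_ `[c, d]) x).
  rewrite patchE; have [xcd|xcd] := boolP (x \in `[c, d]).
    by rewrite mem_set//= clamp_id.
  rewrite memNset; last exact/negP.
  move: xcd; rewrite in_itv/= negb_and -!ltNge => /orP[xc|dx].
  + have -> : clamp c d x = c.
      by rewrite /clamp max_l// ge_min (ltW xc).
    by case: fc => // ca; move: xc; rewrite ca ltNge ax.
  + have -> : clamp c d x = d.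
      by rewrite /clamp min_r ?(ltW dx)// max_r// ltW.
    by case: fd => // db'; move: dx; rewrite db' ltNge xb.
- exact: sqint_patch.
- move=> psi /test_function_spec[dp cp cdp pa pb].
  rewrite (@Rintegral_zero_outside _ _ `[c, d])//.
    transitivity (\int[lam]_(x in `[c, d]) (f x * derive1 psi x + g x * psi x)).
      by apply: eq_Rintegral => x xcd; rewrite !patchE xcd.
    rewrite (wdiff_by_parts wf dp cdp)// ?(ltW cd)//.
    have -> : f d * psi d = 0 by case: fd => ->; rewrite ?pb ?mulr0 ?mul0r.
    have -> : f c * psi c = 0 by case: fc => ->; rewrite ?pa ?mulr0 ?mul0r.
    by rewrite subrr.
  by move=> x _ xcd; rewrite !patchE memNset// !mul0r addr0.
Qed.

End weakly_differentiable.

(** * The Hilbert space H^1 *)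

Section prehilbert.
Context {R : realType} {T : Type} (H : set (T -> R)) (ip : (T -> R) -> (T -> R) -> R).
Hypothesis H_lin : forall f g c, H f -> H g -> H (fun x => f x + c * g x).
Hypothesis ipC : forall f g, ip f g = ip g f.
Hypothesis ip_lin : forall f g h c, H f -> H g -> H h ->
  ip (fun x => f x + c * g x) h = ip f h + c * ip g h.
Hypothesis ip_ge0 : forall f, H f -> 0 <= ip f f.

Lemma ip_linr f g h c : H f -> H g -> H h ->
  ip h (fun x => f x + c * g x) = ip h f + c * ip h g.
Proof. by move=> Hf Hg Hh; rewrite ipC ip_lin// ![ip _ h]ipC. Qed.

Lemma H_zero f : H f -> H (fun=> 0).
Proof.
move=> Hf; have := H_lin (-1) Hf Hf; congr H.
by apply/funext => x; rewrite mulN1r subrr.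
Qed.

Lemma ip_zero f : H f -> ip (fun=> 0) f = 0.
Proof.
move=> Hf; have := ip_lin (-1) Hf Hf Hf.
rewrite mulN1r subrr => E; rewrite -[RHS]E; congr (ip _ f).
by apply/funext => x; rewrite mulN1r subrr.
Qed.

Lemma H_sum (I : Type) (s : seq I) (f : I -> T -> R) (c : I -> R) h : H h ->
  (forall i, H (f i)) -> H (fun x => \sum_(i <- s) c i * f i x).
Proof.
move=> Hh Hf; elim: s => [|i s IH].
  by have := H_zero Hh; congr H; apply/funext => x; rewrite big_nil.
have := H_lin (c i) IH (Hf i); congr H.
by apply/funext => x; rewrite big_cons addrC.
Qed.

Lemma ip_sum (I : Type) (s : seq I) (f : I -> T -> R) (c : I -> R) h : H h ->
  (forall i, H (f i)) ->
  ip (fun x => \sum_(i <- s) c i * f i x) h = \sum_(i <- s) c i * ip (f i) h.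
Proof.
move=> Hh Hf; elim: s => [|i s IH].
  rewrite big_nil -[RHS](ip_zero Hh); congr (ip _ h).
  by apply/funext => x; rewrite big_nil.
rewrite big_cons -IH addrC -ip_lin//; last exact: H_sum Hh Hf.
by congr (ip _ h); apply/funext => x; rewrite big_cons addrC.
Qed.

Lemma ip_expand f g c : H f -> H g ->
  ip (fun x => f x + c * g x) (fun x => f x + c * g x) =
  ip f f + 2 * c * ip f g + c ^+ 2 * ip g g.
Proof.
move=> Hf Hg; have Hl := H_lin c Hf Hg.
by rewrite ip_lin// !ip_linr// [ip g f]ipC; ring.
Qed.

Lemma cauchy_schwarz_sqr f g : H f -> H g -> ip f g ^+ 2 <= ip f f * ip g g.
Proof.
move=> Hf Hg; have f0 := ip_ge0 Hf; have g0 := ip_ge0 Hg.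
have key c : 0 <= ip f f + 2 * c * ip f g + c ^+ 2 * ip g g.
  by rewrite -ip_expand//; apply: ip_ge0; exact: H_lin.
have [g00|gn0] := eqVneq (ip g g) 0.
  have [->|fg] := eqVneq (ip f g) 0; first by rewrite expr0n/= mulr_ge0.
  (* In this degenerate case the expansion is affine in [c], and this value of [c] makes it equal to
     -1. *)
  have := key (- (ip f f + 1) / (2 * ip f g)).
  rewrite g00 mulr0 addr0.
  rewrite (_ : 2 * _ * _ = - (ip f f + 1)); last by field.
  lra.
have gp : 0 < ip g g by rewrite lt_def gn0.
have := key (- ip f g / ip g g).
have -> : ip f f + 2 * (- ip f g / ip g g) * ip f g + (- ip f g / ip g g) ^+ 2 * ip g g
  = (ip f f * ip g g - ip f g ^+ 2) / ip g g by field.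
by rewrite ler_pdivlMr// mul0r subr_ge0.
Qed.

Lemma cauchy_schwarz f g : H f -> H g ->
  `|ip f g| <= Num.sqrt (ip f f) * Num.sqrt (ip g g).
Proof.
move=> Hf Hg; rewrite -sqrtrM ?ip_ge0//.
by rewrite -sqrtr_sqr ler_sqrt ?cauchy_schwarz_sqr// mulr_ge0 ?ip_ge0.
Qed.

(** Pythagoras for an orthogonal family with squared norms [s i]. The same coefficients serve both
    in L^2, with [s i = 1], and in H^1, with [s i = 1 + lambda i]. *)
Lemma ip_residual n (f : nat -> T -> R) (c s : nat -> R) h : H h -> (forall i, H (f i)) ->
  (forall i j, ip (f i) (f j) = s i * (i == j)%:R) -> (forall i, ip h (f i) = s i * c i) ->
  ip (fun x => h x - \sum_(i < n) c i * f i x) (fun x => h x - \sum_(i < n) c i * f i x) =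
  ip h h - \sum_(i < n) s i * c i ^+ 2.
Proof.
move=> Hh Hf fij hf; pose S x := \sum_(i < n) c i * f i x.
have Hf' (i : 'I_n) : H (f i) by [].
have HS : H S by exact: (H_sum _ _ Hh Hf').
have -> : (fun x => h x - \sum_(i < n) c i * f i x) = (fun x => h x + -1 * S x).
  by apply/funext => x; rewrite mulN1r.
rewrite ip_expand// [ip h S]ipC.
have SE g : H g -> ip S g = \sum_(i < n) c i * ip (f i) g.
  by move=> Hg; exact: (ip_sum _ _ Hg Hf').
have -> : ip S h = \sum_(i < n) s i * c i ^+ 2.
  by rewrite SE//; apply: eq_bigr => i _; rewrite [ip _ h]ipC hf; ring.
have -> : ip S S = \sum_(i < n) s i * c i ^+ 2.
  rewrite SE//; apply: eq_bigr => i _.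
  rewrite [ip _ S]ipC SE// (bigD1 i)//= big1 ?addr0.
    by rewrite fij eqxx/= mulr1; ring.
  by move=> j ji; rewrite fij (negbTE (_ : (j : nat) != i))// !mulr0.
ring.
Qed.

End prehilbert.

(** * H^1(mu) as an inner product space *)

Section H1.
Context {R : realType} (a b : R) (mu : probability (measurableTypeR R) R).
Context (rho : R -> R).
Hypothesis ab : a < b.
Hypothesis rho_gt0 : forall x, x \in `[a, b] -> 0 < rho x.
Hypothesis rho_cont : {within `[a, b], continuous rho}.
Hypothesis rho_density : forall A : set (measurableTypeR R), measurable A ->
  mu A = (\int[lebesgue_measure]_(x in A `&` `[a, b]) (rho x)%:E)%E.

Local Notation lam := (@lebesgue_measure R).
Local Notation H1 := (H1 a b mu).
Local Notation L2ip := (L2ip a b mu).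
Local Notation H1ip := (H1ip a b mu).
Local Notation D := (weak_derivative a b).
Local Notation wdiff := (wdiff a b).

Lemma wdiff_H1 (f g : R -> R) : wdiff f g -> H1 f.
Proof.
move=> [cf wf sg]; split => //.
  exact/(L2_sqint rho_gt0 rho_cont rho_density)/sqint_continuous.
by exists g => //; exact/(L2_sqint rho_gt0 rho_cont rho_density).
Qed.

(** [weak_derivative] may have picked another version than the square-integrable one provided by
    [H1]; almost everywhere uniqueness transfers square integrability to it. *)
Lemma H1_wdiff (f : R -> R) : H1 f -> wdiff f (D f).
Proof.
move=> [cf _ [g wg /(L2_sqint rho_gt0 rho_cont rho_density) sg]].
have wD : is_weak_derivative a b f (D f) by apply: (xgetPex (cst 0)); exists g.
split => //; apply: sqint_ae (weak_derivative_unique ab cf wg wD) sg.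
have [_ [mD _ _] _] := wD.
exact: measurable_fun_itv_cc mD.
Qed.

Lemma wdiff_ae (f g : R -> R) : wdiff f g -> ae_eq lam `[a, b]%classic (D f) g.
Proof.
move=> wf; have [cf wg _] := wf; have [_ wD _] := H1_wdiff (wdiff_H1 wf).
exact (weak_derivative_unique ab cf wD wg).
Qed.

Lemma L2ip_weak_derivative (f g f' g' : R -> R) : wdiff f f' -> wdiff g g' ->
  L2ip (D f) (D g) = L2ip f' g'.
Proof.
move=> wf wg; have [_ _ sf'] := wf; have [_ _ sg'] := wg.
have [_ _ sDf] := H1_wdiff (wdiff_H1 wf); have [_ _ sDg] := H1_wdiff (wdiff_H1 wg).
have E := L2ip_ae rho_cont rho_density.
rewrite (E _ _ _ sDf sf' sDg (wdiff_ae wf)) L2ipC.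
by rewrite (E _ _ _ sDg sg' sf' (wdiff_ae wg)) L2ipC.
Qed.

Lemma H1ip_wdiff (f g f' g' : R -> R) : wdiff f f' -> wdiff g g' ->
  H1ip f g = L2ip f g + L2ip f' g'.
Proof. by move=> wf wg; rewrite /Defs.H1ip (L2ip_weak_derivative wf wg). Qed.

Lemma H1_lin (f g : R -> R) (c : R) : H1 f -> H1 g -> H1 (fun x => f x + c * g x).
Proof.
by move=> /H1_wdiff wf /H1_wdiff wg; exact: wdiff_H1 (wdiff_lin ab c wf wg).
Qed.

Lemma H1_sqint (f : R -> R) : H1 f -> sqint a b f.
Proof. by move=> [cf _ _]; exact: sqint_continuous. Qed.

Lemma H1ipC (f g : R -> R) : H1ip f g = H1ip g f.
Proof. by rewrite /Defs.H1ip (L2ipC a b mu f) (L2ipC a b mu (weak_derivative a b f)). Qed.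

Lemma H1ip_lin (f g h : R -> R) (c : R) : H1 f -> H1 g -> H1 h ->
  H1ip (fun x => f x + c * g x) h = H1ip f h + c * H1ip g h.
Proof.
move=> Hf Hg Hh; have wf := H1_wdiff Hf; have wg := H1_wdiff Hg; have wh := H1_wdiff Hh.
rewrite (H1ip_wdiff (wdiff_lin ab c wf wg) wh) /Defs.H1ip.
have [_ _ sf] := wf; have [_ _ sg] := wg; have [_ _ sh] := wh.
rewrite !(L2ip_lin rho_gt0 rho_cont rho_density)//; try exact: H1_sqint.
by rewrite mulrDr addrACA.
Qed.

Lemma H1ip_ge0 (f : R -> R) : 0 <= H1ip f f.
Proof. by rewrite addr_ge0// L2ip_ge0. Qed.

Lemma H1_cauchy_schwarz (f g : R -> R) : H1 f -> H1 g ->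
  `|H1ip f g| <= H1norm a b mu f * H1norm a b mu g.
Proof.
move=> Hf Hg.
exact: (cauchy_schwarz H1_lin H1ipC H1ip_lin (fun f _ => H1ip_ge0 f) Hf Hg).
Qed.

Lemma L2_cauchy_schwarz_sqr (f g : R -> R) : sqint a b f -> sqint a b g ->
  L2ip f g ^+ 2 <= L2ip f f * L2ip g g.
Proof.
move=> sf sg; apply: (@cauchy_schwarz_sqr R R (sqint a b) L2ip) => //.
- by move=> u v c; exact: sqint_lin.
- by move=> u v; exact: L2ipC.
- by move=> u v w c; exact: (L2ip_lin rho_gt0 rho_cont rho_density).
- by move=> u _; exact: L2ip_ge0.
Qed.

End H1.

(** * Sobolev embedding *)

Section sobolev.
Context {R : realType} (a b : R) (mu : probability (measurableTypeR R) R).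
Context (rho : R -> R).
Hypothesis ab : a < b.
Hypothesis rho_gt0 : forall x, x \in `[a, b] -> 0 < rho x.
Hypothesis rho_cont : {within `[a, b], continuous rho}.
Hypothesis rho_density : forall A : set (measurableTypeR R), measurable A ->
  mu A = (\int[lebesgue_measure]_(x in A `&` `[a, b]) (rho x)%:E)%E.
Variable c0 : R.
Hypothesis c0_gt0 : 0 < c0.
Hypothesis rho_ge : forall x, x \in `[a, b] -> c0 <= rho x.

Local Notation lam := (@lebesgue_measure R).
Local Notation H1 := (H1 a b mu).
Local Notation L2ip := (L2ip a b mu).
Local Notation H1ip := (H1ip a b mu).
Local Notation H1norm := (H1norm a b mu).
Local Notation wdiff := (wdiff a b).

Lemma invr_density_continuous : {within `[a, b], continuous (fun x => (rho x)^-1)}.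
Proof.
apply/subspace_continuousP => x xab; apply: cvgV; first by rewrite gt_eqF// rho_gt0.
by move/subspace_continuousP : rho_cont; exact.
Qed.

Lemma Rintegral_itv_cst (c d k : R) : c <= d -> \int[lam]_(x in `[c, d]) k = k * (d - c).
Proof.
move=> cd; rewrite Rintegral_cst//= lebesgue_measure_itv/= lte_fin.
by move: cd; rewrite le_eqVlt => /predU1P[->|->]; rewrite ?ltxx ?subrr.
Qed.

Lemma density_mul_integrable (f g : R -> R) : sqint a b f -> sqint a b g ->
  lam.-integrable `[a, b] (EFin \o (fun x => f x * g x * rho x)).
Proof.
move=> sf sg; have [C C0 hC] := within_continuous_bounded rho_cont.
apply: (@le_integrable _ _ _ lam `[a, b] _ _ (fun x => C%:E * (f x * g x)%:E)%E) => //.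
- apply/measurable_EFinP; apply: measurable_funM; last exact: within_continuous_measurable.
  by apply: measurable_funM; [case: sf|case: sg].
- move=> x xab; rewrite -EFinM !abse_EFin lee_fin !normrM [leLHS]mulrC.
  by rewrite ler_wpM2r// (ger0_norm (ltW C0)) hC.
- by apply: integrableZl => //; exact: sqint_mul.
Qed.

(** The increment is the [L2ip] of [g] with the indicator of [c, d] divided by [rho], whose squared
    norm is at most [(d - c) / c0]; Cauchy-Schwarz concludes. *)
Lemma wdiff_holder (f g : R -> R) (c d : R) : wdiff f g -> a <= c -> c <= d -> d <= b ->
  (f d - f c) ^+ 2 <= (d - c) / c0 * L2ip g g.
Proof.
move=> wf ac cd db; have [_ _ sg] := wf.
pose v x := (rho x)^-1; pose w := v \_ `[c, d].
have sv : sqint a b v by apply: sqint_continuous; exact: invr_density_continuous.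
have sw : sqint a b w by exact: sqint_patch.
have sub : `[c, d] `<=` `[a, b]%classic by apply: subset_itv; rewrite bnd_simp.
have gw : L2ip g w = f d - f c.
  rewrite (L2ipE rho_gt0 rho_cont rho_density sg sw) (@Rintegral_zero_outside _ _ `[c, d])//.
    rewrite -(wdiff_ftc ab wf ac cd db); apply: eq_Rintegral => x xcd.
    rewrite /w patchE xcd /v -mulrA mulVf ?mulr1// gt_eqF// rho_gt0//.
    by apply: sub; exact/set_mem.
  by move=> x _ xcd; rewrite /w patchE memNset// mulr0 mul0r.
have ww : L2ip w w <= (d - c) / c0.
  rewrite (L2ipE rho_gt0 rho_cont rho_density sw sw) (@Rintegral_zero_outside _ _ `[c, d])//;
    last by move=> x _ xcd; rewrite /w patchE memNset// mulr0 mul0r.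
  rewrite mulrC -(Rintegral_itv_cst _ cd); apply: le_Rintegral => //.
  - by apply: integrableS (density_mul_integrable sw sw).
  - by apply: within_continuous_integrable; exact: continuous_subspaceT (@cst_continuous _ _ _).
  - move=> x xcd; have xab := sub _ xcd; rewrite /w patchE mem_set// /v -mulrA mulVf ?mulr1.
      by rewrite lef_pV2 ?posrE ?rho_gt0 ?rho_ge.
    by rewrite gt_eqF// rho_gt0.
rewrite -gw (le_trans (L2_cauchy_schwarz_sqr rho_gt0 rho_cont rho_density sg sw))//.
by rewrite mulrC ler_wpM2r// L2ip_ge0.
Qed.

Lemma L2ip_ge_itv (f : R -> R) (c d m : R) : sqint a b f -> a <= c -> c <= d -> d <= b ->
  0 <= m -> (forall x, x \in `[c, d] -> m <= `|f x|) ->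
  m ^+ 2 * (c0 * (d - c)) <= L2ip f f.
Proof.
move=> sf ac cd db m0 hm.
have sub : `[c, d] `<=` `[a, b]%classic by apply: subset_itv; rewrite bnd_simp.
rewrite (L2ipE rho_gt0 rho_cont rho_density sf sf) mulrA -(Rintegral_itv_cst _ cd).
have iff_ := density_mul_integrable sf sf.
apply: (@le_trans _ _ (\int[lam]_(x in `[c, d]) (f x * f x * rho x))).
  apply: le_Rintegral => //.
  - by apply: within_continuous_integrable; exact: continuous_subspaceT (@cst_continuous _ _ _).
  - by apply: integrableS iff_.
  - move=> x xcd; have xab := sub _ xcd; rewrite -expr2 -(real_normK (num_real (f x))).
    apply: ler_pM; rewrite ?sqr_ge0 ?(ltW c0_gt0) ?rho_ge//.
    by rewrite lerXn2r ?nnegrE// hm.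
pose p := f \_ `[c, d]; have sp : sqint a b p by exact: sqint_patch.
rewrite [leLHS](_ : _ = \int[lam]_(x in `[a, b]) (p x * p x * rho x)).
  apply: le_Rintegral => //; first exact: density_mul_integrable.
  move=> x xab; rewrite /p patchE; case: ifPn => // _.
  by rewrite !mul0r mulr_ge0// -?expr2 ?sqr_ge0// ltW// rho_gt0.
rewrite [RHS](@Rintegral_zero_outside _ _ `[c, d])//.
  by apply: eq_Rintegral => x xcd; rewrite /p patchE xcd.
by move=> x _ xcd; rewrite /p patchE memNset// !mul0r.
Qed.

Lemma H1normE (f : R -> R) : H1norm f ^+ 2 = H1ip f f.
Proof. by rewrite sqr_sqrtr// H1ip_ge0. Qed.

Lemma H1norm_ge0 (f : R -> R) : 0 <= H1norm f.
Proof. exact: sqrtr_ge0. Qed.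

Lemma L2ip_le_H1norm (f : R -> R) : L2ip f f <= H1norm f ^+ 2.
Proof. by rewrite H1normE lerDl L2ip_ge0. Qed.

(** By the Hölder estimate [f] stays close to [f x] on an interval of length [del] around or beside
    [x], and its size there is controlled by the L^2 norm. The free [del] is what turns a bounded
    H^1 norm and a small L^2 norm into a small supremum. *)
Lemma H1_sup_le (f : R -> R) (x del : R) : H1 f -> x \in `[a, b] ->
  0 < del -> del <= b - a ->
  `|f x| <= Num.sqrt (del / c0) * H1norm f + Num.sqrt (L2ip f f / (c0 * del)).
Proof.
move=> Hf xab del0 delab; have wf := H1_wdiff ab rho_gt0 rho_cont rho_density Hf.
have sf := wdiff_sqint wf.
(* An interval of length [del] that contains [x], shifted left when [x] is too close to [b]. *)
pose c := Num.min x (b - del); pose d := c + del.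
have [ax xb] : a <= x /\ x <= b by move: xab; rewrite in_itv => /andP.
have ac : a <= c by rewrite le_min ax/=; lra.
have db : d <= b by rewrite /d -lerBrDr ge_min lexx orbT.
have cd : c <= d by rewrite lerDl ltW.
have cx : c <= x by rewrite ge_min lexx.
have xd : x <= d.
  by rewrite /d /c; case: (leP x (b - del)) => h; [rewrite lerDl ltW|rewrite subrK].
have osc z : z \in `[c, d] -> `|f x| - Num.sqrt (del / c0) * H1norm f <= `|f z|.
  rewrite in_itv/= => /andP[cz zd].
  rewrite lerBlDr -lerBlDl (le_trans (lerB_dist _ _))//.
  have k0 : 0 <= del / c0 by rewrite divr_ge0// ltW.
  rewrite -(ler_pXn2r (n := 2))// ?nnegrE ?mulr_ge0 ?sqrtr_ge0// real_normK ?num_real//.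
  rewrite exprMn sqr_sqrtr// H1normE.
  have L := L2ip_ge0 a b mu (weak_derivative a b f).
  apply: (@le_trans _ _ 
    (del / c0 * L2ip (weak_derivative a b f) (weak_derivative a b f))); last first.
    by rewrite ler_wpM2l// lerDr L2ip_ge0.
  have aux u v : c <= u -> u <= v -> v <= d -> (f v - f u) ^+ 2 <=
      del / c0 * L2ip (weak_derivative a b f) (weak_derivative a b f).
    move=> cu uv vd; apply: (le_trans (wdiff_holder wf _ uv _)).
    - exact: le_trans cu.
    - exact: le_trans db.
    - rewrite ler_wpM2r// ler_wpM2r ?invr_ge0 ?(ltW c0_gt0)//.
      by move: vd; rewrite /d; lra.
  have [xz|zx] := leP x z; last by apply: aux => //; exact: ltW.
  by rewrite -sqrrN opprB; exact: aux.
rewrite -lerBlDl; set m := _ - _ in osc *.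
have [m0|m0] := leP m 0; first by rewrite (le_trans m0)// sqrtr_ge0.
rewrite -[leLHS](ger0_norm (ltW m0)) -sqrtr_sqr ler_sqrt; last first.
  by rewrite divr_ge0 ?L2ip_ge0// mulr_ge0// ltW.
rewrite ler_pdivlMr ?mulr_gt0//.
have := L2ip_ge_itv sf ac cd db (ltW m0) osc.
by rewrite /d [c + del]addrC addrK.
Qed.

Lemma H1_sup_norm : exists2 C : R, 0 < C &
  forall f x, H1 f -> x \in `[a, b] -> `|f x| <= C * H1norm f.
Proof.
have ba0 : 0 < b - a by rewrite subr_gt0.
exists (Num.sqrt ((b - a) / c0) + Num.sqrt ((c0 * (b - a))^-1)).
  by rewrite ltr_pwDl// ?sqrtr_ge0// sqrtr_gt0 divr_gt0.
move=> f x Hf xab; apply: (le_trans (H1_sup_le Hf xab ba0 (lexx _))).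
rewrite [leRHS]mulrDl lerD2l sqrtrM ?L2ip_ge0// [leLHS]mulrC ler_wpM2l ?sqrtr_ge0//.
rewrite -[leRHS]ger0_norm ?H1norm_ge0// -sqrtr_sqr ler_sqrt ?sqr_ge0//.
exact: L2ip_le_H1norm.
Qed.

End sobolev.

(** * Eigenfunction expansions *)

Section expansion.
Context {R : realType} (a b : R) (mu : probability (measurableTypeR R) R).
Context (rho : R -> R) (lambda : nat -> R) (phi : nat -> R -> R) (K : R -> R -> R).
Hypothesis ab : a < b.
Hypothesis rho_gt0 : forall x, x \in `[a, b] -> 0 < rho x.
Hypothesis rho_cont : {within `[a, b], continuous rho}.
Hypothesis rho_density : forall A : set (measurableTypeR R), measurable A ->
  mu A = (\int[lebesgue_measure]_(x in A `&` `[a, b]) (rho x)%:E)%E.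
Hypothesis PB : poincare_basis a b mu lambda phi.
Hypothesis KR : reproducing_kernel `[a, b] (H1 a b mu) (H1ip a b mu) K.

Local Notation lam := (@lebesgue_measure R).
Local Notation H1 := (H1 a b mu).
Local Notation L2ip := (L2ip a b mu).
Local Notation H1ip := (H1ip a b mu).
Local Notation H1norm := (H1norm a b mu).
Local Notation al := (alpha lambda).

Lemma lambda_le m n : (m <= n)%N -> lambda m <= lambda n.
Proof.
by apply: (@homo_leq _ lambda (<=%R)) => // [x y z|i];
  [exact: le_trans|exact: ltW (poincare_lambda_lt PB i)].
Qed.

Lemma lambda_lt m n : (m < n)%N -> lambda m < lambda n.
Proof. by move=> mn; rewrite (lt_le_trans (poincare_lambda_lt PB m))// lambda_le. Qed.

Lemma lambda_ge0 m : 0 <= lambda m.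
Proof. by rewrite -(poincare_lambda0 PB) lambda_le. Qed.

Lemma lambda1_gt0 m : 0 < 1 + lambda m.
Proof. by rewrite ltr_pwDl// lambda_ge0. Qed.

Lemma alpha_gt0 m : 0 < al m.
Proof. by rewrite invr_gt0 lambda1_gt0. Qed.

Lemma alpha_le m n : (m <= n)%N -> al n <= al m.
Proof. by move=> mn; rewrite lef_pV2 ?posrE ?lambda1_gt0// lerD2l lambda_le. Qed.

Lemma alpha_lt m n : (m < n)%N -> al n < al m.
Proof. by move=> mn; rewrite ltf_pV2 ?posrE ?lambda1_gt0// ltrD2l lambda_lt. Qed.

Lemma alphaV m : al m * (1 + lambda m) = 1.
Proof. by rewrite mulVf// gt_eqF// lambda1_gt0. Qed.

Lemma alpha_small e : 0 < e -> exists N, al N <= e.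
Proof.
move=> e0; have : \forall n \near \oo, e^-1 <= lambda n.
  exact: (cvgryPge _).1 (poincare_lambda_cvg PB) _.
move=> [N _ /(_ N (leqnn _))/= h]; exists N.
rewrite -[leRHS]invrK lef_pV2 ?posrE ?lambda1_gt0 ?invr_gt0//.
by rewrite (le_trans h)// lerDr.
Qed.

Lemma phi_H1 m : H1 (phi m).
Proof. by case: (poincare_eigen PB m). Qed.

Lemma phi_sqint m : sqint a b (phi m).
Proof. exact: H1_sqint (phi_H1 m). Qed.

Lemma H1ip_phi m g : H1 g -> H1ip (phi m) g = (1 + lambda m) * L2ip (phi m) g.
Proof.
move=> Hg; have [_ /(_ g Hg) E] := poincare_eigen PB m.
by rewrite /Defs.H1ip E mulrDl mul1r.
Qed.

Definition coef (h : R -> R) m := L2ip h (phi m).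

Lemma H1ip_phi_r h m : H1 h -> H1ip h (phi m) = (1 + lambda m) * coef h m.
Proof. by move=> Hh; rewrite H1ipC H1ip_phi// L2ipC. Qed.

Lemma H1ip_phi2 i j : H1ip (phi i) (phi j) = (1 + lambda i) * (i == j)%:R.
Proof. by rewrite H1ip_phi ?(poincare_orthonormal PB)//; exact: phi_H1. Qed.

Definition residual (h : R -> R) N x := h x - \sum_(m < N) coef h m * phi m x.

Let H1l := fun f g c => @H1_lin R a b mu rho ab rho_gt0 rho_cont rho_density f g c.
Let H1il := fun f g h c => @H1ip_lin R a b mu rho ab rho_gt0 rho_cont rho_density f g h c.
Let L2l := fun f g c => @sqint_lin R a b f g c.
Let L2il := fun f g h c => @L2ip_lin R a b mu rho rho_gt0 rho_cont rho_density f g h c.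

Lemma H1_sum_phi N (c : nat -> R) : H1 (fun x => \sum_(m < N) c m * phi m x).
Proof.
exact: (@H_sum R R H1 H1l 'I_N (index_enum 'I_N) (fun m => phi m) (fun m => c m)
  _ (phi_H1 0%N) (fun m => phi_H1 m)).
Qed.

Lemma H1_residual h N : H1 h -> H1 (residual h N).
Proof.
move=> Hh; have := H1l (-1) Hh (H1_sum_phi N (coef h)); congr H1.
by apply/funext => x; rewrite mulN1r.
Qed.

Lemma H1ip_residual h N : H1 h ->
  H1ip (residual h N) (residual h N) =
  H1ip h h - \sum_(m < N) (1 + lambda m) * coef h m ^+ 2.
Proof.
move=> Hh; apply: (ip_residual H1l (H1ipC a b mu) H1il N Hh phi_H1 H1ip_phi2).
by move=> i; exact: H1ip_phi_r.
Qed.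

Lemma L2ip_residual h N : H1 h ->
  L2ip (residual h N) (residual h N) = L2ip h h - \sum_(m < N) coef h m ^+ 2.
Proof.
move=> Hh.
rewrite (@ip_residual _ _ (sqint a b) L2ip L2l (L2ipC a b mu) L2il N phi (coef h) (fun=> 1))//.
- by under eq_bigr do rewrite mul1r.
- exact: H1_sqint Hh.
- exact: phi_sqint.
- by move=> i j; rewrite mul1r (poincare_orthonormal PB).
- by move=> i; rewrite mul1r.
Qed.

Lemma bessel h N : H1 h -> \sum_(m < N) (1 + lambda m) * coef h m ^+ 2 <= H1ip h h.
Proof. by move=> Hh; rewrite -subr_ge0 -H1ip_residual// H1ip_ge0. Qed.

Lemma residual_norm_le h N : H1 h -> H1norm (residual h N) <= H1norm h.
Proof.
move=> Hh; rewrite /Defs.H1norm; apply: ler_wsqrtr.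
rewrite (H1ip_residual N Hh) gerBl sumr_ge0// => i _.
by rewrite mulr_ge0 ?sqr_ge0// ltW// lambda1_gt0.
Qed.

Lemma L2ip_residual_cvg h : H1 h -> L2ip (residual h N) (residual h N) @[N --> \oo] --> 0.
Proof.
move=> Hh; have [_ L2h _] := Hh.
have := poincare_complete PB L2h => H.
have E N : L2ip (residual h N) (residual h N) =
    L2norm a b mu (residual h N) * L2norm a b mu (residual h N).
  by rewrite -expr2 sqr_sqrtr// L2ip_ge0.
under eq_cvg => N do rewrite E.
by have := cvgM H H; rewrite mulr0; apply.
Qed.

(* Components on [phi m] with [m >= N] weigh at least [1 + lambda N] times more
   in the H^1 norm than in the L^2 norm. *)
Lemma L2ip_residual_le h N : H1 h ->
  L2ip (residual h N) (residual h N) <= al N * H1ip h h.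
Proof.
move=> Hh; apply/ler_addgt0Pr => e e0.
(* Completeness is given in L^2 only: it absorbs the tail beyond a large [k] into [e], while the
   finite block from [N] to [k] is compared with Bessel's inequality in H^1. *)
have /cvgrPdist_le/(_ _ e0) [K0 _ hK0] := L2ip_residual_cvg Hh.
pose k := (N + K0)%N.
have /hK0/= : (K0 <= k)%N by rewrite leq_addl.
rewrite sub0r normrN ger0_norm ?L2ip_ge0// => hk.
rewrite -lerBlDr (le_trans _ (ler_wpM2l (ltW (alpha_gt0 N)) (bessel k Hh)))//.
apply: (le_trans (lerB (lexx _) hk)).
rewrite !L2ip_residual// opprB addrC addrA subrK.
rewrite -!(big_mkord xpredT (fun m => coef h m ^+ 2)).
rewrite -(big_mkord xpredT (fun m => (1 + lambda m) * coef h m ^+ 2)).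
rewrite (@big_cat_nat _ _ _ N 0 k)//= ?leq_addr// addrAC subrr add0r.
rewrite (@big_cat_nat _ _ _ N 0 k)//= ?leq_addr// mulrDr.
rewrite ler_wpDl//.
  rewrite mulr_ge0 ?(ltW (alpha_gt0 _))// sumr_ge0// => i _.
  by rewrite mulr_ge0 ?sqr_ge0// ltW// lambda1_gt0.
rewrite mulr_sumr !big_nat; apply: ler_sum => i /andP[Ni _].
rewrite mulrA -[leLHS]mul1r ler_wpM2r ?sqr_ge0// -[leLHS](alphaV i).
by rewrite ler_wpM2r ?(ltW (lambda1_gt0 _))// alpha_le.
Qed.

Lemma residual_uniform e : 0 < e -> exists N0, forall N h x, (N0 <= N)%N ->
  H1 h -> x \in `[a, b] -> `|residual h N x| <= e * H1norm h.
Proof.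
move=> e0; have [c0 c00 rho_ge] := density_ge rho_gt0 rho_cont.
have ba0 : 0 < b - a by rewrite subr_gt0.
(* This value makes the first term of [H1_sup_le] at most half of the target; [N0] then makes
   [al N0 / (c0 * del)] at most [(e / 2) ^+ 2], which handles the second one. Neither depends on
   [h]. *)
pose del := Num.min (b - a) (c0 * (e / 2) ^+ 2).
have e20 : 0 < e / 2 by rewrite divr_gt0.
have del0 : 0 < del by rewrite lt_min ba0 mulr_gt0// exprn_gt0.
have delab : del <= b - a by rewrite ge_min lexx.
have [N0 hN0] := @alpha_small (c0 * del * (e / 2) ^+ 2) ltac:(by rewrite !mulr_gt0// exprn_gt0).
exists N0 => N h x N0N Hh xab.
have Hr := H1_residual N Hh.
apply: (le_trans (H1_sup_le ab rho_gt0 rho_cont rho_density c00 rho_ge Hr xab del0 delab)).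
have h0 := H1norm_ge0 a b mu h.
rewrite [e]splitr mulrDl; apply: lerD.
  apply: ler_pM; [exact: sqrtr_ge0|exact: H1norm_ge0| |exact: residual_norm_le].
  rewrite -[leRHS](ger0_norm (ltW e20)) -sqrtr_sqr; apply: ler_wsqrtr.
  by rewrite ler_pdivrMr// mulrC ge_min lexx orbT.
have q0 : 0 <= e / 2 * H1norm h by apply: mulr_ge0; [exact: ltW|].
rewrite -[leRHS](ger0_norm q0) -sqrtr_sqr; apply: ler_wsqrtr.
have cd0 : 0 < c0 * del by exact: mulr_gt0.
rewrite (ler_pdivrMr _ _ cd0); apply: (le_trans (L2ip_residual_le N Hh)).
rewrite exprMn -(H1normE a b mu h) mulrAC; apply: ler_wpM2r; first exact: sqr_ge0.
by rewrite (le_trans (alpha_le N0N))// mulrC.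
Qed.

Lemma K_H1 y : y \in `[a, b] -> H1 (K^~ y).
Proof. by move=> /KR[]. Qed.

Lemma K_repr y h : y \in `[a, b] -> H1 h -> H1ip h (K^~ y) = h y.
Proof. by move=> /KR[_]; exact. Qed.

Lemma coef_K y m : y \in `[a, b] -> coef (K^~ y) m = al m * phi m y.
Proof.
move=> yab; have := K_repr yab (phi_H1 m); rewrite H1ip_phi; last exact: K_H1.
by move=> <-; rewrite mulrA alphaV mul1r /coef L2ipC.
Qed.

(** Indexed by the number of terms: [truncated_kernel] at [M] is [Kpart M.+1]. *)
Definition Kpart N x y := \sum_(m < N) al m * phi m x * phi m y.

Lemma residual_K y N x : y \in `[a, b] -> residual (K^~ y) N x = K x y - Kpart N x y.
Proof.
move=> yab; congr (_ - _); apply: eq_bigr => m _.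
by rewrite coef_K// mulrAC.
Qed.

(** The squared norm of [K^~ y] is [K y y], which the supremum estimate bounds by [C] times the norm
    itself. *)
Lemma K_diag_bound : exists2 C : R, 0 < C & forall y, y \in `[a, b] ->
  H1norm (K^~ y) <= C.
Proof.
have [c0 c00 rho_ge] := density_ge rho_gt0 rho_cont.
have [C C0 hC] := H1_sup_norm ab rho_gt0 rho_cont rho_density c00 rho_ge.
exists C => // y yab; have H := hC _ _ (K_H1 yab) yab.
have E := K_repr yab (K_H1 yab); rewrite -(H1normE a b mu) in E.
have N0 := H1norm_ge0 a b mu (K^~ y).
have [->|n0] := eqVneq (H1norm (K^~ y)) 0; first exact: ltW.
have np : 0 < H1norm (K^~ y) by rewrite lt_def n0.
by move: H; rewrite -E ger0_norm ?sqr_ge0// expr2 ler_pM2r.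
Qed.

Lemma K_uniform e : 0 < e -> exists N0, forall N x y, (N0 <= N)%N ->
  x \in `[a, b] -> y \in `[a, b] -> `|K x y - Kpart N x y| <= e.
Proof.
move=> e0; have [C C0 hC] := K_diag_bound.
have [N0 hN0] := residual_uniform (divr_gt0 e0 C0).
exists N0 => N x y N0N xab yab; rewrite -residual_K//.
rewrite (le_trans (hN0 _ _ _ N0N (K_H1 yab) xab))// mulrAC ler_pdivrMr//.
by rewrite ler_wpM2l ?(ltW e0)// hC.
Qed.

(** Bessel's inequality for [K^~ x], whose weighted squared coefficients are [al m * phi m x ^+ 2].
    Uniformity in [N] is what [quad_unisolvent] relies on. *)
Lemma Kpart_diag_le : exists2 B : R, 0 < B & forall N x, x \in `[a, b] ->
  \sum_(m < N) al m * phi m x ^+ 2 <= B.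
Proof.
have [C C0 hC] := K_diag_bound; exists (C ^+ 2); first exact: exprn_gt0.
move=> N x xab.
apply: (@le_trans _ _ (H1ip (K^~ x) (K^~ x))).
  apply: le_trans (bessel N (K_H1 xab)); apply: ler_sum => m _.
  rewrite coef_K// exprMn (_ : (1 + _) * _ = al m * (1 + lambda m) * al m * phi m x ^+ 2).
    by rewrite alphaV mul1r.
  by ring.
by rewrite -(H1normE a b mu) lerXn2r ?nnegrE ?H1norm_ge0 ?(ltW C0) ?hC.
Qed.

End expansion.

(** * Sturm theory *)

Section antiderivative.
Context {R : realType}.
Local Notation lam := (@lebesgue_measure R).

Lemma continuous_antiderivative (r : R -> R) : continuous r ->
  exists P : R -> R, forall x : R, is_derive x 1 P (r x).
Proof.
move=> cr.
(* The signed integral from 0 to [x]: at least one of the two intervals is empty or a point. Near a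
   given [x] it differs by a constant from the integral starting at a fixed [- N]. *)
pose P (x : R) := \int[lam]_(t in `[0, x]) r t - \int[lam]_(t in `[x, 0]) r t.
exists P => x.
pose N := `|x| + 1.
have xN : - N < x by rewrite /N; have := ler_norm (- x); rewrite normrN; lra.
have N0 : - N < 0 by rewrite oppr_lt0 ltr_wpDl.
have ir u v : lam.-integrable `[u, v] (EFin \o r).
  by apply: within_continuous_integrable; exact: continuous_subspaceT.
have PE y : - N < y -> P y = \int[lam]_(t in `[- N, y]) r t - \int[lam]_(t in `[- N, 0]) r t.
  move=> Ny; rewrite /P; have [y0|y0] := leP 0 y.
    have iy := ir (- N) y.
    rewrite (Rintegral_itvB iy) ?bnd_simp//; last by rewrite ltW.
    rewrite Rintegral_itv_obnd_cbnd; last first.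
      by apply: integrableS (ir 0 y) => //; exact: subset_itv_oc_cc.
    move: y0; rewrite le_eqVlt => /predU1P[<-|y0].
      by rewrite set_itv1 Rintegral_set1 subrr.
    have -> : `[y, 0]%classic = set0 by apply: set_itv_ge; rewrite bnd_simp -ltNge.
    by rewrite Rintegral_set0 subr0.
  rewrite -opprB -[RHS]opprB; congr (- _).
  have i0 := ir (- N) 0.
  rewrite (Rintegral_itvB i0) ?bnd_simp//; [|exact: ltW|exact: ltW].
  rewrite Rintegral_itv_obnd_cbnd; last first.
    by apply: integrableS (ir y 0) => //; exact: subset_itv_oc_cc.
  have -> : `[0, y]%classic = set0 by apply: set_itv_ge; rewrite bnd_simp -ltNge.
  by rewrite Rintegral_set0 subr0.
have [dG G'] := continuous_FTC1_closed (ltr_pwDr ltr01 (lexx x)) (ir (- N) (x + 1)) xN (cr x).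
have dG' : is_derive x 1 (fun y => \int[lam]_(t in `[- N, y]) r t) (r x).
  by apply: DeriveDef; [exact: dG|rewrite -derive1E; exact: G'].
have h : is_derive x 1
    (fun y => \int[lam]_(t in `[- N, y]) r t - \int[lam]_(t in `[- N, 0]) r t) (r x).
  by apply: is_derive_eq; rewrite subr0.
apply: near_eq_is_derive h; near=> y; rewrite PE//; near: y.
exact: lt_nbhsr.
Unshelve. all: by end_near. Qed.

End antiderivative.

(** * The Neumann problem as a first-order system *)

Section flux.
Context {R : realType} (a b : R) (r : R -> R).

(** The problem (r u')' = r h with Neumann conditions, where [F] is r u'. Derivatives are two-sided
    even at [a] and [b], so [u] must be differentiable there as a function on the line. *)
Definition flux (u F h : R -> R) : Prop :=
  [/\ forall x : R, x \in `[a, b] -> is_derive x 1 u (F x / r x : R),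
      forall x : R, x \in `[a, b] -> is_derive x 1 F (r x * h x : R),
      F a = 0 & F b = 0].

Lemma flux_lin u v F G h k (c : R) : flux u F h -> flux v G k ->
  flux (fun x => u x + c * v x) (fun x => F x + c * G x) (fun x => h x + c * k x).
Proof.
move=> [du dF Fa Fb] [dv dG Ga Gb]; split.
- move=> x xab; have h1 := du x xab; have h2 := dv x xab.
  by apply: is_derive_eq; rewrite /GRing.scale/=; ring.
- move=> x xab; have h1 := dF x xab; have h2 := dG x xab.
  by apply: is_derive_eq; rewrite /GRing.scale/=; ring.
- by rewrite Fa Ga mulr0 addr0.
- by rewrite Fb Gb mulr0 addr0.
Qed.

Lemma flux_sum n (u F h : nat -> R -> R) (c : nat -> R) :
  (forall i, flux (u i) (F i) (h i)) ->
  flux (fun x => \sum_(i < n) c i * u i x) (fun x => \sum_(i < n) c i * F i x)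
    (fun x => \sum_(i < n) c i * h i x).
Proof.
move=> fl; elim: n => [|n IH].
  have E (v : nat -> R -> R) : (fun x => \sum_(i < 0) c i * v i x) = (fun=> 0 : R).
    by apply/funext => x; rewrite big_ord0.
  rewrite !E; split => // x _.
    by rewrite mul0r; exact: is_derive_cst.
  by rewrite mulr0; exact: is_derive_cst.
have := flux_lin (c n) IH (fl n).
have E (v : nat -> R -> R) : (fun x => \sum_(i < n.+1) c i * v i x) =
    (fun x => \sum_(i < n) c i * v i x + c n * v n x).
  by apply/funext => x; rewrite big_ord_recr.
by rewrite !E.
Qed.

End flux.

(** * Regularity of the eigenfunctions *)

Section regularity.
Context {R : realType} (a b : R) (mu : probability (measurableTypeR R) R).
Context (rho : R -> R) (lambda : nat -> R) (phi : nat -> R -> R).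
Hypothesis ab : a < b.
Hypothesis rho_gt0 : forall x, x \in `[a, b] -> 0 < rho x.
Hypothesis rho_cont : {within `[a, b], continuous rho}.
Hypothesis rho_density : forall A : set (measurableTypeR R), measurable A ->
  mu A = (\int[lebesgue_measure]_(x in A `&` `[a, b]) (rho x)%:E)%E.
Hypothesis PB : poincare_basis a b mu lambda phi.

Local Notation lam := (@lebesgue_measure R).
Local Notation L2ip := (L2ip a b mu).
Local Notation D := (weak_derivative a b).
Local Notation r := (rho \o clamp a b).

Lemma density_clamp_gt0 x : 0 < r x.
Proof. by apply: rho_gt0; exact: clamp_itv (ltW ab). Qed.

Lemma density_clamp_continuous : continuous r.
Proof. exact: continuous_clamp (ltW ab) rho_cont. Qed.

(* With P' = rho phi and Q' = P / rho, testing the eigenvalue equation against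
   g = phi + lambda Q gives |g'| = 0, so that g is constant. *)
Lemma eigenfunction_flux m : exists f F : R -> R,
  {in `[a, b], phi m =1 f} /\ flux a b r f F (fun x => - lambda m * f x).
Proof.
pose p := phi m \o clamp a b; pose l := lambda m.
have Hphi := phi_H1 PB m; have [cphi _ _] := Hphi.
have cp : continuous p by exact: continuous_clamp (ltW ab) cphi.
have pE x : x \in `[a, b] -> p x = phi m x by move=> xab; rewrite /p/= clamp_id.
have rE x : x \in `[a, b] -> r x = rho x by move=> xab; rewrite /= clamp_id.
have cr := density_clamp_continuous.
have crp : continuous (fun x => r x * p x) by move=> x; apply: cvgM; [exact: cr|exact: cp].
have [P0 dP0] := continuous_antiderivative crp.
pose P x := P0 x - P0 a.
have dP (x : R) : is_derive x 1 P (r x * p x).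
  by have h := dP0 x; apply: is_derive_eq; rewrite subr0.
have cP : continuous P by move=> x; exact: is_derive_continuous (dP x).
have cPr : continuous (fun x => P x / r x).
  move=> x; apply: cvgM; first exact: cP.
  by apply: cvgV; [rewrite gt_eqF// density_clamp_gt0|exact: cr].
have [Q dQ] := continuous_antiderivative cPr.
have Pa : P a = 0 by rewrite /P subrr.
(* The flux condition at [b]: for [m > 0] the integral [P b] is the inner product of [phi m] with
   the constant [phi 0], and for [m = 0] the eigenvalue is 0. *)
have lPb : l * P b = 0.
  have [m0|m0] := posnP m; first by rewrite /l m0 (poincare_lambda0 PB) mul0r.
  have h := Rintegral_FTC2 ab dP crp; rewrite Pa subr0 in h; rewrite -h.
  have -> : \int[lam]_(x in `[a, b]) (r x * p x) = L2ip (phi m) (phi 0%N).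
    rewrite (L2ipE rho_gt0 rho_cont rho_density (phi_sqint PB _) (phi_sqint PB _)).
    apply: eq_Rintegral => x; rewrite inE/= => xab.
    have h0 := poincare_phi0 PB xab; have h1 := rE x xab; have h2 := pE x xab.
    by rewrite h2 [phi 0%N x]h0 mulr1 mulrC; congr (_ * _).
  by rewrite (poincare_orthonormal PB) gtn_eqF// mulr0.
have wphi := H1_wdiff ab rho_gt0 rho_cont rho_density Hphi.
have wQ := wdiff_C1 ab dQ cPr.
pose g x := phi m x + l * Q x; pose g' x := D (phi m) x + l * (P x / r x).
have wg : wdiff a b g g' by exact: (wdiff_lin ab l wphi wQ).
have [cg _ sg'] := wg; have sg := sqint_continuous cg.
have [_ _ sD] := wphi; have [_ _ sPr] := wQ.
(* [e1] is the eigenvalue equation tested with [g]; [e2] is integration by parts of [g] against [P],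
   without boundary terms because [P a = 0] and [l * P b = 0]. The two add up to
   [L2ip g' g' = 0]. *)
have e1 : L2ip (D (phi m)) g' = l * L2ip (phi m) g.
  rewrite -(L2ip_weak_derivative ab rho_gt0 rho_cont rho_density wphi wg).
  by have [_] := poincare_eigen PB m; apply; exact: (wdiff_H1 rho_gt0 rho_cont rho_density wg).
have e2 : l * L2ip (fun x => P x / r x) g' = - (l * L2ip (phi m) g).
  have := wdiff_by_parts ab wg dP crp (lexx a) (ltW ab) (lexx b).
  rewrite Pa mulr0 subr0.
  have sP : sqint a b P by apply: sqint_continuous; exact: continuous_subspaceT.
  have srp : sqint a b (fun x => r x * p x).
    by apply: sqint_continuous; exact: continuous_subspaceT.
  rewrite RintegralD//; [|exact: sqint_mul|exact: sqint_mul].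
  rewrite (L2ipE rho_gt0 rho_cont rho_density sPr sg').
  rewrite (L2ipE rho_gt0 rho_cont rho_density (phi_sqint PB _) sg).
  have -> : \int[lam]_(x in `[a, b]) (P x / r x * g' x * rho x) =
      \int[lam]_(x in `[a, b]) (g' x * P x).
    have aux (p0 q0 k0 : R) : k0 != 0 -> p0 / k0 * q0 * k0 = q0 * p0.
      by move=> k00; field.
    apply: eq_Rintegral => x; rewrite inE/= => xab; rewrite -(rE _ xab).
    by apply: aux; rewrite (gt_eqF (density_clamp_gt0 x)).
  have -> : \int[lam]_(x in `[a, b]) (phi m x * g x * rho x) =
      \int[lam]_(x in `[a, b]) (g x * (r x * p x)).
    apply: eq_Rintegral => x; rewrite inE/= => xab.
    by rewrite -(rE _ xab) (pE _ xab) mulrAC mulrC [phi m x * _]mulrC.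
  move=> E; apply/eqP; rewrite -addr_eq0 -mulrDr addrC E mulrCA lPb mulr0//.
have e3 : L2ip g' g' = 0.
  rewrite {1}(L2ip_lin rho_gt0 rho_cont rho_density l sD sPr sg') e1 e2 subrr//.
have [c0 c00 rho_ge] := density_ge rho_gt0 rho_cont.
have gc x : x \in `[a, b] -> g x = g a.
  rewrite in_itv/= => /andP[ax xb].
  have := wdiff_holder ab rho_gt0 rho_cont rho_density c00 rho_ge wg (lexx a) ax xb.
  rewrite e3 mulr0 => h; apply/eqP; rewrite -subr_eq0 -sqrf_eq0 eq_le h sqr_ge0//.
have [ga gaE] : exists ga, g a = ga by exists (g a).
rewrite gaE in gc.
(* [phi m] is arbitrary outside [a, b]; the formula [ga - l * Q x] agrees with it on [a, b] and is
   differentiable on the whole line. *)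
exists (fun x => ga - l * Q x), (fun x => - l * P x).
have fE : {in `[a, b], phi m =1 (fun x => ga - l * Q x)}.
  by move=> x xab; rewrite -(gc x xab) /g addrK.
split => //; split.
- move=> x _; have h := dQ x; apply: is_derive_eq.
  by rewrite /GRing.scale/= add0r mul1r mulrA !mulNr.
- move=> x xab; have h := dP x; apply: is_derive_eq.
  rewrite /GRing.scale/= -(fE x xab) -(pE x xab). by rewrite mulrCA.
- by rewrite Pa mulr0.
- by rewrite mulNr lPb oppr0.
Qed.

End regularity.

(** * Local signs and nodal intervals *)

Section sign_lemmas.
Context {R : realType}.

Lemma is_derive_gt0_sign (F : R -> R) (s k : R) : is_derive s 1 F k -> 0 < k -> F s = 0 ->
  exists2 e : R, 0 < e & forall x, `|x - s| < e ->
    (s < x -> 0 < F x) /\ (x < s -> F x < 0).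
Proof.
move=> /is_derive1_caratheodory[g [Fg cg gs]] k0 Fs.
have : \forall x \near s, 0 < g x.
  by apply: (cvgr_gt (g s) cg); rewrite gs.
move=> [e/= e0 he]; exists e => // x xs.
have gx : 0 < g x by apply: he; rewrite /ball_/= distrC.
have := Fg x; rewrite Fs subr0 => ->; split => h.
  by rewrite mulr_gt0// subr_gt0.
by rewrite pmulr_rlt0// subr_lt0.
Qed.

Lemma continuous_near_gt0 (u : R -> R) (c : R) : {for c, continuous u} -> 0 < u c ->
  exists2 e : R, 0 < e & forall x, `|x - c| < e -> 0 < u x.
Proof.
move=> cu uc; have : \forall x \near c, 0 < u x by exact: (cvgr_gt (u c) cu).
by move=> [e/= e0 he]; exists e => // x xs; apply: he; rewrite /ball_/= distrC.
Qed.

(** The left end of the nodal interval of [t]: the supremum of the points of [a, t] where [u <= 0],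
    or [a] if there is none. *)
Lemma positivity_left (u : R -> R) (a t : R) : a <= t ->
  (forall x, a <= x -> x <= t -> {for x, continuous u}) -> 0 < u t ->
  exists c, [/\ a <= c, c <= t, (c = a \/ (u c = 0 /\ c < t)) &
    forall x, c < x -> x <= t -> 0 < u x].
Proof.
move=> at_ cu ut.
pose S := [set x | [/\ a <= x, x <= t & u x <= 0]].
have [S0|/set0P[s0 Ss0]] := eqVneq S set0.
  exists a; split => //; first by left.
  move=> x ax xt; rewrite ltNge; apply/negP => ux.
  have : S x by split => //; exact: ltW.
  by rewrite S0.
have hsup : has_sup S by split; [exists s0|exists t => x []].
pose c := sup S.
have cub x : S x -> x <= c by move=> Sx; exact: sup_upper_bound.
have ac : a <= c by apply: (le_trans _ (cub _ Ss0)); case: Ss0.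
have ct : c <= t by apply: ge_sup; [exists s0|move=> x []].
have pos x : c < x -> x <= t -> 0 < u x.
  move=> cx xt; rewrite ltNge; apply/negP => ux.
  have : S x by split => //; rewrite (le_trans ac)// ltW.
  by move=> /cub; rewrite leNgt cx.
have uc_le : u c <= 0.
  rewrite leNgt; apply/negP => uc0.
  have [e e0 he] := continuous_near_gt0 (cu _ ac ct) uc0.
  have [x Sx xe] := sup_adherent e0 hsup.
  have [_ _] := Sx; rewrite leNgt he// ler0_norm ?subr_le0 ?cub//.
  by rewrite opprB ltrBlDr addrC -ltrBlDr.
have ct' : c < t.
  rewrite lt_neqAle ct andbT; apply/eqP => ct'.
  by move: uc_le; rewrite ct' leNgt ut.
exists c; split => //; right; split => //.
apply/eqP; rewrite eq_le uc_le leNgt; apply/negP => uc0.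
have cnu : {for c, continuous (fun x => - u x)} by apply: cvgN; exact: cu.
have [e e0 he] := continuous_near_gt0 cnu (ltac:(by rewrite oppr_gt0) : 0 < - u c).
pose x := Num.min t (c + e / 2).
have cx : c < x by rewrite lt_min ct'/= ltrDl divr_gt0.
have := pos x cx; rewrite ge_min lexx => /(_ isT) ux.
have : 0 < - u x.
  apply: he; rewrite gtr0_norm ?subr_gt0// ltrBlDl.
  by rewrite (@le_lt_trans _ _ (c + e / 2))// ?ge_min ?lexx ?orbT// ltrD2l; lra.
by rewrite oppr_gt0 ltNge ltW.
Qed.

Lemma positivity_right (u : R -> R) (b t : R) : t <= b ->
  (forall x, t <= x -> x <= b -> {for x, continuous u}) -> 0 < u t ->
  exists d, [/\ t <= d, d <= b, (d = b \/ (u d = 0 /\ t < d)) &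
    forall x, t <= x -> x < d -> 0 < u x].
Proof.
move=> tb cu ut.
have [|||c [h1 h2 h3 h4]] := @positivity_left (fun x => u (- x)) (- b) (- t).
- by rewrite lerN2.
- move=> x bx xt; apply: (@continuous_comp _ _ _ -%R u); first exact: opp_continuous.
  by apply: cu; [rewrite lerNr|rewrite lerNl].
- by rewrite opprK.
exists (- c); split.
- by rewrite lerNr.
- by rewrite lerNl.
- by case: h3 => [->|[h3 h3']]; [left; rewrite opprK|right; rewrite h3 ltrNr].
- by move=> x tx xc; rewrite -[x]opprK; apply: h4; [rewrite ltrNr|rewrite lerN2].
Qed.

End sign_lemmas.

(** * Uniqueness, maximum principle and Sturm comparison *)

Section flux_theory.
Context {R : realType} (a b : R) (r : R -> R).
Hypothesis ab : a < b.
Hypothesis r_gt0 : forall x, 0 < r x.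
Hypothesis r_cont : continuous r.
Local Notation flux := (flux a b r).

Lemma flux_scale u F h (c : R) : flux u F h ->
  flux (fun x => c * u x) (fun x => c * F x) (fun x => c * h x).
Proof.
move=> [du dF Fa Fb]; split.
- move=> x xab; have h1 := du x xab.
  by apply: is_derive_eq; rewrite /GRing.scale/=; ring.
- move=> x xab; have h1 := dF x xab.
  by apply: is_derive_eq; rewrite /GRing.scale/=; ring.
- by rewrite Fa mulr0.
- by rewrite Fb mulr0.
Qed.

Lemma flux_continuous u F h x : flux u F h -> x \in `[a, b] ->
  {for x, continuous u} /\ {for x, continuous F}.
Proof.
by move=> [du dF _ _] xab; split; [exact: is_derive_continuous (du _ xab)|
  exact: is_derive_continuous (dF _ xab)].
Qed.

Lemma flux_within u F h c d : flux u F h -> a <= c -> d <= b ->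
  {within `[c, d], continuous u}.
Proof.
move=> fl ac db; apply/subspace_continuousP => x; rewrite /= in_itv/= => /andP[cx xd].
have xab : x \in `[a, b] by rewrite in_itv/= (le_trans ac cx) (le_trans xd db).
by apply: cvg_within_filter; case: (flux_continuous fl xab).
Qed.

(* Gronwall's argument for u^2 + F^2. *)
Lemma flux_unique u F l c : flux u F (fun x => - l * u x) -> c \in `[a, b] ->
  u c = 0 -> F c = 0 -> forall x, x \in `[a, b] -> u x = 0.
Proof.
move=> fl cab uc Fc; have [du dF _ _] := fl.
pose B x := (r x)^-1 - l * r x.
have cB : {within `[a, b], continuous B}.
  apply: continuous_subspaceT => x; apply: cvgB.
    by apply: cvgV; [rewrite gt_eqF|exact: r_cont].
  by apply: cvgM; [exact: cvg_cst|exact: r_cont].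
have [C C0 hC] := within_continuous_bounded cB.
pose N x := u x ^+ 2 + F x ^+ 2.
have N0 x : 0 <= N x by rewrite addr_ge0 ?sqr_ge0.
have dN (x : R) : x \in `[a, b] -> is_derive x 1 N (2 * u x * F x * B x).
  move=> xab; have h1 := du x xab; have h2 := dF x xab.
  apply: is_derive_eq; rewrite /GRing.scale/= /B.
  by have := r_gt0 x => rx; field; rewrite gt_eqF.
have bnd x : x \in `[a, b] -> `|2 * u x * F x * B x| <= C * N x.
  move=> xab; rewrite normrM mulrC; apply: ler_pM => //; first exact: hC.
  rewrite /N -(real_normK (num_real (u x))) -(real_normK (num_real (F x))).
  rewrite !normrM ger0_norm//.
  have := sqr_ge0 (`|u x| - `|F x|); rewrite sqrrB -mulrA -[_ *+ 2]mulr_natl; lra.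
have Nc : N c = 0 by rewrite /N uc Fc expr0n addr0.
have dE (k x : R) : x \in `[a, b] -> is_derive x 1 (fun x => N x * expR (k * x))
    ((2 * u x * F x * B x + k * N x) * expR (k * x)).
  move=> xab; have h1 := dN x xab.
  have h2 : is_derive x 1 (fun x : R => expR (k * x)) (expR (k * x) * k).
    have h3 : is_derive x 1 (fun x : R => k * x) k.
      by apply: is_derive_eq; rewrite /GRing.scale/= mulr1.
    exact: (@is_derive1_comp _ expR (fun x : R => k * x) x _ _ (is_derive_expR (k * x)) h3).
  by apply: is_derive_eq; rewrite /GRing.scale/=; ring.
have cN k p q : a <= p -> q <= b -> {within `[p, q], continuous (fun x => N x * expR (k * x))}.
  move=> ap qb; apply/subspace_continuousP => x; rewrite /= in_itv/= => /andP[px xq].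
  apply: cvg_within_filter; apply: is_derive_continuous (dE k x _).
  by rewrite in_itv/= (le_trans ap px) (le_trans xq qb).
have [ac cb] : a <= c /\ c <= b by move: cab; rewrite in_itv => /andP.
have Nz x : x \in `[a, b] -> N x = 0.
  move=> xab; have [ax xb] : a <= x /\ x <= b by move: xab; rewrite in_itv => /andP.
  have inab p q y : a <= p -> q <= b -> y \in `]p, q[ -> y \in `[a, b].
    move=> ap qb; rewrite !in_itv/= => /andP[/ltW py /ltW yq].
    by rewrite (le_trans ap) ?(le_trans yq).
  apply/eqP; rewrite eq_le N0 andbT.
  (* To the right of [c], [N] times [expR (- C * x)] is nonincreasing and starts from 0; to the
     left, [N] times [expR (C * x)] is nondecreasing and ends at 0. *)
  have [cx|xc] := leP c x.
    have := @ler0_derive1_nincr _ (fun x => N x * expR (- C * x)) c x.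
    move=> /(_ _ _ (cN _ _ _ ac xb) c x (lexx _) cx (lexx _)).
    rewrite Nc mul0r pmulr_lle0 ?expR_gt0//; apply.
    - by move=> y /(inab _ _ _ ac xb) yab; case: (dE (- C) y yab).
    - move=> y /(inab _ _ _ ac xb) yab; rewrite derive1E.
      have h := dE (- C) y yab; rewrite derive_val pmulr_lle0 ?expR_gt0//.
      have := ler_norm (2 * u y * F y * B y); have := bnd y yab; lra.
  have := @ger0_derive1_ndecr _ (fun x => N x * expR (C * x)) x c.
  move=> /(_ _ _ (cN _ _ _ ax cb) x c (lexx _) (ltW xc) (lexx _)).
  rewrite Nc mul0r pmulr_lle0 ?expR_gt0//; apply.
  - by move=> y /(inab _ _ _ ax cb) yab; case: (dE C y yab).
  - move=> y /(inab _ _ _ ax cb) yab; rewrite derive1E.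
    have h := dE C y yab; rewrite derive_val mulr_ge0 ?expR_ge0//.
    have := ler_norm (- (2 * u y * F y * B y)); rewrite normrN; have := bnd y yab; lra.
move=> x xab; have := Nz x xab; rewrite /N => /eqP.
by rewrite paddr_eq0 ?sqr_ge0// => /andP[/eqP/eqP]; rewrite sqrf_eq0 => /eqP.
Qed.

(* At a maximum of u the flux F vanishes and F' = r h cannot be positive. *)
Lemma flux_argmax u F h p q t : flux u F h -> a <= p -> q <= b -> p < q ->
  p <= t -> t <= q -> p = a \/ u p < u t -> q = b \/ u q < u t ->
  exists s, [/\ p <= s, s <= q, p = a \/ p < s, q = b \/ s < q & u t <= u s /\ h s <= 0].
Proof.
move=> fl ap qb pq pt tq pa qb'; have [du dF Fa Fb] := fl.
have [s + smax] := EVT_max (ltW pq) (flux_within fl ap qb).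
rewrite in_itv/= => /andP[ps sq].
have uts : u t <= u s by apply: smax; rewrite in_itv/= pt.
have p' : p = a \/ p < s.
  case: pa => pa; [by left|right]; rewrite lt_neqAle ps andbT; apply/eqP => E.
  by move: uts; rewrite -E leNgt pa.
have q' : q = b \/ s < q.
  case: qb' => qb'; [by left|right]; rewrite lt_neqAle sq andbT; apply/eqP => E.
  by move: uts; rewrite E leNgt qb'.
have sab : s \in `[a, b] by rewrite in_itv/= (le_trans ap ps) (le_trans sq qb).
have inab x : p <= x -> x <= q -> x \in `[a, b].
  by move=> px xq; rewrite in_itv/= (le_trans ap px) (le_trans xq qb).
exists s; split => //; split => //.
have Fs : F s = 0.
  have [->//|sa] := eqVneq s a; have [->//|sb] := eqVneq s b.
  have ps' : p < s by case: p' => // pa'; rewrite lt_neqAle ps pa' eq_sym sa.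
  have sq' : s < q by case: q' => // qa'; rewrite lt_neqAle sq qa' sb.
  have d0 : is_derive s 1 u 0.
    apply: (@derive1_at_max _ u p q s (ltW pq)).
    - move=> x; rewrite in_itv/= => /andP[/ltW px /ltW xq].
      by case: (du x (inab x px xq)).
    - by rewrite in_itv/= ps'.
    - move=> x; rewrite in_itv/= => /andP[/ltW px /ltW xq].
      by apply: smax; rewrite in_itv/= px.
  have := du s sab; move=> [_]; case: d0 => _ -> /esym/eqP.
  by rewrite mulf_eq0 invr_eq0 (gt_eqF (r_gt0 s)) orbF => /eqP.
(* [F] would increase through 0 at [s], so [u] would take larger values on both sides of [s]; at
   least one side lies in [p, q] and contradicts maximality. *)
rewrite leNgt; apply/negP => hs.
have rh : 0 < r s * h s by rewrite mulr_gt0.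
have [e e0 he] := is_derive_gt0_sign (dF s sab) rh Fs.
have mvt x y : p <= x -> x < y -> y <= q -> exists2 z, x < z < y & u y - u x = F z / r z * (y - x).
  move=> px xy yq.
  have h1 z : z \in `]x, y[ -> is_derive z 1 u (F z / r z : R).
    rewrite in_itv/= => /andP[/ltW xz /ltW zy].
    by apply: du; apply: inab; [exact: le_trans xz|exact: le_trans yq].
  have h2 : {within `[x, y], continuous u}.
    by apply: (flux_within fl); [exact: le_trans px|exact: le_trans qb].
  have [z zxy E] := MVT xy h1 h2.
  by exists z => //; move: zxy; rewrite in_itv.
have [sq'|qs] := ltP s q.
  pose y := Num.min q (s + e / 2).
  have sy : s < y by rewrite lt_min sq'/= ltrDl divr_gt0.
  have yq : y <= q by rewrite ge_min lexx.
  have [z /andP[sz zy] E] := mvt s y ps sy yq.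
  have Fz : 0 < F z.
    apply: (he z _).1 => //; rewrite gtr0_norm ?subr_gt0// ltrBlDl (lt_trans zy)//.
    by rewrite (@le_lt_trans _ _ (s + e / 2))// ?ge_min ?lexx ?orbT// ltrD2l; lra.
  have : 0 < u y - u s by rewrite E mulr_gt0 ?divr_gt0// subr_gt0.
  by rewrite subr_gt0 ltNge smax// in_itv/= (le_trans ps (ltW sy)).
have ps' : p < s by rewrite (lt_le_trans pq).
pose y := Num.max p (s - e / 2).
have ys : y < s by rewrite gt_max ps'/= ltrBlDr ltrDl divr_gt0.
have py : p <= y by rewrite le_max lexx.
have [z /andP[yz zs] E] := mvt y s py ys sq.
have Fz : F z < 0.
  apply: (he z _).2 => //; rewrite ltr0_norm ?subr_lt0// opprB ltrBlDr -ltrBlDl.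
  rewrite (@lt_le_trans _ _ (s - e / 2))//; first by rewrite ltrD2l; lra.
  by rewrite (le_trans _ (ltW yz))// le_max lexx orbT.
have : u s - u y < 0 by rewrite E !pmulr_llt0 ?subr_gt0 ?invr_gt0.
by rewrite subr_lt0 ltNge smax// in_itv/= py (le_trans (ltW ys)).
Qed.

(* Sturm comparison: the Wronskian F w - f W is monotone on a nodal interval of f. *)
Lemma flux_sturm f F w W l m c d : flux f F (fun x => - l * f x) ->
  flux w W (fun x => - m * w x) -> l < m -> a <= c -> c < d -> d <= b ->
  (forall x, c < x -> x < d -> 0 < f x) -> c = a \/ f c = 0 -> d = b \/ f d = 0 ->
  (exists2 x, x \in `[a, b] & w x != 0) ->
  exists s, [/\ c < s, s < d & w s < 0].
Proof.
move=> flf flw lm ac cd db fpos fc fd wn0; apply: contrapT => nex.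
have wpos x : c < x -> x < d -> 0 <= w x.
  by move=> cx xd; rewrite leNgt; apply/negP => wx; apply: nex; exists x.
have [df dF Fa Fb] := flf; have [dw dW Wa Wb] := flw.
have inab x : c <= x -> x <= d -> x \in `[a, b].
  by move=> cx xd; rewrite in_itv/= (le_trans ac cx) (le_trans xd db).
have wc0 x : c <= x -> x <= d -> 0 <= w x.
  move=> cx xd; rewrite leNgt; apply/negP => wx.
  have [cw _] := flux_continuous flw (inab x cx xd).
  have cnw : {for x, continuous (fun x => - w x)} by exact: cvgN.
  have [e e0 he] := continuous_near_gt0 cnw (ltac:(by rewrite oppr_gt0) : 0 < - w x).
  have [y [cy yd xy]] : exists y, [/\ c < y, y < d & `|y - x| < e].
    have [xm|mx] := leP x ((c + d) / 2).
      exists (Num.min ((c + d) / 2 + (d - c) / 4) (x + e / 2)); split.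
      - by rewrite lt_min; apply/andP; split; lra.
      - by rewrite gt_min; apply/orP; left; lra.
      - rewrite ger0_norm ?subr_ge0 ?le_min; last by apply/andP; split; lra.
        by rewrite ltrBlDl gt_min; apply/orP; right; lra.
    exists (Num.max ((c + d) / 2 - (d - c) / 4) (x - e / 2)); split.
    - by rewrite lt_max; apply/orP; left; lra.
    - by rewrite gt_max; apply/andP; split; lra.
    - rewrite ler0_norm ?subr_le0 ?ge_max; last by apply/andP; split; lra.
      by rewrite opprB ltrBlDr -ltrBlDl lt_max; apply/orP; right; lra.
  by have := he y xy; rewrite oppr_gt0 ltNge wpos.
pose V x := F x * w x - f x * W x.
have dV (x : R) : c <= x -> x <= d -> is_derive x 1 V ((m - l) * r x * (f x * w x)).
  move=> cx xd; have xab := inab x cx xd.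
  have h1 := df x xab; have h2 := dF x xab; have h3 := dw x xab; have h4 := dW x xab.
  apply: is_derive_eq; rewrite /GRing.scale/=.
  by have := r_gt0 x => rx; field; rewrite gt_eqF.
(* At an end of [a, b] both fluxes vanish. Otherwise [f c = 0], and [F c >= 0] because [f] is
   positive just to the right of [c]. The other end [d] is symmetric. *)
have Vc : 0 <= V c.
  rewrite /V; case: fc => [->|fc]; first by rewrite Fa Wa mul0r mulr0 subrr.
  rewrite fc mul0r subr0 mulr_ge0// ?wc0 ?(ltW cd)//.
  rewrite leNgt; apply/negP => Fc.
  have dnf : is_derive c 1 (fun x => - f x) (- (F c / r c)).
    by have h := df c (inab c (lexx _) (ltW cd)); exact: is_deriveN.
  have [||e e0 he] := is_derive_gt0_sign dnf.
  - by rewrite oppr_gt0 pmulr_llt0// invr_gt0.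
  - by rewrite fc oppr0.
  pose y := Num.min ((c + d) / 2) (c + e / 2).
  have cy : c < y by rewrite lt_min; apply/andP; split; lra.
  have yd : y < d by rewrite gt_min; apply/orP; left; lra.
  have [] := he y _; last by move=> /(_ cy) + _; rewrite oppr_gt0 ltNge ltW// fpos.
  by rewrite gtr0_norm ?subr_gt0// ltrBlDl gt_min; apply/orP; right; lra.
have Vd : V d <= 0.
  rewrite /V; case: fd => [->|fd]; first by rewrite Fb Wb mul0r mulr0 subrr.
  rewrite fd mul0r subr0 mulr_le0_ge0// ?wc0 ?(ltW cd)//.
  rewrite leNgt; apply/negP => Fd.
  have [||e e0 he] := is_derive_gt0_sign (df d (inab d (ltW cd) (lexx _))).
  - by rewrite divr_gt0.
  - by [].
  pose y := Num.max ((c + d) / 2) (d - e / 2).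
  have yd : y < d by rewrite gt_max; apply/andP; split; lra.
  have cy : c < y by rewrite lt_max; apply/orP; left; lra.
  have [] := he y _; last by move=> _ /(_ yd); rewrite ltNge ltW// fpos.
  by rewrite ltr0_norm ?subr_lt0// opprB ltrBlDr -ltrBlDl lt_max; apply/orP; right; lra.
have cV p q : c <= p -> q <= d -> {within `[p, q], continuous V}.
  move=> cp qd; apply/subspace_continuousP => x; rewrite /= in_itv/= => /andP[px xq].
  apply: cvg_within_filter; apply: is_derive_continuous (dV x _ _).
    exact: le_trans cp px.
  exact: le_trans xq qd.
have Vmono x y : c <= x -> x <= y -> y <= d -> V x <= V y.
  move=> cx xy yd; apply: (@ger0_derive1_ndecr _ V c d) => //; last exact: cV.
  - by move=> z; rewrite in_itv/= => /andP[/ltW cz /ltW zd]; case: (dV z cz zd).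
  - move=> z; rewrite in_itv/= => /andP[cz zd]; rewrite derive1E.
    have h := dV z (ltW cz) (ltW zd); rewrite derive_val.
    by rewrite !mulr_ge0 ?subr_ge0 ?(ltW lm)// ?(ltW (r_gt0 _))// ?wpos// ltW// fpos.
(* [V] is nondecreasing from a nonnegative to a nonpositive value. Its derivative therefore
   vanishes, which forces [w = 0] on ]c, d[ and then, by uniqueness, on [a, b]. *)
have V0 x : c <= x -> x <= d -> V x = 0.
  move=> cx xd; apply/eqP; rewrite eq_le.
  by rewrite (le_trans (Vmono x d cx xd (lexx _)))// (le_trans Vc)// Vmono.
have near_oo x : c < x -> x < d -> \forall y \near x, c < y /\ y < d.
  by move=> cx xd; near=> y; split; near: y; [exact: lt_nbhsr|exact: lt_nbhsl].
have wz x : c < x -> x < d -> w x = 0.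
  move=> cx xd.
  have h0 : is_derive x 1 V 0.
    apply: near_eq_is_derive (is_derive_cst (0 : R) x 1).
    by apply: filterS (near_oo x cx xd) => y [cy yd]; rewrite V0// ltW.
  have [_ E] := dV x (ltW cx) (ltW xd); case: h0 => _; rewrite E => /eqP.
  rewrite !mulf_eq0 subr_eq0 (gt_eqF lm) (gt_eqF (r_gt0 x)) (gt_eqF (fpos x cx xd)) /=.
  by move/eqP.
pose mid := (c + d) / 2.
have [cm md] : c < mid /\ mid < d by have := midf_lt cd; rewrite /mid => -[].
have Wm : W mid = 0.
  have h0 : is_derive mid 1 w 0.
    apply: near_eq_is_derive (is_derive_cst (0 : R) mid 1).
    by apply: filterS (near_oo mid cm md) => y [cy yd]; rewrite wz.
  have [_ E] := dw mid (inab _ (ltW cm) (ltW md)); case: h0 => _; rewrite E => /eqP.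
  by rewrite mulf_eq0 invr_eq0 (gt_eqF (r_gt0 mid)) orbF => /eqP.
have [x xab] := wn0.
by rewrite (flux_unique flw (inab _ (ltW cm) (ltW md)) (wz _ cm md) Wm xab) eqxx.
Unshelve. all: by end_near. Qed.

End flux_theory.

(** * Alternation under the resolvent and from one eigenfunction to the next *)

Section alternation.
Context {R : realType} (a b : R) (r : R -> R).
Hypothesis ab : a < b.
Hypothesis r_gt0 : forall x, 0 < r x.
Hypothesis r_cont : continuous r.
Local Notation flux := (flux a b r).

(** There are [n] sign changes, hence [n + 1] points; the parity of [k] is the sign at the first
    one. The margin [e] makes the notion stable under uniform perturbation. *)
Definition alternates (u : R -> R) n (e : R) : Prop := exists k (t : nat -> R),
  [/\ forall i, (i <= n)%N -> t i \in `[a, b],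
      forall i, (i < n)%N -> t i < t i.+1 &
      forall i, (i <= n)%N -> e <= (-1) ^+ (i + k) * u (t i)].

(** Here [u] is the resolvent of [u - h]. Each alternation point is moved to a maximum of the signed
    [u] between its neighbours; there the signed [h] is nonpositive, so subtracting [h] only
    enlarges the value and the margin survives unchanged. *)
Lemma flux_alternates u F h n e : 0 < e -> flux u F h -> alternates u n e ->
  alternates (fun x => u x - h x) n e.
Proof.
move=> e0 fl [k [t [tab tt te]]].
(* Points are moved from left to right; the last clause keeps [s j] to the left of the next unmoved
   point, which leaves room for the next move. *)
suff H j : (j <= n)%N -> exists s : nat -> R,
    [/\ forall i, (i <= j)%N -> s i \in `[a, b],
        forall i, (i < j)%N -> s i < s i.+1,
        forall i, (i <= j)%N -> e <= (-1) ^+ (i + k) * u (s i),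
        forall i, (i <= j)%N -> (-1) ^+ (i + k) * h (s i) <= 0 &
        (j < n)%N -> s j < t j.+1].
  have [s [sab ss se sh _]] := H n (leqnn n); exists k, s; split => // i ijn.
  by rewrite mulrBr (le_trans (se i ijn))// lerDl oppr_ge0 sh.
(* The search interval runs from the previous moved point [p] to the next unmoved one [q]. At each
   of these ends the signed [u] is below its value at [t i], unless the end is [a] or [b], where the
   flux vanishes. *)
have step i p : (i <= n)%N -> a <= p -> p < t i \/ p = a /\ i = 0%N ->
    p = a \/ (-1) ^+ (i + k) * u p < e ->
    exists s, [/\ p <= s, s \in `[a, b], p = a \/ p < s, e <= (-1) ^+ (i + k) * u s &
      (-1) ^+ (i + k) * h s <= 0 /\ ((i < n)%N -> s < t i.+1)].
  move=> ijn ap pt pe.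
  have tia : a <= t i <= b by have := tab i ijn; rewrite in_itv.
  have /andP[ati tib] := tia.
  have pti : p <= t i by case: pt => [/ltW//|[->]].
  pose q := if (i < n)%N then t i.+1 else b.
  have tiq : t i <= q by rewrite /q; case: ifPn => // iltn; rewrite ltW// tt.
  have pq : p < q.
    case: pt => [pt|[-> i0]]; first exact: lt_le_trans tiq.
    rewrite /q; case: ifPn => // iltn; exact: le_lt_trans (tt _ iltn).
  have qb : q <= b.
    by rewrite /q; case: ifPn => // iltn; have := tab _ iltn; rewrite in_itv => /andP[].
  have eqq : (i < n)%N -> (-1) ^+ (i + k) * u q < 0.
    move=> iltn; rewrite /q iltn; have := te _ iltn.
    by rewrite addSn exprS mulN1r mulNr => h1; rewrite -oppr_gt0 (lt_le_trans e0).
  have [||s [ps sq pps qqs [uts hs]]] :=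
    flux_argmax r_gt0 (flux_scale ((-1) ^+ (i + k)) fl) ap qb pq pti tiq.
  - by case: pe => [->|pe]; [left|right; exact: lt_le_trans (te i ijn)].
  - have [iltn|nlti] := ltnP i n; last by left; rewrite /q ltnNge nlti.
    by right; rewrite (lt_le_trans (eqq iltn))// (le_trans (ltW e0))// te.
  have es := le_trans (te i ijn) uts.
  exists s; split => //.
    by rewrite in_itv/= (le_trans ap ps) (le_trans sq qb).
  split => // iltn; have -> : t i.+1 = q by rewrite /q iltn.
  rewrite lt_neqAle sq andbT; apply/eqP => sq'.
  by have := eqq iltn; rewrite -sq' ltNge (le_trans (ltW e0)).
elim: j => [_|j IH jn].
  have [s [ps sab _ es [hs st]]] := 
    step 0%N a (leq0n n) (lexx a) (or_intror (conj erefl erefl)) (or_introl erefl).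
  exists (fun=> s); split => // i; rewrite leqn0 => /eqP -> //.
have [s [sab ss se sh st]] := IH (ltnW jn).
have asj : a <= s j by have := sab j (leqnn j); rewrite in_itv => /andP[].
have [||s' [ps s'ab pps es [hs st']]] := step j.+1 (s j) jn asj.
- by left; exact: st.
- right; rewrite addSn exprS mulN1r mulNr (lt_trans _ e0)// oppr_lt0.
  by rewrite (lt_le_trans e0)// se.
have sjs' : s j < s'.
  have [E|//] := pps; rewrite lt_neqAle ps andbT; apply/eqP => E'.
  have h1 := se j (leqnn j); move: es; rewrite -E' addSn exprS mulN1r mulNr => h2.
  by have := lt_le_trans e0 h1; have := lt_le_trans e0 h2;
    rewrite oppr_gt0 => /ltW; rewrite leNgt => /negbTE ->.
pose s2 i := if (i <= j)%N then s i else s'.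
have s2j : s2 j.+1 = s' by rewrite /s2 ltnn.
have s2le i : (i <= j)%N -> s2 i = s i by rewrite /s2 => ->.
exists s2; split.
- by move=> i; rewrite leq_eqVlt => /predU1P[->|]; rewrite ?s2j// ltnS => ij; rewrite s2le ?sab.
- move=> i; rewrite ltnS leq_eqVlt => /predU1P[->|ij]; first by rewrite s2j s2le.
  by rewrite !s2le ?(ltnW ij)// ss.
- by move=> i; rewrite leq_eqVlt => /predU1P[->|]; rewrite ?s2j// ltnS => ij; rewrite s2le ?se.
- by move=> i; rewrite leq_eqVlt => /predU1P[->|]; rewrite ?s2j// ltnS => ij; rewrite s2le ?sh.
- by rewrite s2j.
Qed.

Lemma positive_min n (v : nat -> R) : (forall i, (i <= n)%N -> 0 < v i) ->
  exists2 e : R, 0 < e & forall i, (i <= n)%N -> e <= v i.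
Proof.
elim: n => [|n IH] h; first by exists (v 0%N); [exact: h|move=> i; rewrite leqn0 => /eqP ->].
have [i /leqW/h//|e e0 he] := IH.
exists (Num.min e (v n.+1)); first by rewrite lt_min e0 h.
by move=> i; rewrite leq_eqVlt ge_min => /predU1P[->|/he ->//]; rewrite lexx orbT.
Qed.

(** By Sturm comparison [w] takes both signs in each of the [n + 1] nodal intervals of [f] around
    the alternation points, and consecutive intervals do not overlap since [f] has opposite signs on
    them. *)
Lemma sturm_step f F w W l m n e : 0 < e -> flux f F (fun x => - l * f x) ->
  flux w W (fun x => - m * w x) -> l < m -> (exists2 x, x \in `[a, b] & w x != 0) ->
  alternates f n e -> exists2 e', 0 < e' & alternates w n.+1 e'.
Proof.
move=> e0 flf flw lm wn0 [k [t [tab tt te]]].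
have tpos i : (i <= n)%N -> 0 < (-1) ^+ (i + k) * f (t i).
  by move=> ijn; rewrite (lt_le_trans e0)// te.
have nodal i : exists cd : R * R, (i <= n)%N -> [/\ a <= cd.1 <= t i, t i <= cd.2 <= b,
    (forall x, cd.1 < x -> x < cd.2 -> 0 < (-1) ^+ (i + k) * f x) &
    forall s : bool, exists x, [/\ cd.1 < x, x < cd.2 & 0 < (-1) ^+ s * w x]].
  have [ijn|] := leqP i n; last by exists (0, 0).
  pose u x := (-1) ^+ (i + k) * f x.
  have flu : flux u (fun x => (-1) ^+ (i + k) * F x) (fun x => - l * u x).
    have := flux_scale ((-1) ^+ (i + k)) flf; congr (flux _ _ _).
    by apply/funext => x; rewrite /u; ring.
  have [ati tib] : a <= t i /\ t i <= b by have := tab i ijn; rewrite in_itv => /andP[].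
  have cu x : a <= x -> x <= b -> {for x, continuous u}.
    move=> ax xb; have xab : x \in `[a, b] by rewrite in_itv/= ax.
    by have [] := flux_continuous flu xab.
  have [c [ac ct c' cpos]] :=
    positivity_left ati (fun x ax xt => cu x ax (le_trans xt tib)) (tpos i ijn).
  have [d [td db d' dpos]] :=
    positivity_right tib (fun x tx xb => cu x (le_trans ati tx) xb) (tpos i ijn).
  have cd : c < d.
    have := le_trans ct td; rewrite le_eqVlt => /predU1P[cd|//].
    have tc : t i = c by apply/eqP; rewrite eq_le ct {1}cd td.
    case: c' => [ca|[_]]; last by rewrite tc ltxx.
    case: d' => [db'|[_]]; last by rewrite tc cd ltxx.
    by have := ab; rewrite -ca -db' cd ltxx.
  have pos x : c < x -> x < d -> 0 < u x.
    by move=> cx xd; have [xt|tx] := leP x (t i); [exact: cpos|apply: dpos => //; exact: ltW].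
  exists (c, d) => _; split => //= [|| s]; [by rewrite ac|by rewrite td|].
  (* The shift of the exponent compensates for [flux_sturm], which produces negative values. *)
  pose sg : R := (-1) ^+ s.+1.
  have fls : flux (fun x => sg * w x) (fun x => sg * W x) (fun x => - m * (sg * w x)).
    have := flux_scale sg flw; congr (flux _ _ _); by apply/funext => x; ring.
  have [|||x [cx xd wx]] := flux_sturm r_gt0 r_cont flu fls lm ac cd db pos.
  - by case: c' => [->|[-> _]]; [left|right].
  - by case: d' => [->|[-> _]]; [left|right].
  - have [x xab wx] := wn0; exists x => //; rewrite mulf_neq0// signr_eq0//.
  by exists x; split => //; move: wx; rewrite /sg exprS mulN1r mulNr oppr_lt0.
have [cd hcd] := choice nodal.
have pts (p : nat * bool) : exists x, (p.1 <= n)%N -> [/\ (cd p.1).1 < x, x < (cd p.1).2 &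
    0 < (-1) ^+ p.2 * w x].
  have [ijn|] := leqP p.1 n; last by exists 0.
  by have [_ _ _ /(_ p.2)[x hx]] := hcd _ ijn; exists x.
have [S hS] := choice pts.
have order i x y : (i < n)%N -> (cd i).1 < x -> x < (cd i).2 ->
    (cd i.+1).1 < y -> y < (cd i.+1).2 -> x < y.
  move=> iltn cx xd cy yd.
  have [/andP[_ ct] /andP[td _] pos _] := hcd i (ltnW iltn).
  have [/andP[_ ct'] /andP[td' _] pos' _] := hcd i.+1 iltn.
  have opp z : 0 < (-1) ^+ (i + k) * f z -> 0 < (-1) ^+ (i.+1 + k) * f z -> False.
    by rewrite addSn exprS mulN1r mulNr oppr_gt0 => /ltW; rewrite leNgt => /negbTE ->.
  rewrite ltNge; apply/negP => yx.
  have xt' : x < t i.+1.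
    rewrite ltNge; apply/negP => tx; apply: (opp (t i.+1)); last exact: tpos.
    by apply: pos; [exact: le_lt_trans (tt _ iltn)|exact: le_lt_trans xd].
  apply: (opp x); first exact: pos.
  by apply: pos'; [exact: lt_le_trans yx|exact: lt_le_trans td'].
(* The first nodal interval supplies two points and each other one a single point, [n + 2] in all.
   The starting sign [k'] is dictated by the order of the two points in the first interval. *)
have key (k' : nat) : S (0%N, odd k') < S (0%N, odd k'.+1) ->
    exists2 e', 0 < e' & alternates w n.+1 e'.
  move=> lt01.
  pose s i := if i is i'.+1 then S (i', odd (i'.+1 + k')) else S (0%N, odd k').
  have sw i : (i <= n.+1)%N -> 0 < (-1) ^+ (i + k') * w (s i).
    case: i => [|i] ijn; rewrite -signr_odd.
      by have [] := hS (0%N, odd k') (leq0n n).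
    by have [] := hS (i, odd (i.+1 + k')) ijn.
  have [e' e'0 he'] := positive_min sw.
  exists e' => //; exists k', s; split => //.
  - have sin p : (p.1 <= n)%N -> S p \in `[a, b].
      move=> ijn; have [/andP[ac _] /andP[_ db] _ _] := hcd _ ijn.
      have [h1 h2 _] := hS p ijn.
      by rewrite in_itv/= (le_trans ac (ltW h1)) (le_trans (ltW h2) db).
    by case=> [|i] ijn; apply: sin.
  - case=> [|i] ijn; first by rewrite /s add1n.
    have [h1 h2 _] := hS (i, odd (i.+1 + k')) (ltnW ijn).
    have [h3 h4 _] := hS (i.+1, odd (i.+2 + k')) ijn.
    exact: (order i).
have [h|h|E] := ltgtP (S (0%N, false)) (S (0%N, true)).
- exact: (key 0%N).
- exact: (key 1%N).
- have [_ _] := hS (0%N, false) (leq0n n); have [_ _] := hS (0%N, true) (leq0n n).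
  rewrite /= -E expr1 expr0 mul1r mulN1r oppr_gt0 => /ltW.
  by rewrite leNgt => /negbTE ->.
Qed.

End alternation.

(** * Unisolvence *)

Section quadrature.
Context {R : realType} (a b : R) (mu : probability (measurableTypeR R) R).
Context (rho : R -> R) (lambda : nat -> R) (phi : nat -> R -> R) (K : R -> R -> R).
Hypothesis ab : a < b.
Hypothesis rho_gt0 : forall x, x \in `[a, b] -> 0 < rho x.
Hypothesis rho_cont : {within `[a, b], continuous rho}.
Hypothesis rho_density : forall A : set (measurableTypeR R), measurable A ->
  mu A = (\int[lebesgue_measure]_(x in A `&` `[a, b]) (rho x)%:E)%E.
Hypothesis PB : poincare_basis a b mu lambda phi.
Hypothesis KR : reproducing_kernel `[a, b] (H1 a b mu) (H1ip a b mu) K.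

Local Notation H1 := (H1 a b mu).
Local Notation L2ip := (L2ip a b mu).
Local Notation H1ip := (H1ip a b mu).
Local Notation H1norm := (H1norm a b mu).
Local Notation al := (alpha lambda).
Let H1l := fun f g c => @H1_lin R a b mu rho ab rho_gt0 rho_cont rho_density f g c.
Let H1il := fun f g h c => @H1ip_lin R a b mu rho ab rho_gt0 rho_cont rho_density f g h c.

Variables (n : nat) (X v : 'cV[R]_n).
Hypothesis Xab : forall i, X i 0 \in `[a, b].
Local Notation Q := (quad X v).

Definition quad_rep (x : R) : R := \sum_(i < n) v i 0 * K x (X i 0).

Lemma quad_rep_H1 : H1 quad_rep.
Proof.
exact: (@H_sum R R H1 H1l 'I_n (index_enum 'I_n) (fun i => K^~ (X i 0)) (fun i => v i 0)
  _ (phi_H1 PB 0%N) (fun i => K_H1 KR (Xab i))).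
Qed.

Lemma quad_repE h : H1 h -> H1ip h quad_rep = Q h.
Proof.
move=> Hh; rewrite H1ipC.
have := @ip_sum R R H1 H1ip H1l H1il 'I_n (index_enum 'I_n) (fun i => K^~ (X i 0))
  (fun i => v i 0) h Hh (fun i => K_H1 KR (Xab i)).
by move=> E; rewrite [LHS]E; apply: eq_bigr => i _; rewrite H1ipC (K_repr KR).
Qed.

Lemma quad_phi_sum N (c : nat -> R) :
  Q (fun x => \sum_(m < N) c m * phi m x) = \sum_(m < N) c m * Q (phi m).
Proof.
rewrite /quad; under eq_bigr do rewrite mulr_sumr.
rewrite exchange_big; apply: eq_bigr => m _; rewrite mulr_sumr.
by apply: eq_bigr => i _; rewrite mulrCA.
Qed.

Lemma quad_le h e : (forall x, x \in `[a, b] -> `|h x| <= e) ->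
  `|Q h| <= (\sum_(i < n) `|v i 0|) * e.
Proof.
move=> he; rewrite (le_trans (ler_norm_sum _ _ _))// mulr_suml; apply: ler_sum => i _.
by rewrite normrM ler_wpM2l// he.
Qed.

Lemma coef_quad_rep m : coef a b mu phi quad_rep m = al m * Q (phi m).
Proof.
have := quad_repE (phi_H1 PB m); rewrite (H1ip_phi PB)//; last exact: quad_rep_H1.
by move=> <-; rewrite mulrA (alphaV PB) mul1r /coef L2ipC.
Qed.

(** The polynomial that vanishes at all nodes except the one of index [i0] is in H^1 and is not
    annihilated by [Q]; its eigenfunction expansion converges uniformly, so [Q] cannot annihilate
    every [phi m]. *)
Lemma quad_phi_neq0 i0 : injective (fun i => X i 0) -> v i0 0 != 0 ->
  exists m, Q (phi m) != 0.
Proof.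
move=> Xinj vi0; apply: contrapT => nex.
have Q0 m : Q (phi m) = 0 by apply/eqP/negP => /negP h; apply: nex; exists m.
pose p : {poly R} := \prod_(j < n | j != i0) ('X - (X j 0)%:P).
have wp : wdiff a b (horner p) (horner p^`()).
  by apply: (wdiff_C1 ab); exact: continuous_horner.
have Hp : H1 (horner p) := wdiff_H1 rho_gt0 rho_cont rho_density wp.
have Qp : Q (horner p) = v i0 0 * p.[X i0 0].
  rewrite /quad (bigD1 i0)//= big1 ?addr0// => j ji0.
  by rewrite /p horner_prod (bigD1 j)//= hornerXsubC subrr mul0r mulr0.
have pn0 : p.[X i0 0] != 0.
  rewrite /p horner_prod; apply/prodf_neq0 => j ji0.
  by rewrite hornerXsubC subr_eq0; apply: contra ji0 => /eqP/Xinj ->.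
have Qp0 : Q (horner p) != 0 by rewrite Qp mulf_neq0.
pose V := \sum_(i < n) `|v i 0|.
have V0 : 0 <= V by apply: sumr_ge0.
pose B := V * H1norm (horner p) + 1.
have B0 : 0 < B by rewrite ltr_wpDl// mulr_ge0// H1norm_ge0.
have [N0 hN0] := residual_uniform ab rho_gt0 rho_cont rho_density PB
  (divr_gt0 (ltac:(by rewrite normr_gt0) : 0 < `|Q (horner p)|) B0).
have E : Q (horner p) = Q (residual a b mu phi (horner p) N0).
  transitivity (Q (residual a b mu phi (horner p) N0) +
    Q (fun x => \sum_(m < N0) coef a b mu phi (horner p) m * phi m x)).
    rewrite /quad -big_split/=; apply: eq_bigr => i _.
    by rewrite -mulrDr /residual subrK.
  by rewrite quad_phi_sum [X in _ + X]big1 ?addr0// => m _; rewrite Q0 mulr0.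
have := quad_le (fun x xab => hN0 N0 _ x (leqnn _) Hp xab).
rewrite -E mulrCA -/V => h.
have := Qp0; rewrite -normr_gt0 => q0.
suff : `|Q (horner p)| < `|Q (horner p)| by rewrite ltxx.
apply: (le_lt_trans h).
by rewrite -mulrA gtr_pMr// mulrC ltr_pdivrMr// mul1r /B ltrDl.
Qed.

(* If k = quad_rep alternates at n + 1 points, cutting k between consecutive
   zeros gives n + 1 functions g in H^1 with disjoint supports and
   Q g = |g|^2 > 0, hence n + 1 distinct nodes. *)
Lemma quad_rep_not_alternates e : (0 < n)%N -> 0 < e -> ~ alternates a b quad_rep n e.
Proof.
move=> n0 e0 [k [t [tab tt te]]].
have wk := H1_wdiff ab rho_gt0 rho_cont rho_density quad_rep_H1.
have [ck _ _] := wk.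
have tpos i : (i <= n)%N -> 0 < (-1) ^+ (i + k) * quad_rep (t i).
  by move=> ijn; rewrite (lt_le_trans e0)// te.
have tn0 i : (i <= n)%N -> quad_rep (t i) != 0.
  by move=> ijn; have := tpos i ijn; apply: contraTneq => ->; rewrite mulr0 ltxx.
have zeros i : exists z, (i < n)%N -> [/\ t i < z, z < t i.+1 & quad_rep z = 0].
  have [iltn|] := ltnP i n; last by exists 0.
  have [||z + kz] := @IVT R (fun x => quad_rep x) (t i) (t i.+1) 0 (ltW (tt i iltn)).
  - apply: continuous_subspaceW ck; apply: subset_itv; rewrite bnd_simp.
      by have := tab i (ltnW iltn); rewrite in_itv => /andP[].
    by have := tab i.+1 iltn; rewrite in_itv => /andP[].
  - have h1 := tpos i (ltnW iltn); have h2 := tpos i.+1 iltn.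
    rewrite ge_min le_max; move: h1 h2; rewrite addSn exprS mulN1r mulNr oppr_gt0.
    rewrite -signr_odd; case: odd; rewrite ?expr1 ?expr0 ?mulN1r ?mul1r ?oppr_gt0 ?oppr_lt0.
      by move=> /ltW -> /ltW ->; rewrite orbT.
    by move=> /ltW -> /ltW ->; rewrite orbT.
  rewrite in_itv/= => /andP[tz zt]; exists z => _; split => //.
  - rewrite lt_neqAle tz andbT; apply: contraTneq isT => E.
    by have := tn0 i (ltnW iltn); rewrite E kz eqxx.
  - rewrite lt_neqAle zt andbT; apply: contraTneq isT => E.
    by have := tn0 i.+1 iltn; rewrite -E kz eqxx.
have [z0 hz0] := choice zeros.
(* Cut points [z 0 = a], [n] zeros of [quad_rep], and [z n.+1 = b], which delimit [n + 1] pieces. *)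
pose z i := if i is i'.+1 then (if (i' < n)%N then z0 i' else b) else a.
have zab i : a <= z i <= b.
  case: i => [|i] /=; first by rewrite lexx ltW.
  case: ifPn => iltn; last by rewrite lexx ltW.
  have [h1 h2 _] := hz0 i iltn.
  have := tab i (ltnW iltn); have := tab i.+1 iltn; rewrite !in_itv/= => /andP[_ h3] /andP[h4 _].
  by rewrite (le_trans h4 (ltW h1)) (le_trans (ltW h2) h3).
have zt i : (i <= n)%N -> z i <= t i /\ t i <= z i.+1.
  move=> ijn; split.
    case: i ijn => [|i] ijn /=; first by have := tab 0%N (leq0n n); rewrite in_itv => /andP[].
    by rewrite ijn ltW//; have [] := hz0 i ijn.
  rewrite /=; case: ifPn => iltn; first by rewrite ltW//; have [] := hz0 i iltn.
  by have := tab i ijn; rewrite in_itv => /andP[].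
have zlt i : (i <= n)%N -> z i < z i.+1.
  move=> ijn; have [h1 h2] := zt i ijn.
  case: i ijn h1 h2 => [|i] ijn h1 h2.
    by apply: (le_lt_trans h1); rewrite /= n0; have [] := hz0 0%N n0.
  by apply: lt_le_trans h2; rewrite /= ijn; have [] := hz0 i ijn.
have zk i : (i < n)%N -> quad_rep (z i.+1) = 0.
  by move=> iltn; rewrite /= iltn; have [] := hz0 i iltn.
(* Requiring [quad_rep] to be nonzero at the node excludes the cut points shared by consecutive
   pieces; this makes [J] injective. *)
have node (i : 'I_n.+1) : exists j : 'I_n, X j 0 \in `[z i, z i.+1] /\ quad_rep (X j 0) != 0.
  have ijn : (i <= n)%N by rewrite -ltnS.
  pose g := quad_rep \_ `[z i, z i.+1].
  have wg : wdiff a b g (weak_derivative a b quad_rep \_ `[z i, z i.+1]).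
    apply: (wdiff_cut ab) => //.
    - by have /andP[] := zab i.
    - exact: zlt.
    - by have /andP[] := zab i.+1.
    - case: (nat_of_ord i) ijn => [|i'] ijn'; [by left|right; exact: zk].
    - have [iltn|ngei] := ltnP i n; first by right; exact: zk.
      by left; rewrite /= ltnNge ngei.
  have Hg := wdiff_H1 rho_gt0 rho_cont rho_density wg.
  (* [Q g] is the inner product of [g] with [quad_rep], and [g] with its derivative is a restriction
     of [quad_rep] with its own, so [quad_rep] may be replaced by [g]. *)
  have gg : Q g = H1ip g g.
    rewrite -(quad_repE Hg) (H1ip_wdiff ab rho_gt0 rho_cont rho_density wg wk).
    rewrite (H1ip_wdiff ab rho_gt0 rho_cont rho_density wg wg).
    by congr (_ + _); apply: eq_Rintegral => x _; rewrite ?/g !patchE; case: ifP => // _;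
      rewrite !mul0r.
  have gt : g (t i) != 0.
    have [h1 h2] := zt i ijn.
    by rewrite /g patchE mem_set ?tn0//= in_itv/= h1.
  have [c0 c00 rho_ge] := density_ge rho_gt0 rho_cont.
  have [C C0 hC] := H1_sup_norm ab rho_gt0 rho_cont rho_density c00 rho_ge.
  have Qg : Q g != 0.
    apply: contra gt => /eqP Qg; have := hC g (t i) Hg (tab i ijn).
    by rewrite /Defs.H1norm -gg Qg sqrtr0 mulr0 normr_le0.
  apply: contrapT => nex; move: Qg; rewrite /quad big1 ?eqxx// => j _.
  have [jz|jz] := boolP (X j 0 \in `[z i, z i.+1]).
    have [kj|kj] := eqVneq (quad_rep (X j 0)) 0.
      by rewrite /g patchE; case: ifP => _; rewrite ?kj mulr0.
    by exfalso; apply: nex; exists j.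
  by rewrite /g patchE memNset ?mulr0//; exact/negP.
have [J hJ] := choice node.
have zmono i j : (i <= j)%N -> (j <= n.+1)%N -> z i <= z j.
  move=> ij jn; rewrite -(subnKC ij); have : (i + (j - i) <= n.+1)%N by rewrite subnKC.
  elim: (j - i)%N => [|d IH]; first by rewrite addn0.
  rewrite addnS => idn; rewrite (le_trans (IH (ltnW idn)))// ltW// zlt//.
have Jlt (i i' : 'I_n.+1) : (i < i')%N -> J i = J i' -> False.
  move=> ii' E; have [+ kX] := hJ i; have [+ _] := hJ i'.
  rewrite -E !in_itv/= => /andP[h1 _] /andP[_ h2].
  have iltn : (i < n)%N by rewrite (leq_trans ii')// -ltnS.
  have := zmono i.+1 i' ii' (ltnW (ltn_ord i')) => h3.
  have E' : X (J i) 0 = z i.+1 by apply/eqP; rewrite eq_le h2 (le_trans h3).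
  by move: kX; rewrite E' zk// eqxx.
have Jinj : injective J.
  move=> i i' E; apply/val_inj; case: (ltngtP i i') => // h.
    by case: (Jlt _ _ h E).
  by case: (Jlt _ _ h (esym E)).
by have := leq_card J Jinj; rewrite !card_ord ltnn.
Qed.

End quadrature.

(** * Stability of alternation *)

Section alternation_lemmas.
Context {R : realType} (a b : R).
Local Notation alternates := (alternates a b).

Lemma alternates_close (u w : R -> R) n e d : alternates u n e ->
  (forall x, x \in `[a, b] -> `|u x - w x| <= d) -> alternates w n (e - d).
Proof.
move=> [k [t [tab tt te]]] uw; exists k, t; split => // i ijn.
have h1 := te i ijn; have h2 := uw _ (tab i ijn).
have h3 : (-1) ^+ (i + k) * (u (t i) - w (t i)) <= d.
  rewrite (le_trans (ler_norm _))// normrM normrX normrN1 expr1n mul1r//.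
rewrite lerBlDr (le_trans h1)// -lerBlDl -mulrBr//.
Qed.

Lemma alternates_scale (u : R -> R) n e c : alternates u n e -> c != 0 ->
  alternates (fun x => c * u x) n (`|c| * e).
Proof.
move=> [k [t [tab tt te]]] c0; have [cn|cp|ce] := ltgtP c 0; last by rewrite ce eqxx in c0.
  exists k.+1, t; split => // i ijn.
  rewrite addnS exprS mulN1r ltr0_norm//.
  have -> : - (-1) ^+ (i + k) * (c * u (t i)) = - c * ((-1) ^+ (i + k) * u (t i)) by ring.
  by rewrite ler_wpM2l ?te// oppr_ge0 ltW.
exists k, t; split => // i ijn.
by rewrite gtr0_norm// mulrCA ler_wpM2l ?te// ltW.
Qed.

Lemma alternates_leq (u : R -> R) m n e : (n <= m)%N -> alternates u m e -> alternates u n e.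
Proof.
move=> nm [k [t [tab tt te]]]; exists k, t; split => i ijn.
- by apply: tab; exact: leq_trans nm.
- by apply: tt; exact: leq_trans nm.
- by apply: te; exact: leq_trans nm.
Qed.

End alternation_lemmas.

(** * The Sturm-Hurwitz argument *)

Section unisolvence.
Context {R : realType} (a b : R) (mu : probability (measurableTypeR R) R).
Context (rho : R -> R) (lambda : nat -> R) (phi : nat -> R -> R) (K : R -> R -> R).
Hypothesis ab : a < b.
Hypothesis rho_gt0 : forall x, x \in `[a, b] -> 0 < rho x.
Hypothesis rho_cont : {within `[a, b], continuous rho}.
Hypothesis rho_density : forall A : set (measurableTypeR R), measurable A ->
  mu A = (\int[lebesgue_measure]_(x in A `&` `[a, b]) (rho x)%:E)%E.
Hypothesis PB : poincare_basis a b mu lambda phi.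
Hypothesis KR : reproducing_kernel `[a, b] (H1 a b mu) (H1ip a b mu) K.

Local Notation al := (alpha lambda).
Local Notation r := (rho \o clamp a b).

Lemma phi_flux : exists f F : nat -> R -> R, forall m,
  {in `[a, b], phi m =1 f m} /\ flux a b r (f m) (F m) (fun x => - lambda m * f m x).
Proof.
have [f hf] := choice (eigenfunction_flux ab rho_gt0 rho_cont rho_density PB).
by have [F hF] := choice hf; exists f, F.
Qed.

Lemma phi_neq0 m : exists2 x, x \in `[a, b] & phi m x != 0.
Proof.
apply: contrapT => nex; have := poincare_orthonormal PB m m.
have -> : L2ip a b mu (phi m) (phi m) = \int[mu]_(x in `[a, b]) 0.
  apply: eq_Rintegral => x; rewrite inE/= => xab.
  have [->|h] := eqVneq (phi m x) 0; first by rewrite mul0r.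
  by exfalso; apply: nex; exists x.
by rewrite Rintegral_cst// mul0r eqxx => /esym/eqP; rewrite oner_eq0.
Qed.

Lemma phi_alternates m : exists2 e : R, 0 < e & alternates a b (phi m) m e.
Proof.
have [f [F hf]] := phi_flux.
have eqf (u w : R -> R) n e : {in `[a, b], u =1 w} -> alternates a b u n e -> alternates a b w n e.
  move=> uw h; have := alternates_close (d := 0) h; rewrite subr0; apply => x xab.
  by rewrite uw// subrr normr0.
suff [e e0 h] : exists2 e : R, 0 < e & alternates a b (f m) m e.
  by exists e => //; apply: eqf h => x xab; rewrite (hf m).1.
elim: m => [|m [e e0 IH]].
  exists 1 => //; exists 0%N, (fun=> a); split => // i.
    by rewrite in_itv/= lexx ltW.
  have aab : a \in `[a, b] by rewrite in_itv/= lexx ltW.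
  by rewrite leqn0 => /eqP ->; rewrite expr0 mul1r -(hf 0%N).1// (poincare_phi0 PB).
apply: (sturm_step ab (density_clamp_gt0 ab rho_gt0) (density_clamp_continuous ab rho_cont)
  e0 (hf m).2 (hf m.+1).2 (poincare_lambda_lt PB m) _ IH).
by have [x xab px] := phi_neq0 m.+1; exists x => //; rewrite -(hf m.+1).1.
Qed.

(** The [p]-th power of the resolvent applied to a partial sum with coefficients [c], since [phi m]
    is an eigenfunction of the resolvent with eigenvalue [al m]. *)
Definition smoothed (c : nat -> R) p N x := \sum_(m < N) (al m ^+ p * c m) * phi m x.

(** Power [p.+1] is the resolvent of power [p], because [al m * (1 + lambda m) = 1];
    [flux_alternates] then removes one power at a time without loss in [e]. *)
Lemma smoothed_alternates c p N n e : 0 < e ->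
  alternates a b (smoothed c p N) n e -> alternates a b (smoothed c 0 N) n e.
Proof.
move=> e0; elim: p => // p IH h; apply: IH.
have [f [F hf]] := phi_flux.
have fE q x : x \in `[a, b] ->
    smoothed c q N x = \sum_(m < N) (al m ^+ q * c m) * f m x.
  by move=> xab; apply: eq_bigr => m _; rewrite (hf m).1.
have fl := flux_sum N (fun m => al m ^+ p.+1 * c m) (fun m => (hf m).2).
have H : alternates a b (fun x => \sum_(m < N) (al m ^+ p.+1 * c m) * f m x) n e.
  have := alternates_close (d := 0) h; rewrite subr0; apply => x xab.
  by rewrite fE// subrr normr0.
have H' := flux_alternates ab (density_clamp_gt0 ab rho_gt0) e0 fl H.
have := alternates_close (d := 0) H'; rewrite subr0; apply => x xab.
rewrite fE// -sumrB -sumrB big1 ?normr0// => m _.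
rewrite exprS -[X in _ - X]mul1r -(alphaV PB m); ring.
Qed.

Lemma expr_lt_exists (q e : R) : 0 <= q -> q < 1 -> 0 < e -> exists p, q ^+ p <= e.
Proof.
move=> q0 q1 e0.
have : q ^+ p @[p --> \oo] --> 0 by apply: cvg_expr; rewrite ger0_norm.
move=> /cvgrPdist_le/(_ _ e0)[p _ /(_ p (leqnn p))/=].
by rewrite sub0r normrN ger0_norm ?exprn_ge0//; exists p.
Qed.

Lemma quad_unisolvent n (X v : 'cV[R]_n) M : (forall i, X i 0 \in `[a, b]) ->
  injective (fun i => X i 0) -> (n <= M.+1)%N ->
  (forall m, (m <= M)%N -> quad X v (phi m) = 0) -> v = 0.
Proof.
move=> Xab Xinj nM Qphi; apply: contrapT => v0.
have [i0 vi0] : exists i0, v i0 0 != 0.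
  apply: contrapT => nex; apply: v0; apply/matrixP => i j; rewrite ord1 mxE.
  by apply/eqP/negP => /negP h; apply: nex; exists i.
have n0 : (0 < n)%N by case: (i0) => ? /(leq_ltn_trans (leq0n _)).
have exm := quad_phi_neq0 ab rho_gt0 rho_cont rho_density PB Xab Xinj vi0.
pose m0 := ex_minn exm.
have [Qm0 m0min] : quad X v (phi m0) != 0 /\ forall m, quad X v (phi m) != 0 -> (m0 <= m)%N.
  by rewrite /m0; case: ex_minnP.
have nm0 : (n <= m0)%N.
  rewrite (leq_trans nM)// ltnNge; apply/negP => /Qphi E.
  by rewrite E eqxx in Qm0.
pose c m := al m * quad X v (phi m).
have c_lt m : (m < m0)%N -> c m = 0.
  move=> mm0; rewrite /c; have [->|/m0min] := eqVneq (quad X v (phi m)) 0; first by rewrite mulr0.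
  by rewrite leqNgt mm0.
have cm0 : c m0 != 0 by rewrite mulf_neq0// gt_eqF// (alpha_gt0 PB).
have [e e0 phi_alt] := phi_alternates m0.
have [B B0 hB] := Kpart_diag_le ab rho_gt0 rho_cont rho_density PB KR.
pose A := (\sum_(i < n) `|v i 0|) * B + 1.
have A0 : 0 < A.
  by apply: ltr_wpDl => //; apply: mulr_ge0; [exact: sumr_ge0|exact: ltW].
(* The product of [phi m (X i 0)] and [phi m x] is at most half the sum of their squares in absolute
   value, which reduces the claim to the diagonal bound [B], uniformly in [N]. *)
have hA N x : x \in `[a, b] -> \sum_(m < N) `|c m * phi m x| <= A.
  move=> xab.
  apply: (@le_trans _ _ (\sum_(i < n) `|v i 0| * B)); last by rewrite -mulr_suml lerDl.
  apply: (@le_trans _ _ (\sum_(i < n) `|v i 0| *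
      \sum_(m < N) (al m * phi m (X i 0) ^+ 2 + al m * phi m x ^+ 2) / 2)); last first.
    apply: ler_sum => i _; rewrite ler_wpM2l// -mulr_suml big_split/=.
    by have := hB N _ (Xab i); have := hB N x xab; lra.
  under [leRHS]eq_bigr do rewrite mulr_sumr.
  rewrite exchange_big/=; apply: ler_sum => m _.
  rewrite /c /quad mulr_sumr mulr_suml (le_trans (ler_norm_sum _ _ _))//.
  apply: ler_sum => i _; have a0 := alpha_gt0 PB m.
  rewrite !normrM (gtr0_norm a0) -mulrDr -!mulrA mulrCA ler_wpM2l//.
  rewrite ler_wpM2l ?(ltW a0)// -(real_normK (num_real (phi m (X i 0)))).
  rewrite -(real_normK (num_real (phi m x))).
  by have := sqr_ge0 (`|phi m (X i 0)| - `|phi m x|); rewrite sqrrB; nra.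
pose q := al m0.+1 / al m0.
have a00 := alpha_gt0 PB m0; have a10 := alpha_gt0 PB m0.+1.
have q0 : 0 <= q by rewrite divr_ge0 ?(ltW a00) ?(ltW a10).
have q1 : q < 1 by rewrite ltr_pdivrMr// mul1r (alpha_lt PB).
have ce0 : 0 < `|c m0| * e by rewrite mulr_gt0// normr_gt0.
(* After [p] resolvent steps the components beyond [m0] total at most [d], half of the margin of the
   [m0] component. The choice is uniform in [N]. *)
have [p hp] := expr_lt_exists q0 q1 (divr_gt0 ce0 (mulr_gt0 (ltr0Sn R 1) A0)).
pose d := al m0 ^+ p * `|c m0| * e / 2.
have d0 : 0 < d by rewrite divr_gt0// -mulrA mulr_gt0// exprn_gt0.
have tail : al m0.+1 ^+ p * A <= d.
  have -> : al m0.+1 ^+ p = q ^+ p * al m0 ^+ p.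
    by rewrite -exprMn divfK// gt_eqF.
  rewrite /d -!mulrA mulrCA ler_wpM2l ?exprn_ge0 ?(ltW a00)//.
  by move: hp; rewrite ler_pdivlMr ?mulr_gt0// [_ * (2 * A)]mulrCA [`|c m0| * (e / 2)]mulrA; lra.
have alt_p N : (m0 < N)%N -> alternates a b (smoothed c p N) n d.
  move=> m0N; apply: (alternates_leq nm0).
  have := alternates_scale phi_alt (mulf_neq0 (lt0r_neq0 (exprn_gt0 p a00)) cm0).
  move=> /(@alternates_close _ a b _ (smoothed c p N) _ _ d).
  have -> : `|al m0 ^+ p * c m0| * e - d = d.
    by rewrite normrM ger0_norm ?exprn_ge0 ?(ltW a00)// /d; field.
  apply => x xab; apply: le_trans tail; rewrite distrC /smoothed (bigD1 (Ordinal m0N))//=.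
  rewrite addrC addrK (le_trans (ler_norm_sum _ _ _))//.
  apply: (@le_trans _ _ (al m0.+1 ^+ p * \sum_(m < N) `|c m * phi m x|)); last first.
    by rewrite ler_wpM2l ?exprn_ge0 ?(ltW a10)// hA.
  rewrite [leRHS](_ : _ = \sum_(m < N) al m0.+1 ^+ p * `|c m * phi m x|) ?mulr_sumr//.
  rewrite [leRHS](bigD1 (Ordinal m0N))//= ler_wpDl ?mulr_ge0 ?exprn_ge0 ?(ltW a10)//.
  apply: ler_sum => m mm0; rewrite -mulrA normrM.
  have am := alpha_gt0 PB m.
  have [mlt|mgt|mE] := ltngtP m m0.
  - by rewrite c_lt// mul0r normr0 !mulr0.
  - rewrite ler_wpM2r// ger0_norm ?exprn_ge0 ?(ltW am)//.
    by rewrite lerXn2r ?nnegrE ?(ltW am) ?(ltW a10)// (alpha_le PB).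
  - by move: mm0; rewrite -val_eqE/= mE eqxx.
have Hk := quad_rep_H1 ab rho_gt0 rho_cont rho_density PB KR v Xab.
pose k := quad_rep K X v; pose nk := H1norm a b mu k.
have nk0 : 0 <= nk := H1norm_ge0 a b mu k.
have nk1 : 0 < nk + 1 by rewrite ltr_wpDl.
(* Only now is [N] chosen, with the partial sum within [d / 2] of [k]; this is legitimate because
   [d] does not depend on [N]. *)
have [N0 hN0] := residual_uniform ab rho_gt0 rho_cont rho_density PB
  (divr_gt0 (divr_gt0 d0 (ltr0Sn R 1)) nk1).
pose N := maxn N0 m0.+1.
have close x : x \in `[a, b] -> `|smoothed c 0 N x - k x| <= d / 2.
  move=> xab; have := hN0 N k x (leq_maxl _ _) Hk xab.
  rewrite -/nk => h; rewrite distrC (_ : k x - _ = residual a b mu phi k N x).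
    rewrite (le_trans h)// mulrAC ler_pdivrMr//.
    by rewrite ler_wpM2l ?(ltW (divr_gt0 d0 (ltr0Sn R 1)))// lerDl.
  congr (_ - _); apply: eq_bigr => m _.
  by rewrite (coef_quad_rep ab rho_gt0 rho_cont rho_density PB KR v Xab) expr0 mul1r.
have := alternates_close (smoothed_alternates d0 (alt_p N (leq_maxr _ _))) close.
have -> : d - d / 2 = d / 2 by field.
apply: (quad_rep_not_alternates ab rho_gt0 rho_cont rho_density PB KR Xab n0).
by rewrite divr_gt0.
Qed.

End unisolvence.

(** * Worst-case error *)

Section worst_case_error.
Context {R : realType} (a b : R) (mu : probability (measurableTypeR R) R).
Context (rho : R -> R) (lambda : nat -> R) (phi : nat -> R -> R) (K : R -> R -> R).
Hypothesis ab : a < b.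
Hypothesis rho_gt0 : forall x, x \in `[a, b] -> 0 < rho x.
Hypothesis rho_cont : {within `[a, b], continuous rho}.
Hypothesis rho_density : forall A : set (measurableTypeR R), measurable A ->
  mu A = (\int[lebesgue_measure]_(x in A `&` `[a, b]) (rho x)%:E)%E.
Hypothesis PB : poincare_basis a b mu lambda phi.
Hypothesis KR : reproducing_kernel `[a, b] (H1 a b mu) (H1ip a b mu) K.

Local Notation H1 := (H1 a b mu).
Local Notation L2ip := (L2ip a b mu).
Local Notation H1ip := (H1ip a b mu).
Local Notation H1norm := (H1norm a b mu).
Local Notation al := (alpha lambda).
Let H1l := fun f g c => @H1_lin R a b mu rho ab rho_gt0 rho_cont rho_density f g c.
Let H1il := fun f g h c => @H1ip_lin R a b mu rho ab rho_gt0 rho_cont rho_density f g h c.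

Lemma Rintegral_phi0 (h : R -> R) : \int[mu]_(x in `[a, b]) h x = L2ip h (phi 0%N).
Proof.
apply: eq_Rintegral => x; rewrite inE/= => xab.
by have -> := poincare_phi0 PB xab; rewrite mulr1.
Qed.

Lemma H1ip_phi0 (h : R -> R) : H1 h -> H1ip h (phi 0%N) = \int[mu]_(x in `[a, b]) h x.
Proof.
move=> Hh; rewrite (H1ip_phi_r PB _ Hh) (poincare_lambda0 PB) addr0 mul1r.
by rewrite Rintegral_phi0.
Qed.

Lemma Rintegral_phi m : \int[mu]_(x in `[a, b]) phi m x = (m == 0%N)%:R.
Proof. by rewrite Rintegral_phi0 (poincare_orthonormal PB). Qed.

Lemma alpha0 : al 0 = 1.
Proof. by rewrite /alpha (poincare_lambda0 PB) addr0 invr1. Qed.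

Variables (n : nat) (X w : 'cV[R]_n).
Hypothesis Xab : forall i, X i 0 \in `[a, b].
Local Notation Q := (quad X w).
Local Notation k := (quad_rep K X w).

Let kH1 := quad_rep_H1 ab rho_gt0 rho_cont rho_density PB KR w Xab.
Let kE := quad_repE ab rho_gt0 rho_cont rho_density KR w Xab.

(** [phi 0] stands for the constant 1: it equals 1 on [a, b] and is already known to be in H^1. *)
Definition error_rep x := phi 0%N x + -1 * k x.

Lemma error_rep_H1 : H1 error_rep.
Proof. by apply: H1l; [exact: phi_H1 PB 0%N|exact: kH1]. Qed.

Lemma error_repE h : H1 h ->
  H1ip h error_rep = \int[mu]_(x in `[a, b]) h x - Q h.
Proof.
move=> Hh.
rewrite (ip_linr (H1ipC a b mu) H1il (-1) (phi_H1 PB 0%N) kH1 Hh).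
by rewrite H1ip_phi0// (kE Hh) mulN1r.
Qed.

Lemma wceE : wce a b mu X w H1 H1norm = (H1norm error_rep)%:E.
Proof.
set N := H1norm error_rep.
have N0 : 0 <= N := H1norm_ge0 a b mu error_rep.
have NN : N ^+ 2 = H1ip error_rep error_rep := H1normE a b mu error_rep.
have HE := error_rep_H1.
apply/eqP; rewrite eq_le; apply/andP; split.
  apply: ge_ereal_sup => _ [h [Hh h1] <-]; rewrite lee_fin -error_repE//.
  apply: (le_trans (H1_cauchy_schwarz ab rho_gt0 rho_cont rho_density Hh HE)).
  by rewrite -/N -[leRHS]mul1r ler_wpM2r.
apply: ereal_sup_ubound.
have HZ := H_zero H1l HE.
(* The supremum is attained at the normalized representative. If [N = 0], then [N^-1 = 0] and the
   candidate is the zero function, which gives the value 0 as wanted. *)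
have Hg := H1l N^-1 HZ HE.
exists (fun x => 0 + N^-1 * error_rep x).
  split => //.
  rewrite /Defs.H1norm -[leRHS]sqrtr1; apply: ler_wsqrtr.
  rewrite (ip_expand H1l (H1ipC a b mu) H1il N^-1 HZ HE).
  rewrite (ip_zero H1il HZ) (ip_zero H1il HE) mulr0 !add0r -NN -exprMn.
  move: (N) => N1; have [->|n0] := eqVneq N1 0; first by rewrite mulr0 expr0n.
  by rewrite mulVf// expr1n.
congr EFin; rewrite -error_repE// (H1il N^-1 HZ HE HE) (ip_zero H1il HE) add0r -NN.
move: (N) N0 => N1 N0; have [->|n0] := eqVneq N1 0; first by rewrite expr0n/= mulr0 normr0.
by rewrite expr2 mulrA mulVf// mul1r ger0_norm.
Qed.

Hypothesis Qexact0 : Q (phi 0%N) = 1.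

Lemma error_rep_sqr : H1norm error_rep ^+ 2 = Q k - 1.
Proof.
rewrite (H1normE a b mu) (ip_expand H1l (H1ipC a b mu) H1il (-1) (phi_H1 PB 0%N) kH1).
rewrite (kE (phi_H1 PB 0%N)) (kE kH1) Qexact0 (H1ip_phi0 (phi_H1 PB 0%N)).
rewrite Rintegral_phi eqxx (_ : true%:R = 1 :> R)//.
by move: (Q k) => q; ring.
Qed.

Lemma quad_rep_mx : Q k = (w^T *m kernel_mx K X *m w) 0 0.
Proof.
rewrite -mulmxA mxE /quad; apply: eq_bigr => i _; rewrite !mxE; congr (_ * _).
by apply: eq_bigr => j _; rewrite mxE mulrC.
Qed.

(** [Q] applied to the eigenfunction expansion of [k], which converges uniformly and hence at the
    nodes. *)
Lemma quad_rep_cvg : \sum_(m < N) al m * Q (phi m) ^+ 2 @[N --> \oo] --> Q k.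
Proof.
apply/cvgrPdist_le => e e0.
pose V := \sum_(i < n) `|w i 0|; have V0 : 0 <= V by apply: sumr_ge0.
pose nk := H1norm k; have nk0 : 0 <= nk := H1norm_ge0 a b mu k.
have B0 : 0 < V * nk + 1 by rewrite ltr_wpDl// mulr_ge0.
have [N0 hN0] := residual_uniform ab rho_gt0 rho_cont rho_density PB (divr_gt0 e0 B0).
exists N0 => // N /= N0N.
have -> : Q k - \sum_(m < N) al m * Q (phi m) ^+ 2 = Q (residual a b mu phi k N).
  have -> : \sum_(m < N) al m * Q (phi m) ^+ 2 =
      Q (fun x => \sum_(m < N) coef a b mu phi k m * phi m x).
    rewrite quad_phi_sum; apply: eq_bigr => m _.
    by rewrite (coef_quad_rep ab rho_gt0 rho_cont rho_density PB KR w Xab) -mulrA.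
  by rewrite /quad -sumrB; apply: eq_bigr => i _; rewrite -mulrBr.
have := quad_le w Xab (fun x xab => hN0 N k x N0N kH1 xab).
rewrite -/V -/nk => h; apply: (le_trans h).
rewrite mulrCA -mulrA ler_piMr ?(ltW e0)// mulrC ler_pdivrMr// mul1r.
by rewrite lerDl.
Qed.

Variable M : nat.
Hypothesis Qexact : forall m, (m <= M)%N -> Q (phi m) = (m == 0%N)%:R.
Local Notation KM := (truncated_kernel lambda phi M).

Lemma truncated_kernel_quad : kernel_mx KM X *m w = const_mx 1.
Proof.
apply/matrixP => i j; rewrite ord1 !mxE.
transitivity (\sum_(m < M.+1) al m * phi m (X i 0) * Q (phi m)).
  under eq_bigr do rewrite !mxE /truncated_kernel mulr_suml.
  rewrite exchange_big; apply: eq_bigr => m _; rewrite mulr_sumr; apply: eq_bigr => l _.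
  ring.
rewrite (bigD1 ord0)//= big1 ?addr0.
  by rewrite Qexact// eqxx/= mulr1 alpha0 mul1r; rewrite (poincare_phi0 PB (Xab i)).
move=> m m0; rewrite Qexact ?leq_ord//.
by rewrite (negbTE (_ : (m : nat) != 0%N))// mulr0.
Qed.

Lemma quad_const_mx1 : (w^T *m const_mx 1) 0 (0 : 'I_1) = 1 :> R.
Proof.
rewrite -[RHS]Qexact0 mxE; apply: eq_bigr => i _; rewrite !mxE.
by rewrite (poincare_phi0 PB (Xab i)).
Qed.

(** With K_M w = 1, the value w^T K_M w = w^T 1 = 1 is the constant subtracted in
    [error_rep_sqr]. *)
Lemma error_rep_mx :
  H1norm error_rep ^+ 2 = (w^T *m (kernel_mx K X - kernel_mx KM X) *m w) 0 0.
Proof.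
rewrite error_rep_sqr mulmxBr mulmxBl -[w^T *m kernel_mx KM X *m w]mulmxA.
rewrite truncated_kernel_quad [RHS]mxE -quad_rep_mx; congr (_ + _).
by rewrite [RHS]mxE quad_const_mx1.
Qed.

Lemma error_rep_sum :
  (\sum_(M.+1 <= m <oo) (al m * Q (phi m) ^+ 2)%:E)%E = (H1norm error_rep ^+ 2)%:E.
Proof.
apply/cvg_lim => //; rewrite error_rep_sqr.
(* By exactness only [m = 0] contributes, so the constant 1 in [error_rep_sqr] removes precisely the
   first [M + 1] terms of the series for [Q k]. *)
have S1 : \sum_(m < M.+1) al m * Q (phi m) ^+ 2 = 1.
  rewrite (bigD1 ord0)//= big1 ?addr0 => [|m m0].
    by rewrite Qexact// eqxx/= expr1n mulr1 alpha0.
  by rewrite Qexact ?leq_ord// (negbTE (_ : (m : nat) != 0%N))// expr0n/= mulr0.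
have E N : (M < N)%N -> (\sum_(M.+1 <= m < N) (al m * Q (phi m) ^+ 2)%:E)%E =
    (\sum_(m < N) al m * Q (phi m) ^+ 2 - 1)%:E.
  move=> MN; rewrite sumEFin -(big_mkord xpredT (fun m => al m * Q (phi m) ^+ 2)).
  rewrite (@big_cat_nat _ _ _ M.+1 0 N)//= (big_mkord xpredT) S1.
  by rewrite addrAC subrr add0r.
have H : (\sum_(m < N) al m * Q (phi m) ^+ 2 - 1)%:E @[N --> \oo] --> (Q k - 1)%:E.
  by apply: cvg_EFin; [exact: nearW|apply: cvgB; [exact: quad_rep_cvg|exact: cvg_cst]].
apply: cvg_trans H; apply: near_eq_cvg; near=> N; rewrite E//.
by near: N; exact: nbhs_infty_gt.
Unshelve. all: by end_near. Qed.

Lemma kernel_sup_norm_le e : (forall x y, x \in `[a, b] -> y \in `[a, b] ->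
  `|K x y - KM x y| <= e) ->
  (kernel_sup_norm a b (fun x y => (K x y - KM x y)%R) <= e%:E)%E.
Proof.
move=> h; apply: ge_ereal_sup => _ [p [p1 p2] <-]; rewrite lee_fin.
exact: h.
Qed.

Hypothesis w_gt0 : forall i, 0 < w i 0.

(** The weights are positive and sum to 1, so the quadratic form is a weighted average of values of
    K - K_M. *)
Lemma error_rep_le_sup :
  ((H1norm error_rep)%:E <= sqrte (kernel_sup_norm a b (fun x y => (K x y - KM x y)%R)))%E.
Proof.
set s := kernel_sup_norm _ _ _.
have ub x y : x \in `[a, b] -> y \in `[a, b] -> (`|K x y - KM x y|%:E <= s)%E.
  by move=> xab yab; apply: ereal_sup_ubound; exists (x, y).
have s0 : (0 <= s)%E.
  have aab : a \in `[a, b] by rewrite in_itv/= lexx ltW.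
  by apply: le_trans (ub a a aab aab); rewrite lee_fin.
case: s s0 ub => [s| |] // s0 ub; last by rewrite leey.
rewrite lee_fin -[leLHS]ger0_norm ?H1norm_ge0// -sqrtr_sqr; apply: ler_wsqrtr.
rewrite error_rep_mx -mulmxA mxE.
apply: (@le_trans _ _ (\sum_(i < n) w i 0 * (\sum_(j < n) w j 0 * s))).
  apply: ler_sum => i _; rewrite mxE ler_wpM2l ?(ltW (w_gt0 i))// mxE.
  apply: ler_sum => j _; rewrite mulrC ler_wpM2l ?(ltW (w_gt0 j))// !mxE.
  by rewrite (le_trans (ler_norm _))// -lee_fin ub.
have w1 : \sum_(j < n) w j 0 = 1.
  rewrite -[RHS]Qexact0; apply: eq_bigr => j _; by rewrite (poincare_phi0 PB (Xab j)) mulr1.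
by rewrite -mulr_suml -mulr_suml w1 !mul1r.
Qed.

(** For a row [u] in the kernel, u K_M u^T = 0 is a sum of squares with positive coefficients
    [al l]; the functional with weights [u] thus annihilates phi_0, ..., phi_M, and unisolvence
    gives [u = 0]. *)
Lemma truncated_kernel_unit : injective (fun i => X i 0) -> (n <= M.+1)%N ->
  kernel_mx KM X \in unitmx.
Proof.
move=> Xinj nM; rewrite -row_free_unit; apply: inj_row_free => u uK.
suff : u^T = 0 by move=> /(congr1 trmx); rewrite trmxK trmx0.
apply: (quad_unisolvent ab rho_gt0 rho_cont rho_density PB KR Xab Xinj nM) => m mM.
have : (u *m kernel_mx KM X *m u^T) 0 0 = \sum_(l < M.+1) al l * quad X u^T (phi l) ^+ 2.
  rewrite -mulmxA mxE; under eq_bigr do rewrite !mxE mulr_sumr.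
  under [RHS]eq_bigr do rewrite expr2 /quad mulr_sumr mulr_sumr.
  rewrite [RHS]exchange_big; apply: eq_bigr => i _ /=.
  under [RHS]eq_bigr do rewrite mulr_suml mulr_sumr.
  rewrite [RHS]exchange_big; apply: eq_bigr => j _ /=.
  rewrite !mxE /truncated_kernel mulr_suml mulr_sumr; apply: eq_bigr => l _; ring.
rewrite uK mul0mx mxE => /esym/eqP; rewrite psumr_eq0 => [|l _]; last first.
  by rewrite mulr_ge0 ?sqr_ge0// ltW// (alpha_gt0 PB).
move=> /allP/(_ (Ordinal (mM : (m < M.+1)%N)) (mem_index_enum _)) /=.
by rewrite mulf_eq0 gt_eqF ?(alpha_gt0 PB)//= sqrf_eq0 => /eqP.
Qed.

Lemma truncated_kernel_mx_sym : (kernel_mx KM X)^T = kernel_mx KM X.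
Proof.
apply/matrixP => i j; rewrite !mxE; apply: eq_bigr => m _; by rewrite mulrAC.
Qed.

Lemma error_rep_invmx (one := const_mx 1 : 'cV[R]_n) : kernel_mx KM X \in unitmx ->
  H1norm error_rep ^+ 2 = (one^T *m invmx (kernel_mx KM X) *m
    (kernel_mx K X - kernel_mx KM X) *m invmx (kernel_mx KM X) *m one) 0 0.
Proof.
move=> U; rewrite error_rep_mx.
have E : invmx (kernel_mx KM X) *m one = w.
  by rewrite /one -truncated_kernel_quad mulmxA mulVmx// mul1mx.
have E' : one^T *m invmx (kernel_mx KM X) = w^T.
  by rewrite -[in RHS]E trmx_mul trmx_inv truncated_kernel_mx_sym.
by rewrite E' -[_ *m one]mulmxA E.
Qed.

End worst_case_error.

Theorem proposition9 (R : realType) (a b : R)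
    (mu : probability (measurableTypeR R) R)
    (lambda : nat -> R) (phi : nat -> R -> R) (K : R -> R -> R) :
  a < b ->
  bounded_perturbation a b mu ->
  poincare_basis a b mu lambda phi ->
  reproducing_kernel `[a, b] (H1 a b mu) (H1ip a b mu) K ->
  (forall (n : nat) (X w : 'cV[R]_n), (0 < n)%N ->
    poincare_quadrature a b mu phi X w ->
    let M := (2 * n).-1 in
    let wce_n := wce a b mu X w (H1 a b mu) (H1norm a b mu) in
    let KX := kernel_mx K X in
    let KMX := kernel_mx (truncated_kernel lambda phi M) X in
    let one : 'cV[R]_n := const_mx 1 in
    [/\ (wce_n ^+ 2 = \sum_(M.+1 <= m <oo)
           (alpha lambda m * (quad X w (phi m)) ^+ 2)%:E)%E,
        (wce_n ^+ 2 = ((w^T *m (KX - KMX) *m w) 0 0)%:E)%E,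
        KMX \in unitmx,
        (wce_n ^+ 2 =
          ((one^T *m invmx KMX *m (KX - KMX) *m invmx KMX *m one) 0 0)%:E)%E &
        (wce_n <= sqrte (kernel_sup_norm a b
           (fun x y => (K x y - truncated_kernel lambda phi M x y)%R)))%E]) /\
  sqrte (kernel_sup_norm a b
           (fun x y => K x y - truncated_kernel lambda phi (2 * n).-1 x y))
    @[n --> \oo] --> (0 : \bar R)%E.
Proof.
move=> ab [rho [rho_gt0 rho_cont _ rho_density]] PB KR; split.
- move=> n X w n0 [Xab Xinj w_gt0 exact] M wce_n KX KMX one.
  have Qexact m : (m <= M)%N -> quad X w (phi m) = (m == 0%N)%:R.
    by move=> mM; rewrite -exact// (Rintegral_phi PB).
  have Q0 : quad X w (phi 0%N) = 1 by rewrite Qexact.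
  have nM : (n <= M.+1)%N by rewrite /M prednK ?muln_gt0// leq_pmull.
  have U : KMX \in unitmx.
    exact: (truncated_kernel_unit ab rho_gt0 rho_cont rho_density PB KR Xab Xinj nM).
  have wce2 : (wce_n ^+ 2 = (H1norm a b mu (error_rep phi K X w) ^+ 2)%:E)%E.
    by rewrite /wce_n (wceE ab rho_gt0 rho_cont rho_density PB KR w Xab).
  split => //.
  + by rewrite wce2 (error_rep_sum ab rho_gt0 rho_cont rho_density PB KR Xab Q0 Qexact).
  + by rewrite wce2 (error_rep_mx ab rho_gt0 rho_cont rho_density PB KR Xab Q0 Qexact).
  + by rewrite wce2 (error_rep_invmx ab rho_gt0 rho_cont rho_density PB KR Xab Q0 Qexact).
  + rewrite /wce_n (wceE ab rho_gt0 rho_cont rho_density PB KR w Xab).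
    exact: (error_rep_le_sup ab rho_gt0 rho_cont rho_density PB KR Xab Q0 Qexact w_gt0).
- have s0 M : (0 <= kernel_sup_norm a b
      (fun x y => (K x y - truncated_kernel lambda phi M x y)%R))%E.
    apply: (@le_trans _ _ (`|K a a - truncated_kernel lambda phi M a a|%:E)).
      by rewrite lee_fin.
    apply: ereal_sup_ubound; exists (a, a) => //=; split => /=; by rewrite in_itv/= lexx ltW.
  have small e : 0 < e -> exists N, forall n, (N <= n)%N ->
      (kernel_sup_norm a b (fun x y => (K x y - truncated_kernel lambda phi (2 * n).-1 x y)%R)
        <= (e ^+ 2)%:E)%E.
    move=> e0; have [N0 hN0] := K_uniform ab rho_gt0 rho_cont rho_density PB KR (exprn_gt0 2 e0).
    (* The lower bound 1 excludes [n = 0], for which [(2 * n).-1.+1] is 1 and not [2 * n]. *)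
    exists (maxn N0 1) => n; rewrite geq_max => /andP[N0n n0].
    apply: kernel_sup_norm_le => x y xab yab.
    have := hN0 (2 * n)%N x y (leq_trans N0n (leq_pmull _ _)) xab yab.
    by rewrite /Kpart /truncated_kernel prednK ?muln_gt0//; exact.
  have sq (s : \bar R) (e : R) : (0 <= s)%E -> 0 < e -> (s <= (e ^+ 2)%:E)%E ->
      sqrte s \is a fin_num /\ `|fine (sqrte s)| <= e.
    case: s => [s| |] //= s0' e0; rewrite lee_fin => se; split => //.
    rewrite ger0_norm ?sqrtr_ge0// -[leRHS](ger0_norm (ltW e0)) -sqrtr_sqr.
    exact: ler_wsqrtr.
  apply/fine_cvgP; split.
    have [N hN] := small 1 ltr01; exists N => // n /= Nn.
    by have [] := sq _ _ (s0 _) ltr01 (hN n Nn).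
  apply/cvgrPdist_le => e e0; have [N hN] := small e e0; exists N => // n /= Nn.
  rewrite sub0r normrN.
  by have [] := sq _ _ (s0 _) e0 (hN n Nn).
Qed.
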